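(* Let $p\ge2$, let $u\in\tilde W^{2p+1,\infty}_\beta(\Omega)$ be the exact solution of the interface problem, and let $u_{\mathcal T}\in U_{\mathcal T}$ be the IFV solution (with $h$ sufficiently small). Then there is a constant $C$ independent of $h$, depending on $\rho$, $\gamma$, $c$, $p$ (and the shape-regularity constant), such that: (1) (supercloseness) $\|u_{\mathcal T}-\mathcal I_hu\|_{0,\infty}\le Ch^{p+2}\|u\|_{2p+1,\infty}$; (2) for every (generalized) Lobatto point $l_{i,j}$, i.e. every zero of $\phi_{i,p+1}$ in $\tau_i$, $|(u-u_{\mathcal T})(l_{i,j})|\le Ch^{p+2}\|u\|_{2p+1,\infty}$; (3) for every Gauss point, $|\beta(u-u_{\mathcal T})'(g_{i,j})|\le Ch^{p+1}\|u\|_{2p+1,\infty}$, $1\le i\le N$, $1\le j\le p$; (4) if moreover $\gamma=c=0$, then for all $1\le i\le N$, $1\le j\le p$, $$|\beta(u-u_{\mathcal T})'(g_{i,j})|\le Ch^{2p}\|u\|_{2p+1,\infty},\quad |(u-u_{\mathcal T})(x_i)|\le Ch^{2p}\|u\|_{2p+1,\infty},$$ $$|(u-u_{\mathcal T})(x_i)-(u-u_{\mathcal T})(x_{i-1})|\le Ch^{2p+1}\|u\|_{2p+1,\infty}.$$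
   Context: Setting. Let $\Omega=(a,b)$ and let $\alpha\in\Omega$ be an interface point, $\Omega^-=(a,\alpha)$, $\Omega^+=(\alpha,b)$. Let $\beta(x)=\beta^-$ on $\Omega^-$ and $\beta(x)=\beta^+$ on $\Omega^+$ with constants $\beta^\pm>0$; put $\rho=\max\{\beta^\pm\}/\min\{\beta^\pm\}$. For a function $v$, $[v(\alpha)]=\lim_{x\to\alpha^+}v(x)-\lim_{x\to\alpha^-}v(x)$. The interface problem is: $-(\beta u')'+\gamma u'+cu=f$ on $\Omega^-\cup\Omega^+$, $u(a)=u(b)=0$, $[u(\alpha)]=0$, $[\beta u'(\alpha)]=0$, where $\gamma\in\mathbb R$ and $c\ge0$ are constants and $f$ is given. Spaces. For $m\ge1$, $q\ge1$: $\tilde W^{m,q}_\beta(\Omega)=\{v\in C(\bar\Omega): v|_{\Omega^\pm}\in W^{m,q}(\Omega^\pm),\ v(a)=v(b)=0,\ [\beta v^{(j)}(\alpha)]=0,\ j=1,\dots,m\}$ with $\|v\|_{m,q}^q=\|v\|^q_{W^{m,q}(\Omega^-)}+\|v\|^q_{W^{m,q}(\Omega^+)}$ (usual modification for $q=\infty$); $\|v\|_{0,\infty}=\sup_\Omega|v|$. Mesh. $a=x_0<x_1<\dots<x_{k-1}<\alpha<x_k<\dots<x_N=b$, $\tau_i=[x_{i-1},x_i]$, $h_i=x_i-x_{i-1}$, $h=\max_i h_i$; the meshes are shape regular. $\tau_k$ is the interface element. Let $\xi_i(x)=(2x-x_{i-1}-x_i)/h_i$ map $\tau_i$ onto $[-1,1]$,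 and $\hat\alpha=\xi_k(\alpha)$. Generalized orthogonal polynomials. Let $\hat\beta(\xi)=\beta^-$ for $\xi\in(-1,\hat\alpha)$, $\hat\beta(\xi)=\beta^+$ for $\xi\in(\hat\alpha,1)$, and $w=1/\hat\beta$. $P_n$ denotes the standard Legendre polynomial of degree $n$ on $[-1,1]$; $\psi_0=(1-\xi)/2$, $\psi_1=(1+\xi)/2$, $\psi_n(\xi)=\int_{-1}^\xi P_{n-1}(t)\,dt$ ($n\ge2$) are the Lobatto polynomials. The generalized Legendre polynomials $L_n$ are polynomials of degree $n$ with $\int_{-1}^1 w L_nL_m\,d\xi=0$ for $m\ne n$. The generalized Lobatto functions are: with $D=(1-\hat\alpha)\beta^-+(1+\hat\alpha)\beta^+$, $\phi_0=\frac{(1-\hat\alpha)\beta^-+(\hat\alpha-\xi)\beta^+}{D}$ on $(-1,\hat\alpha)$, $\phi_0=\frac{(1-\xi)\beta^-}{D}$ on $(\hat\alpha,1)$; $\phi_1=\frac{(1+\xi)\beta^+}{D}$ on $(-1,\hat\alpha)$, $\phi_1=\frac{(\xi-\hat\alpha)\beta^-+(1+\hat\alpha)\beta^+}{D}$ on $(\hat\alpha,1)$; $\phi_n(\xi)=\int_{-1}^\xi w(t)L_{n-1}(t)\,dt$ for $n\ge2$. Local functions: $\phi_{i,n}(x)=\psi_n(\xi_i(x))$ for $i\ne k$, $\phi_{k,n}(x)=\phi_n(\xi_k(x))$; $P_{i,n}(x)=P_n(\xi_i(x))$ for $i\ne k$, $P_{k,n}(x)=L_n(\xi_k(x))$. Gauss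 points. Fix the degree $p$. The (generalized) Gauss points $g_{i,1}<\dots<g_{i,p}$ are the $p$ zeros of $P_{i,p}$ in $\tau_i$. Trial space. $U_{\mathcal T}=\{v\in C(\bar\Omega): v|_{\tau_i}\in\mathrm{span}\{\phi_{i,n}:0\le n\le p\}\ \forall i,\ v(a)=v(b)=0\}$. Test space. Let $p_i=p$ for $i<N$, $p_N=p-1$, and $g_{i,p+1}:=g_{i+1,1}$ for $i<N$. The test space $V_{\mathcal T'}$ consists of functions $v_{\mathcal T'}=\sum_{i=1}^N\sum_{j=1}^{p_i}v_{i,j}\chi_{[g_{i,j},g_{i,j+1}]}$ with real constants $v_{i,j}$. IFV method. The IFV solution is $u_{\mathcal T}\in U_{\mathcal T}$ such that for all $(i,j)$ with $1\le i\le N$, $1\le j\le p_i$: $\beta u_{\mathcal T}'(g_{i,j})-\beta u_{\mathcal T}'(g_{i,j+1})+\int_{g_{i,j}}^{g_{i,j+1}}(\gamma u_{\mathcal T}'+cu_{\mathcal T})\,dx=\int_{g_{i,j}}^{g_{i,j+1}}f\,dx$. Gauss–Lobatto projection. For $u\in\tilde W^{m,q}_\beta(\Omega)$, on each $\tau_i$ set $u_{i,0}=u(x_{i-1})$, $u_{i,1}=u(x_i)$, and for $n\ge2$, $u_{i,n}=\int_{\tau_i}\beta u'\phi_{i,n}'\,dx\big/\int_{\tau_i}\beta(\phi_{i,n}')^2dx$; then $(\mathcal I_hu)|_{\tau_i}=\sum_{n=0}^pu_{i,n}\phi_{i,n}$.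
   Formalization: The constant C may depend on β⁻ and β⁺ themselves (and on the fixed a, b, α), not only on ρ, γ, c, p and shape regularity; dependence on ρ alone fails in (4), since for γ=c=0 scaling β scales the flux error but leaves u and u_T unchanged. *)

(* Defs.v *)
From Stdlib Require Import Reals Lra Lia Arith ClassicalEpsilon.
Open Scope R_scope.

(** Total Riemann integral: the Riemann integral of [g] over [x,y] when [g]
    is Riemann integrable there (independent of the integrability proof),
    and 0 otherwise.  All integrands used below are Riemann integrable. *)
Definition RInt (g : R -> R) (x y : R) : R :=
  match excluded_middle_informative (exists pr : Riemann_integrable g x y, True) with
  | left H => RiemannInt (proj1_sig (constructive_indefinite_description _ H))
  | right _ => 0
  end.

Fixpoint sumR (n : nat) (f : nat -> R) : R :=
  match n with O => 0 | S m => sumR m f + f m end.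

(** Standard Legendre polynomials (Bonnet recursion): Leg n = P_n on [-1,1]. *)
Fixpoint leg2 (n : nat) (t : R) : R * R :=
  match n with
  | O => (1, t)
  | S m => let (a, b) := leg2 m t in
           (b, ((2 * INR m + 3) * t * b - (INR m + 1) * a) / (INR m + 2))
  end.
Definition Leg (n : nat) (t : R) : R := fst (leg2 n t).

Definition is_poly_deg (q : R -> R) (n : nat) : Prop :=
  exists cs : nat -> R, cs n <> 0 /\
    forall t, q t = sumR (S n) (fun m => cs m * t ^ m).

Definition psi (n : nat) (t : R) : R :=
  match n with
  | O => (1 - t) / 2
  | S O => (1 + t) / 2
  | S m => RInt (Leg m) (-1) t
  end.
Definition dpsi (n : nat) (t : R) : R :=
  match n with
  | O => - / 2
  | S O => / 2
  | S m => Leg m t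
  end.

Fixpoint hmax (X : nat -> R) (n : nat) : R :=
  match n with O => 0 | S m => Rmax (hmax X m) (X (S m) - X m) end.

Section IFV.
(* beta^-, beta^+, interface alpha, mesh nodes X 0 < ... < X N,
   interface element index k, degree p, generalized Legendre family L *)
Variables (bm bp al : R) (X : nat -> R) (N k p : nat) (L : nat -> R -> R).

Definition betaf (x : R) : R := if Rle_dec x al then bm else bp.

Definition xi (i : nat) (x : R) : R := (2 * x - X (i - 1) - X i) / (X i - X (i - 1)).
Definition ahat : R := xi k al.
Definition Dden : R := (1 - ahat) * bm + (1 + ahat) * bp.
Definition what (t : R) : R := if Rle_dec t ahat then / bm else / bp.

Definition is_gen_legendre : Prop :=
  (forall n, is_poly_deg (L n) n) /\
  (forall m n, m <> n -> RInt (fun t => what t * L m t * L n t) (-1) 1 = 0).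

Definition gphi (n : nat) (t : R) : R :=
  match n with
  | O => if Rle_dec t ahat then ((1 - ahat) * bm + (ahat - t) * bp) / Dden
         else (1 - t) * bm / Dden
  | S O => if Rle_dec t ahat then (1 + t) * bp / Dden
           else ((t - ahat) * bm + (1 + ahat) * bp) / Dden
  | S m => RInt (fun s => what s * L m s) (-1) t
  end.
Definition dgphi (n : nat) (t : R) : R :=
  match n with
  | O => if Rle_dec t ahat then - bp / Dden else - bm / Dden
  | S O => if Rle_dec t ahat then bp / Dden else bm / Dden
  | S m => what t * L m t
  end.

Definition lphi (i n : nat) (x : R) : R :=
  if Nat.eqb i k then gphi n (xi i x) else psi n (xi i x).
Definition ldphi (i n : nat) (x : R) : R :=
  2 / (X i - X (i - 1)) *
  (if Nat.eqb i k then dgphi n (xi i x) else dpsi n (xi i x)).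
Definition Pin (i n : nat) (x : R) : R :=
  if Nat.eqb i k then L n (xi i x) else Leg n (xi i x).

(** a function in U_T given by coefficients cf i n (element i, mode n):
    its restriction to tau_i, derivative on tau_i, and flux beta v' on tau_i *)
Definition loc (cf : nat -> nat -> R) (i : nat) (x : R) : R :=
  sumR (S p) (fun n => cf i n * lphi i n x).
Definition dloc (cf : nat -> nat -> R) (i : nat) (x : R) : R :=
  sumR (S p) (fun n => cf i n * ldphi i n x).
Definition fluxT (cf : nat -> nat -> R) (i : nat) (x : R) : R :=
  betaf x * dloc cf i x.

(** global function on (a,b] glued from element-wise functions F i *)
Definition glob (F : nat -> R -> R) (x : R) : R :=
  sumR N (fun i0 => if Rlt_dec (X i0) x then
                      if Rle_dec x (X (S i0)) then F (S i0) x else 0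
                    else 0).

Definition in_UT (cf : nat -> nat -> R) : Prop :=
  (forall i, (1 <= i < N)%nat -> loc cf i (X i) = loc cf (S i) (X i)) /\
  loc cf 1 (X 0) = 0 /\ loc cf N (X N) = 0.

Definition is_gauss (g : nat -> nat -> R) : Prop :=
  forall i, (1 <= i <= N)%nat ->
    (forall j, (1 <= j < p)%nat -> g i j < g i (S j)) /\
    (forall j, (1 <= j <= p)%nat ->
        X (i - 1) <= g i j <= X i /\ Pin i p (g i j) = 0) /\
    (forall x, X (i - 1) <= x <= X i -> Pin i p x = 0 ->
        exists j, (1 <= j <= p)%nat /\ x = g i j).

(** right endpoint g_{i,j+1} of the control volume (with g_{i,p+1} = g_{i+1,1})
    and the element in which it lies *)
Definition gnext (g : nat -> nat -> R) (i j : nat) : R :=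
  if Nat.ltb j p then g i (S j) else g (S i) 1%nat.
Definition enext (i j : nat) : nat := if Nat.ltb j p then i else S i.

Definition is_IFV (gam cr : R) (f : R -> R) (g : nat -> nat -> R)
  (cf : nat -> nat -> R) : Prop :=
  forall i j, (1 <= i <= N)%nat -> (1 <= j)%nat ->
    (j <= (if Nat.ltb i N then p else p - 1))%nat ->
    fluxT cf i (g i j) - fluxT cf (enext i j) (gnext g i j)
    + RInt (fun x => gam * glob (dloc cf) x + cr * glob (loc cf) x)
           (g i j) (gnext g i j)
    = RInt f (g i j) (gnext g i j).

(** Gauss-Lobatto projection I_h u on tau_i; [fu] is the flux beta u' *)
Definition Icoef (u fu : R -> R) (i n : nat) : R :=
  match n with
  | O => u (X (i - 1))
  | S O => u (X i)
  | _ => RInt (fun x => fu x * ldphi i n x) (X (i - 1)) (X i)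
         / RInt (fun x => betaf x * (ldphi i n x) ^ 2) (X (i - 1)) (X i)
  end.
Definition Ih (u fu : R -> R) (i : nat) (x : R) : R :=
  sumR (S p) (fun n => Icoef u fu i n * lphi i n x).

End IFV.

(** u restricted to [l,r] is in W^{m,infty}(l,r) with ||u||_{W^{m,infty}} <= M,
    witnessed by classical derivatives D 0 = u, ..., D (m-1) (continuous on
    [l,r], D (m-1) Lipschitz with constant ||u^{(m)}||_infty). *)
Definition W_inf_piece (l r : R) (m : nat) (u : R -> R) (D : nat -> R -> R)
  (M : R) : Prop :=
  (forall x, l <= x <= r -> D O x = u x) /\
  (forall j x, (S j < m)%nat -> l < x < r -> derivable_pt_lim (D j) x (D (S j) x)) /\
  (forall j x, (j < m)%nat -> l <= x <= r -> Rabs (D j x) <= M) /\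
  (forall j x y, (j < m)%nat -> l <= x <= r -> l <= y <= r ->
      Rabs (D j x - D j y) <= M * Rabs (x - y)).

(* Main.v *)
(** Put E = u - u_T, F = beta u', w = 1 / beta, and let q be the flux of u_T, on each element a single
    polynomial of degree < p. Summing the IFV equations shows that F - q - gam E - c int_a^x E has the
    same value K at all (generalized) Gauss points. On an element, the flux Q of I_h u is the w-orthogonal
    projection of F, so eta = u - I_h u vanishes at the nodes, has mean zero (as p >= 2), and F - Q is of
    higher order at the zeros of P_(i,p). Interpolation at the Gauss points is exact for w-integrals of
    polynomials of degree < 2 p, whence
      E_i - E_(i-1) = (int w) (gam E_(i-1) + c S_(i-1) + K) + small,  S_i - S_(i-1) = h_i E_(i-1) + small,
    where S_i = int_a^(x_i) E; the loss of one order on the interface element occurs only once. The boundary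
    values E_0 = E_N = 0 determine K by discrete shooting: the solution with unit initial flux stays away
    from 0 at b, and Gronwall's inequality bounds E, S and K by C h^(p+2). If gam = c = 0 then F - q = K at
    all Gauss points and only the quadrature error of order 2 p + 1 per element remains.

    All constants are independent of the position of the interface in its element: the Lagrange basis l_j
    at the Gauss points satisfies int w l_j^2 = int w l_j, hence int w l_j^2 <= int w. *)
From Stdlib Require Import Reals Lra Lia Arith.
Require Import Defs.
From Coquelicot Require Import Coquelicot.
Open Scope R_scope.

(** The obstacle is the kink of [u] and of the trial functions at the interface: on the interface
    element neither Taylor expansion nor polynomial interpolation applies to them. The flux does not
    see the kink. The jump conditions on beta u^(j), j = 1, ..., 2 p, say that F and its derivatives
    up to order 2 p - 1 match at alpha, and the generalized modes have polynomial fluxes on the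
    whole element. So only fluxes are approximated, and E is recovered from E' = w (F - q), the
    discontinuity being confined to the weight w.

    The order lost on the interface element comes from gam eta alone. Where w is constant, eta is
    close to a polynomial on which the Gauss rule is exact, and its zero mean cancels the leading
    contribution; where w jumps, eta is estimated only by its size h^(p+1).

    Smallness of h serves three purposes: it absorbs the feedback of the flux error on itself within
    an element, it keeps the explicit shooting recursion nonnegative when gam is negative, and it
    absorbs the term h |K| when K is solved for. *)

(** * Finite sums *)

Lemma sumR_ext (n : nat) (f g : nat -> R) :
  (forall i, (i < n)%nat -> f i = g i) -> sumR n f = sumR n g.
Proof.
  induction n as [|n IH]; intros H; simpl; auto.
  rewrite IH, (H n); auto.
Qed.

Lemma sumR_plus (n : nat) (f g : nat -> R) :
  sumR n (fun i => f i + g i) = sumR n f + sumR n g.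
Proof. induction n as [|n IH]; simpl; [lra | rewrite IH; lra]. Qed.

Lemma sumR_scal (n : nat) (c : R) (f : nat -> R) :
  sumR n (fun i => c * f i) = c * sumR n f.
Proof. induction n as [|n IH]; simpl; [lra | rewrite IH; lra]. Qed.

Lemma sumR_0 (n : nat) (f : nat -> R) :
  (forall i, (i < n)%nat -> f i = 0) -> sumR n f = 0.
Proof.
  induction n as [|n IH]; intros H; simpl; auto.
  rewrite IH, (H n); auto; lra.
Qed.

Lemma sumR_le (n : nat) (f g : nat -> R) :
  (forall i, (i < n)%nat -> f i <= g i) -> sumR n f <= sumR n g.
Proof.
  induction n as [|n IH]; intros H; simpl; [lra|].
  apply Rplus_le_compat; auto.
Qed.

Lemma sumR_abs (n : nat) (f : nat -> R) :
  Rabs (sumR n f) <= sumR n (fun i => Rabs (f i)).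
Proof.
  induction n as [|n IH]; simpl; [rewrite Rabs_R0; lra|].
  eapply Rle_trans; [apply Rabs_triang|lra].
Qed.

Lemma sumR_const (n : nat) (c : R) : sumR n (fun _ => c) = INR n * c.
Proof. induction n as [|n IH]; simpl sumR; [simpl; lra | rewrite IH, S_INR; lra]. Qed.

Lemma sumR_S_l (n : nat) (f : nat -> R) :
  sumR (S n) f = f O + sumR n (fun i => f (S i)).
Proof.
  induction n as [|n IH]; [simpl; lra|].
  change (sumR (S (S n)) f) with (sumR (S n) f + f (S n)).
  rewrite IH; simpl; lra.
Qed.

Lemma sumR_telescope (n : nat) (f : nat -> R) :
  sumR n (fun i => f (S i) - f i) = f n - f O.
Proof. induction n as [|n IH]; simpl; [lra | rewrite IH; lra]. Qed.

Lemma sumR_single (n j : nat) (f : nat -> R) :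
  (j < n)%nat -> (forall i, (i < n)%nat -> i <> j -> f i = 0) -> sumR n f = f j.
Proof.
  induction n as [|n IH]; intros Hj H; [lia|]; simpl.
  destruct (Nat.eq_dec j n) as [->|Hjn].
  - rewrite sumR_0; [lra|]. intros i Hi; apply H; lia.
  - rewrite IH, (H n); try lia; [lra|]. intros; apply H; lia.
Qed.

(** * Polynomial functions *)

(** The index counts coefficients, so the degree is less than [n] and the zero polynomial has the
    index 0 of its own; dividing out a root then always lowers the index by one. *)
Definition pol (n : nat) (q : R -> R) : Prop :=
  exists cs : nat -> R, forall t, q t = sumR n (fun m => cs m * t ^ m).

Lemma pol_ext (n : nat) (q s : R -> R) : (forall t, q t = s t) -> pol n q -> pol n s.
Proof. intros H [cs Hc]; exists cs; intros t; rewrite <- H; auto. Qed.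

Lemma pol_0 (q : R -> R) : pol 0 q -> forall t, q t = 0.
Proof. intros [cs H] t; rewrite H; reflexivity. Qed.

Lemma pol_S_top (n : nat) (q : R -> R) :
  pol (S n) q <-> exists c q1, pol n q1 /\ forall t, q t = q1 t + c * t ^ n.
Proof.
  split.
  - intros [cs H]. exists (cs n), (fun t => sumR n (fun m => cs m * t ^ m)).
    split; [exists cs; auto|]. intros t; rewrite H; reflexivity.
  - intros [c [q1 [[cs H1] H]]].
    exists (fun m => if Nat.eqb m n then c else cs m). intros t.
    simpl; rewrite Nat.eqb_refl, H, H1. f_equal.
    apply sumR_ext; intros i Hi. destruct (Nat.eqb_spec i n); [lia|auto].
Qed.

Lemma pol_S_horner (n : nat) (q : R -> R) :
  pol (S n) q <-> exists c q1, pol n q1 /\ forall t, q t = c + t * q1 t.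
Proof.
  split.
  - intros [cs H]. exists (cs O), (fun t => sumR n (fun m => cs (S m) * t ^ m)).
    split; [exists (fun m => cs (S m)); auto|]. intros t; rewrite H, sumR_S_l.
    rewrite <- sumR_scal. simpl; f_equal; [lra|]. apply sumR_ext; intros; ring.
  - intros [c [q1 [[cs H1] H]]].
    exists (fun m => match m with O => c | S m => cs m end). intros t.
    rewrite sumR_S_l, H, H1, <- sumR_scal. simpl; f_equal; [lra|].
    apply sumR_ext; intros; ring.
Qed.

Lemma pol_plus (n : nat) (q s : R -> R) :
  pol n q -> pol n s -> pol n (fun t => q t + s t).
Proof.
  intros [cs H] [ds H']. exists (fun m => cs m + ds m). intros t.
  rewrite H, H', <- sumR_plus. apply sumR_ext; intros; ring.
Qed.

Lemma pol_scal (n : nat) (c : R) (q : R -> R) : pol n q -> pol n (fun t => c * q t).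
Proof.
  intros [cs H]. exists (fun m => c * cs m). intros t.
  rewrite H, <- sumR_scal. apply sumR_ext; intros; ring.
Qed.

Lemma pol_minus (n : nat) (q s : R -> R) :
  pol n q -> pol n s -> pol n (fun t => q t - s t).
Proof.
  intros Hq Hs. apply pol_ext with (fun t => q t + (-1) * s t); [intros; ring|].
  apply pol_plus; auto; apply pol_scal; auto.
Qed.

Lemma pol_zero (n : nat) : pol n (fun _ => 0).
Proof. exists (fun _ => 0); intros t; rewrite sumR_0; auto; intros; ring. Qed.

Lemma pol_const (n : nat) (c : R) : (1 <= n)%nat -> pol n (fun _ => c).
Proof.
  destruct n as [|n]; [lia|intros _]. apply pol_S_horner.
  exists c, (fun _ => 0); split; [apply pol_zero | intros; ring].
Qed.

Lemma pol_S (n : nat) (q : R -> R) : pol n q -> pol (S n) q.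
Proof. intros H; apply pol_S_top; exists 0, q; split; auto; intros; ring. Qed.

Lemma pol_mono (n m : nat) (q : R -> R) : (n <= m)%nat -> pol n q -> pol m q.
Proof. induction 1; auto; intros; apply pol_S; auto. Qed.

Lemma pol_mul_linear (n : nat) (a b : R) (q : R -> R) :
  pol n q -> pol (S n) (fun t => (a * t + b) * q t).
Proof.
  intros H. apply pol_ext with (fun t => (0 + t * (a * q t)) + b * q t); [intros; ring|].
  apply pol_plus; [|apply pol_S, pol_scal; auto].
  apply pol_S_horner; exists 0, (fun t => a * q t); split; auto; apply pol_scal; auto.
Qed.

Lemma pol_linear (n : nat) (a b : R) : (2 <= n)%nat -> pol n (fun t => a * t + b).
Proof.
  intros Hn; apply pol_mono with 2%nat; auto.
  apply pol_ext with (fun t => (a * t + b) * 1); [intros; ring|].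
  apply pol_mul_linear, pol_const; lia.
Qed.

Lemma pol_mult (n m : nat) (q s : R -> R) :
  pol (S n) q -> pol m s -> pol (n + m) (fun t => q t * s t).
Proof.
  revert q; induction n as [|n IH]; intros q Hq Hs;
    apply pol_S_horner in Hq; destruct Hq as [c [q1 [H1 H]]].
  - apply pol_ext with (fun t => c * s t); [|apply pol_scal; auto].
    intros t; rewrite H, (pol_0 _ H1); ring.
  - apply pol_ext with (fun t => c * s t + (1 * t + 0) * (q1 t * s t)).
    { intros t; rewrite H; ring. }
    apply pol_plus; [apply pol_scal, pol_mono with m; auto; lia|].
    apply (pol_mul_linear (n + m)); auto.
Qed.

Lemma pol_affine (n : nat) (a b : R) (q : R -> R) : pol n q -> pol n (fun t => q (a * t + b)).
Proof.
  revert q; induction n as [|n IH]; intros q Hq.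
  - exists (fun _ => 0); intros t; simpl; apply pol_0; auto.
  - apply pol_S_horner in Hq; destruct Hq as [c [q1 [H1 H]]].
    apply pol_ext with (fun t => c + (a * t + b) * q1 (a * t + b)).
    { intros t; rewrite H; ring. }
    apply pol_plus; [apply pol_const; lia|].
    apply (pol_mul_linear n a b (fun t => q1 (a * t + b))); auto.
Qed.

Lemma pol_div (n : nat) (q : R -> R) (x0 : R) :
  pol (S n) q -> exists q1, pol n q1 /\ forall t, q t = q x0 + (t - x0) * q1 t.
Proof.
  revert q; induction n as [|n IH]; intros q Hq;
    apply pol_S_horner in Hq; destruct Hq as [c [q1 [H1 H]]].
  - exists (fun _ => 0); split; [apply pol_zero|].
    intros t; rewrite !H, !(pol_0 _ H1); ring.
  - destruct (IH q1 H1) as [q2 [H2 H3]].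
    exists (fun t => q1 t + x0 * q2 t); split.
    + apply pol_plus; auto; apply pol_S, pol_scal; auto.
    + intros t; rewrite !H, (H3 t); ring.
Qed.

Lemma pol_antider (n : nat) (q : R -> R) :
  pol n q -> exists Q, pol (S n) Q /\ forall t, is_derive Q t (q t).
Proof.
  revert q; induction n as [|n IH]; intros q Hq.
  - exists (fun _ => 0); split; [apply pol_zero|].
    intros t; rewrite (pol_0 _ Hq). apply @is_derive_const.
  - apply pol_S_top in Hq; destruct Hq as [c [q1 [H1 H]]].
    destruct (IH q1 H1) as [Q [HQ HQ']].
    exists (fun t => Q t + c / INR (S n) * t ^ (S n)); split.
    + apply pol_S_top; exists (c / INR (S n)), Q; split; auto.
    + intros t; rewrite H. apply @is_derive_plus; auto.
      assert (INR (S n) <> 0) by (apply not_0_INR; lia).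
      auto_derive; auto. change (Nat.pred (S n)) with n. field; auto.
Qed.

Lemma pol_continuous (n : nat) (q : R -> R) : pol n q -> forall t, continuous q t.
Proof.
  intros [cs H] t.
  apply continuous_ext with (fun t => sumR n (fun m => cs m * t ^ m)); [auto|].
  clear H; induction n as [|n IH]; simpl.
  - apply continuous_const.
  - apply @continuous_plus; [apply IH|].
    apply @ex_derive_continuous. auto_derive; auto.
Qed.

(** * Newton interpolation *)

Fixpoint prodlin (n : nat) (g : nat -> R) (t : R) : R :=
  match n with O => 1 | S m => prodlin m g t * (t - g m) end.

Lemma pol_prodlin (n : nat) (g : nat -> R) : pol (S n) (prodlin n g).
Proof.
  induction n as [|n IH]; [apply pol_const; lia|].
  apply pol_ext with (fun t => (1 * t + - g n) * prodlin n g t); [intros; simpl; ring|].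
  apply pol_mul_linear; auto.
Qed.

Lemma prodlin_root (n : nat) (g : nat -> R) (j : nat) : (j < n)%nat -> prodlin n g (g j) = 0.
Proof.
  induction n as [|n IH]; intros Hj; [lia|]; simpl.
  destruct (Nat.eq_dec j n) as [->|]; [ring|]. rewrite IH; [ring|lia].
Qed.

Lemma prodlin_neq (n : nat) (g : nat -> R) (t : R) :
  (forall j, (j < n)%nat -> t <> g j) -> prodlin n g t <> 0.
Proof.
  induction n as [|n IH]; intros H; simpl; [lra|].
  apply Rmult_integral_contrapositive; split; [apply IH; auto|].
  intros E; apply (H n); [lia|lra].
Qed.

(** The remainder [r] has the values of [q] at the nodes. With Gauss points as nodes, the other term
    is the one that orthogonality annihilates under the weighted integral. *)
Lemma newton_division (n m : nat) (g : nat -> R) (q : R -> R) :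
  pol (n + m) q ->
  exists r s, pol n r /\ pol m s /\ forall t, q t = r t + prodlin n g t * s t.
Proof.
  revert m; induction n as [|n IH]; intros m Hq.
  - exists (fun _ => 0), q; repeat split; auto; [apply pol_zero|intros; simpl; ring].
  - destruct (IH (S m)) as [r [s [Hr [Hs H]]]].
    { replace (n + S m)%nat with (S n + m)%nat by lia; auto. }
    destruct (pol_div m s (g n) Hs) as [s1 [Hs1 H1]].
    exists (fun t => r t + s (g n) * prodlin n g t), s1; repeat split; auto.
    + apply pol_plus; [apply pol_S; auto|apply pol_scal, pol_prodlin].
    + intros t; rewrite H, (H1 t); simpl; ring.
Qed.

Lemma pol_interpolate (n : nat) (g y : nat -> R) :
  (forall i j, (i < j < n)%nat -> g i <> g j) ->
  exists q, pol n q /\ forall j, (j < n)%nat -> q (g j) = y j.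
Proof.
  induction n as [|n IH]; intros Hg.
  - exists (fun _ => 0); split; [apply pol_zero|intros; lia].
  - destruct IH as [q [Hq H]]; [intros; apply Hg; lia|].
    assert (Hn : prodlin n g (g n) <> 0).
    { apply prodlin_neq; intros j Hj E; apply (Hg j n); auto; lia. }
    exists (fun t => q t + (y n - q (g n)) / prodlin n g (g n) * prodlin n g t); split.
    + apply pol_plus; [apply pol_S; auto|apply pol_scal, pol_prodlin].
    + intros j Hj. destruct (Nat.eq_dec j n) as [->|]; [field; auto|].
      rewrite (prodlin_root n g j), (H j) by lia; ring.
Qed.

Lemma pol_roots (n : nat) (g : nat -> R) (q : R -> R) :
  (forall i j, (i < j < n)%nat -> g i <> g j) ->
  pol n q -> (forall j, (j < n)%nat -> q (g j) = 0) -> forall t, q t = 0.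
Proof.
  revert q; induction n as [|n IH]; intros q Hg Hq H0 t.
  - apply pol_0; auto.
  - destruct (pol_div n q (g n) Hq) as [q1 [Hq1 H1]].
    rewrite H1, H0, (IH q1); try lia; auto; [ring|intros; apply Hg; lia|].
    intros j Hj. specialize (H1 (g j)). rewrite !H0 in H1 by lia.
    assert (A : (g j - g n) * q1 (g j) = 0) by lra.
    apply Rmult_integral in A; destruct A as [A|A]; auto.
    exfalso; apply (Hg j n); [lia|lra].
Qed.

Lemma pol_factor (n m : nat) (g : nat -> R) (q : R -> R) :
  (forall i j, (i < j < n)%nat -> g i <> g j) ->
  pol (n + m) q -> (forall j, (j < n)%nat -> q (g j) = 0) ->
  exists s, pol m s /\ forall t, q t = prodlin n g t * s t.
Proof.
  intros Hg Hq H0. destruct (newton_division n m g q Hq) as [r [s [Hr [Hs H]]]].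
  exists s; split; auto. intros t; rewrite H, (pol_roots n g r); auto; [ring|].
  intros j Hj. specialize (H (g j)). rewrite prodlin_root, H0 in H by auto. lra.
Qed.

(** The quotient of [q] by the factor of the last node takes divided differences of [q] as values at
    the other nodes, and separation bounds these by [2 * D * m / (r - l)]. Multiplying the factor
    back cancels the length, so [C] depends on [n] and [D] only. *)
Lemma newton_stability (n : nat) (D : R) : 0 < D ->
  exists C, 0 < C /\ forall (q : R -> R) (t : nat -> R) (l r m : R),
    pol n q -> l < r -> (forall i, (i < n)%nat -> l <= t i <= r) ->
    (forall i j, (i < j < n)%nat -> r - l <= D * Rabs (t i - t j)) ->
    0 <= m -> (forall i, (i < n)%nat -> Rabs (q (t i)) <= m) ->
    forall x, l <= x <= r -> Rabs (q x) <= C * m.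
Proof.
  intros HD; induction n as [|n [C [HC IH]]].
  - exists 1; split; [lra|]. intros q t l r m Hq _ _ _ Hm _ x _.
    rewrite (pol_0 _ Hq), Rabs_R0; lra.
  - exists (1 + 2 * D * C); split; [nra|].
    intros q t l r m Hq Hlr Ht Hgap Hm Hqm x Hx.
    destruct (pol_div n q (t n) Hq) as [q1 [Hq1 H1]].
    assert (B : Rabs (q1 x) <= C * (2 * D * m / (r - l))).
    { apply (IH q1 t l r); auto.
      - intros i j Hij; apply Hgap; lia.
      - apply Rmult_le_pos; [nra|left; apply Rinv_0_lt_compat; lra].
      - intros i Hi. assert (Hg := Hgap i n ltac:(lia)).
        assert (Hpos : 0 < Rabs (t i - t n)) by nra.
        assert (E : q1 (t i) = (q (t i) - q (t n)) / (t i - t n)).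
        { rewrite (H1 (t i)). field. intros E; rewrite E, Rabs_R0 in Hpos; lra. }
        rewrite E. unfold Rdiv at 1. rewrite Rabs_mult, Rabs_inv.
        apply Rmult_le_reg_r with (Rabs (t i - t n)); auto.
        rewrite Rmult_assoc, Rinv_l, Rmult_1_r by lra.
        apply Rle_trans with (2 * m).
        + unfold Rminus; eapply Rle_trans; [apply Rabs_triang|]. rewrite Rabs_Ropp.
          assert (A1 := Hqm i ltac:(lia)). assert (A2 := Hqm n ltac:(lia)). lra.
        + apply Rmult_le_reg_r with (r - l); [lra|].
          replace (2 * D * m / (r - l) * Rabs (t i - t n) * (r - l))
            with (2 * m * (D * Rabs (t i - t n))) by (field; lra).
          apply Rmult_le_compat_l; lra. }
    rewrite H1. eapply Rle_trans; [apply Rabs_triang|].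
    rewrite Rmult_plus_distr_r. apply Rplus_le_compat; [rewrite Rmult_1_l; auto|].
    rewrite Rabs_mult.
    assert (Hxt : Rabs (x - t n) <= r - l).
    { assert (A := Ht n ltac:(lia)). apply Rabs_le; lra. }
    apply Rle_trans with ((r - l) * (C * (2 * D * m / (r - l)))).
    + apply Rmult_le_compat; auto; apply Rabs_pos.
    + right; field; lra.
Qed.

Lemma is_poly_deg_split (q : R -> R) (n : nat) :
  is_poly_deg q n ->
  exists c s, c <> 0 /\ pol n s /\ forall t, q t = s t + c * t ^ n.
Proof.
  intros [cs [Hc H]]. exists (cs n), (fun t => sumR n (fun m => cs m * t ^ m)).
  repeat split; auto. exists cs; auto.
Qed.

Lemma is_poly_deg_pol (q : R -> R) (n : nat) : is_poly_deg q n -> pol (S n) q.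
Proof. intros [cs [_ H]]; exists cs; auto. Qed.

(** Each step eliminates the leading coefficient with the member of that exact degree. *)
Lemma pol_span (Lf : nat -> R -> R) (n : nat) :
  (forall m, is_poly_deg (Lf m) m) ->
  forall s, pol n s -> exists cs, forall t, s t = sumR n (fun m => cs m * Lf m t).
Proof.
  intros HL; induction n as [|n IH]; intros s Hs.
  - exists (fun _ => 0); intros; simpl; apply pol_0; auto.
  - apply pol_S_top in Hs; destruct Hs as [c [s1 [Hs1 H1]]].
    destruct (is_poly_deg_split _ _ (HL n)) as [d [s2 [Hd [Hs2 H2]]]].
    destruct (IH (fun t => s1 t - c / d * s2 t)) as [cs Hcs].
    { apply pol_minus; auto; apply pol_scal; auto. }
    exists (fun m => if Nat.eqb m n then c / d else cs m). intros t; simpl.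
    rewrite Nat.eqb_refl, H1, H2.
    rewrite (sumR_ext n _ (fun m => cs m * Lf m t)).
    + rewrite <- Hcs; field; auto.
    + intros i Hi; destruct (Nat.eqb_spec i n); [lia|auto].
Qed.

(** The induction uses that division by [t - x0] preserves the leading coefficient. *)
Lemma is_poly_deg_neq0 (q : R -> R) (n : nat) :
  is_poly_deg q n -> exists t, q t <> 0.
Proof.
  intros H.
  (* Vanishing is assumed on a half-line only: cancelling [t - x0] loses the point [x0], and the
     induction restarts at [x0 + 1]. *)
  assert (G : forall n c s x0, pol n s -> (forall t, x0 <= t -> s t + c * t ^ n = 0) -> c = 0).
  { clear; induction n as [|n IH]; intros c s x0 Hs H.
    - specialize (H x0 (Rle_refl _)). rewrite (pol_0 _ Hs) in H. simpl in H; lra.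
    - destruct (pol_div n s x0 Hs) as [s1 [Hs1 H1]].
      destruct n as [|n].
      + assert (A := H x0 (Rle_refl _)). assert (B := H (x0 + 1) ltac:(lra)).
        rewrite (H1 (x0 + 1)), (pol_0 _ Hs1) in B. simpl in A, B; lra.
      + destruct (pol_div (S n) (fun t => t ^ S n) x0) as [w [Hw Hw1]].
        { apply pol_S_top; exists 1, (fun _ => 0); split; [apply pol_zero|intros; ring]. }
        apply (IH c (fun t => s1 t + c * x0 * w t) (x0 + 1)).
        { apply pol_plus; auto; apply pol_scal; auto. }
        intros t Ht. assert (A := H x0 (Rle_refl _)). assert (B := H t ltac:(lra)).
        rewrite (H1 t) in B.
        assert (E : t ^ S (S n) = x0 ^ S (S n) + (t - x0) * (t ^ S n + x0 * w t)).
        { change (t ^ S (S n)) with (t * t ^ S n). change (x0 ^ S (S n)) with (x0 * x0 ^ S n).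
          assert (E := Hw1 t). cbv beta in E. rewrite E. ring_simplify. nra. }
        rewrite E in B.
        assert (F : (t - x0) * (s1 t + c * x0 * w t + c * t ^ S n) = 0) by nra.
        apply Rmult_integral in F; destruct F; lra. }
  destruct (is_poly_deg_split _ _ H) as [c [s [Hc [Hs Hq]]]].
  destruct (Classical_Prop.classic (exists t, q t <> 0)) as [|N]; auto.
  exfalso; apply Hc, (G n c s 0); auto. intros t _. rewrite <- Hq.
  apply Classical_Prop.NNPP; intros E; apply N; exists t; auto.
Qed.

(** * Integrals of piecewise continuous functions *)

(** The type ascription to [R] hides the carrier of Coquelicot's normed module from [ring] and [lra]. *)
Definition RI (f : R -> R) (l r : R) : R := RInt f l r.

Lemma RInt_DefsE (f : R -> R) (x y : R) : ex_RInt f x y -> Defs.RInt f x y = RI f x y.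
Proof.
  intros Hf; unfold Defs.RInt.
  destruct (ClassicalEpsilon.excluded_middle_informative _) as [H|H].
  - symmetry; apply RInt_Reals.
  - exfalso; apply H; exists (ex_RInt_Reals_0 _ _ _ Hf); auto.
Qed.

(** Two globally continuous functions instead of one-sided limits: closure under products and affine
    maps, and integrability over every interval, then reduce to the continuous case. The value at
    [al] is the left one, as in [betaf]. *)
Definition pc (al : R) (f : R -> R) : Prop :=
  exists f1 f2, (forall x, continuous f1 x) /\ (forall x, continuous f2 x) /\
    forall x, f x = if Rle_dec x al then f1 x else f2 x.

Lemma pc_cont (al : R) (f : R -> R) : (forall x, continuous f x) -> pc al f.
Proof. intros H; exists f, f; repeat split; auto; intros x; destruct (Rle_dec x al); auto. Qed.

Lemma pc_if (al : R) (f1 f2 : R -> R) :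
  (forall x, continuous f1 x) -> (forall x, continuous f2 x) ->
  pc al (fun x => if Rle_dec x al then f1 x else f2 x).
Proof. intros H1 H2; exists f1, f2; auto. Qed.

Lemma pc_const (al c : R) : pc al (fun _ => c).
Proof. apply pc_cont; intros; apply continuous_const. Qed.

Lemma pc_pol (al : R) (n : nat) (q : R -> R) : pol n q -> pc al q.
Proof. intros H; apply pc_cont, (pol_continuous n); auto. Qed.

Lemma pc_ext (al : R) (f g : R -> R) : (forall x, f x = g x) -> pc al f -> pc al g.
Proof. intros E [f1 [f2 [H1 [H2 H]]]]; exists f1, f2; repeat split; auto; intros; rewrite <- E; auto. Qed.

Lemma pc_plus (al : R) (f g : R -> R) : pc al f -> pc al g -> pc al (fun x => f x + g x).
Proof.
  intros [f1 [f2 [F1 [F2 F]]]] [g1 [g2 [G1 [G2 G]]]].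
  exists (fun x => f1 x + g1 x), (fun x => f2 x + g2 x); repeat split.
  - intros x; apply @continuous_plus; auto.
  - intros x; apply @continuous_plus; auto.
  - intros x; rewrite F, G; destruct (Rle_dec x al); auto.
Qed.

Lemma pc_mult (al : R) (f g : R -> R) : pc al f -> pc al g -> pc al (fun x => f x * g x).
Proof.
  intros [f1 [f2 [F1 [F2 F]]]] [g1 [g2 [G1 [G2 G]]]].
  exists (fun x => f1 x * g1 x), (fun x => f2 x * g2 x); repeat split.
  - intros x; apply @continuous_mult; auto.
  - intros x; apply @continuous_mult; auto.
  - intros x; rewrite F, G; destruct (Rle_dec x al); auto.
Qed.

Lemma pc_scal (al c : R) (f : R -> R) : pc al f -> pc al (fun x => c * f x).
Proof. intros; apply pc_mult; auto; apply pc_const. Qed.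

Lemma pc_minus (al : R) (f g : R -> R) : pc al f -> pc al g -> pc al (fun x => f x - g x).
Proof.
  intros; apply pc_ext with (fun x => f x + (-1) * g x); [intros; ring|].
  apply pc_plus; auto; apply pc_scal; auto.
Qed.

Lemma pc_pow (al : R) (f : R -> R) (n : nat) : pc al f -> pc al (fun x => f x ^ n).
Proof. intros H; induction n; simpl; [apply pc_const | apply pc_mult; auto]. Qed.

Lemma pc_affine (al a b : R) (f : R -> R) :
  0 < a -> pc (a * al + b) f -> pc al (fun x => f (a * x + b)).
Proof.
  intros Ha [f1 [f2 [F1 [F2 F]]]].
  assert (A : forall x, continuous (fun x => a * x + b) x).
  { intros x; apply @ex_derive_continuous; auto_derive; auto. }
  exists (fun x => f1 (a * x + b)), (fun x => f2 (a * x + b)); repeat split.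
  - intros x; apply (continuous_comp (fun x => a * x + b) f1); auto.
  - intros x; apply (continuous_comp (fun x => a * x + b) f2); auto.
  - intros x; rewrite F.
    destruct (Rle_dec x al), (Rle_dec (a * x + b) (a * al + b)); auto; exfalso; nra.
Qed.

Lemma pc_ex_RInt (al : R) (f : R -> R) (x y : R) : pc al f -> ex_RInt f x y.
Proof.
  intros [f1 [f2 [F1 [F2 F]]]].
  assert (A : forall z, ex_RInt f al z).
  { intros z. destruct (Rle_dec z al) as [Hz|Hz].
    - apply ex_RInt_ext with f1; [|apply @ex_RInt_continuous; auto].
      rewrite Rmin_right, Rmax_left by lra. intros t Ht; rewrite F.
      destruct (Rle_dec t al); auto; lra.
    - apply ex_RInt_ext with f2; [|apply @ex_RInt_continuous; auto].
      rewrite Rmin_left, Rmax_right by lra. intros t Ht; rewrite F.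
      destruct (Rle_dec t al); auto; lra. }
  apply @ex_RInt_Chasles with al; auto. apply @ex_RInt_swap; auto.
Qed.

Lemma pc_continuous_off (al : R) (f : R -> R) (x : R) : pc al f -> x <> al -> continuous f x.
Proof.
  intros [f1 [f2 [F1 [F2 F]]]] Hx.
  assert (Hd : 0 < Rabs (x - al)) by (apply Rabs_pos_lt; lra).
  destruct (Rle_dec x al) as [Hl|Hl].
  - apply (continuous_ext_loc _ f1); auto.
    exists (mkposreal _ Hd); intros y Hy; rewrite F.
    change (Rabs (y - x) < Rabs (x - al)) in Hy.
    rewrite (Rabs_left1 (x - al)) in Hy by lra. apply Rabs_def2 in Hy.
    destruct (Rle_dec y al); auto; lra.
  - apply (continuous_ext_loc _ f2); auto.
    exists (mkposreal _ Hd); intros y Hy; rewrite F.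
    change (Rabs (y - x) < Rabs (x - al)) in Hy.
    rewrite (Rabs_right (x - al)) in Hy by lra. apply Rabs_def2 in Hy.
    destruct (Rle_dec y al); auto; lra.
Qed.

Lemma RInt_ext_lt (f g : R -> R) (l r : R) :
  l <= r -> (forall x, l < x < r -> f x = g x) -> RI f l r = RI g l r.
Proof. intros Hl H; unfold RI; apply RInt_ext; rewrite Rmin_left, Rmax_right by lra; auto. Qed.

Lemma RI_ext (f g : R -> R) (l r : R) : (forall x, f x = g x) -> RI f l r = RI g l r.
Proof. intros H; unfold RI; apply RInt_ext; auto. Qed.

Lemma pcI_plus (al : R) (f g : R -> R) (l r : R) : pc al f -> pc al g ->
  RI (fun x => f x + g x) l r = RI f l r + RI g l r.
Proof. intros; unfold RI; apply @RInt_plus; eapply pc_ex_RInt; eauto. Qed.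

Lemma pcI_scal (al c : R) (f : R -> R) (l r : R) : pc al f ->
  RI (fun x => c * f x) l r = c * RI f l r.
Proof. intros; unfold RI; apply @RInt_scal; eapply pc_ex_RInt; eauto. Qed.

Lemma pcI_minus (al : R) (f g : R -> R) (l r : R) : pc al f -> pc al g ->
  RI (fun x => f x - g x) l r = RI f l r - RI g l r.
Proof. intros; unfold RI; apply @RInt_minus; eapply pc_ex_RInt; eauto. Qed.

Lemma pcI_const (c l r : R) : RI (fun _ => c) l r = c * (r - l).
Proof. unfold RI; rewrite RInt_const; apply Rmult_comm. Qed.

Lemma pcI_sum (al : R) (n : nat) (f : nat -> R -> R) (l r : R) :
  (forall i, (i < n)%nat -> pc al (f i)) ->
  pc al (fun x => sumR n (fun i => f i x)) /\
  RI (fun x => sumR n (fun i => f i x)) l r = sumR n (fun i => RI (f i) l r).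
Proof.
  induction n as [|n IH]; intros H; simpl.
  - split; [apply pc_const|]. rewrite pcI_const; ring.
  - destruct IH as [P E]; auto. split; [apply pc_plus; auto|].
    rewrite <- E. apply (pcI_plus al); auto.
Qed.

Lemma pcI_point (f : R -> R) (l : R) : RI f l l = 0.
Proof. unfold RI; apply @RInt_point. Qed.

Lemma pcI_Chasles (al : R) (f : R -> R) (x y z : R) : pc al f ->
  RI f x y + RI f y z = RI f x z.
Proof. intros; unfold RI; apply @RInt_Chasles; eapply pc_ex_RInt; eauto. Qed.

Lemma RInt_ext_off (al : R) (f g : R -> R) (x y : R) : x <= y -> pc al g ->
  (forall z, x < z < y -> z <> al -> f z = g z) -> ex_RInt f x y /\ RI f x y = RI g x y.
Proof.
  intros Hxy Hg H.
  assert (Q : forall l r, x <= l -> l <= r -> r <= y -> (r <= al \/ al <= l) ->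
    ex_RInt f l r /\ RI f l r = RI g l r).
  { intros l r H1 H2 H3 H4.
    assert (E : forall z, l < z < r -> g z = f z) by (intros z Hz; symmetry; apply H; lra).
    split.
    - apply ex_RInt_ext with g; [rewrite Rmin_left, Rmax_right by lra; auto|].
      apply (pc_ex_RInt al); auto.
    - symmetry; apply RInt_ext_lt; auto. }
  destruct (Rle_dec y al); [apply Q; lra|]. destruct (Rle_dec al x); [apply Q; lra|].
  destruct (Q x al) as [Q1 Q2]; try lra. destruct (Q al y) as [Q3 Q4]; try lra.
  split; [apply @ex_RInt_Chasles with al; auto|].
  rewrite <- (pcI_Chasles al g x al y), <- Q2, <- Q4 by auto.
  symmetry; unfold RI; apply @RInt_Chasles; auto.
Qed.

Lemma pcI_le (al : R) (f g : R -> R) (l r : R) : l <= r -> pc al f -> pc al g ->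
  (forall x, l < x < r -> f x <= g x) -> RI f l r <= RI g l r.
Proof. intros; unfold RI; apply RInt_le; auto; eapply pc_ex_RInt; eauto. Qed.

Lemma pcI_ge0 (al : R) (f : R -> R) (l r : R) : l <= r -> pc al f ->
  (forall x, l < x < r -> 0 <= f x) -> 0 <= RI f l r.
Proof.
  intros Hl Hf H. rewrite <- (Rmult_0_l (r - l)), <- (pcI_const 0).
  apply (pcI_le al); auto; apply pc_const.
Qed.

Lemma pcI_abs (al : R) (f : R -> R) (l r B : R) : l <= r -> pc al f ->
  (forall x, l < x < r -> Rabs (f x) <= B) -> Rabs (RI f l r) <= B * (r - l).
Proof.
  intros Hl Hf H. apply Rabs_le; split.
  - replace (- (B * (r - l))) with (- B * (r - l)) by ring. rewrite <- pcI_const.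
    apply (pcI_le al); auto; [apply pc_const|]. intros x Hx; apply H in Hx.
    apply Rabs_le_between in Hx; lra.
  - rewrite <- pcI_const. apply (pcI_le al); auto; [apply pc_const|]. intros x Hx; apply H in Hx.
    apply Rabs_le_between in Hx; lra.
Qed.

Lemma prim_continuous (al : R) (f : R -> R) (l x : R) : pc al f ->
  continuous (fun y => RI f l y) x.
Proof.
  intros Hf; apply (continuous_RInt_1 f l).
  exists (mkposreal 1 Rlt_0_1); intros y _.
  apply @RInt_correct, (pc_ex_RInt al); auto.
Qed.

Lemma prim_pc (al : R) (f : R -> R) (l : R) : pc al f -> pc al (fun y => RI f l y).
Proof. intros; apply pc_cont; intros; apply (prim_continuous al); auto. Qed.

Lemma prim_derive (al : R) (f : R -> R) (l x : R) : pc al f -> continuous f x ->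
  is_derive (fun y => RI f l y) x (f x).
Proof.
  intros Hf Hx; apply (is_derive_RInt f (fun y => RI f l y) l); auto.
  exists (mkposreal 1 Rlt_0_1); intros y _.
  apply @RInt_correct, (pc_ex_RInt al); auto.
Qed.

(** Differentiability holds only inside the interval, so the difference between [f] and the
    primitive of [g] is shown constant by the mean value theorem. *)
Lemma ftc_cont (f g : R -> R) (l r : R) : l <= r ->
  (forall x, l <= x <= r -> continuous f x) -> (forall x, continuous g x) ->
  (forall x, l < x < r -> is_derive f x (g x)) -> RI g l r = f r - f l.
Proof.
  intros Hlr Hf Hg Hd. destruct (Req_dec l r) as [<-|Hne]; [rewrite pcI_point; ring|].
  destruct (MVT_gen (fun x => f x - RI g l x) l r (fun _ => 0)) as [c [_ Hc]].
  - rewrite Rmin_left, Rmax_right by lra. intros x Hx.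
    replace 0 with (g x - g x) by ring. apply @is_derive_minus; auto.
    apply (prim_derive 0); auto; apply pc_cont; auto.
  - rewrite Rmin_left, Rmax_right by lra. intros x Hx.
    apply continuity_pt_filterlim. apply @continuous_minus; auto.
    apply (prim_continuous 0), pc_cont; auto.
  - cbv beta in Hc. rewrite pcI_point in Hc. lra.
Qed.

Lemma ftc_pc (al : R) (f g : R -> R) (l r : R) : l <= r ->
  (forall x, l <= x <= r -> continuous f x) -> pc al g ->
  (forall x, l < x < r -> x <> al -> is_derive f x (g x)) -> RI g l r = f r - f l.
Proof.
  intros Hlr Hf Hg Hd.
  assert (P := Hg). destruct P as [g1 [g2 [G1 [G2 G]]]].
  assert (A : forall l' r', l <= l' -> l' <= r' -> r' <= r -> r' <= al ->
    RI g l' r' = f r' - f l').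
  { intros l' r' H1 H2 H3 H4. rewrite (RInt_ext_lt g g1); auto.
    - apply ftc_cont; auto; [intros; apply Hf; lra|].
      intros x Hx. replace (g1 x) with (g x); [apply Hd; lra|].
      rewrite G; destruct (Rle_dec x al); auto; lra.
    - intros x Hx; rewrite G; destruct (Rle_dec x al); auto; lra. }
  assert (B : forall l' r', l <= l' -> l' <= r' -> r' <= r -> al <= l' ->
    RI g l' r' = f r' - f l').
  { intros l' r' H1 H2 H3 H4. rewrite (RInt_ext_lt g g2); auto.
    - apply ftc_cont; auto; [intros; apply Hf; lra|].
      intros x Hx. replace (g2 x) with (g x); [apply Hd; lra|].
      rewrite G; destruct (Rle_dec x al); auto; lra.
    - intros x Hx; rewrite G; destruct (Rle_dec x al); auto; lra. }
  destruct (Rle_dec r al); [apply A; lra|]. destruct (Rle_dec al l); [apply B; lra|].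
  rewrite <- (pcI_Chasles al g l al r), A, B; auto; lra.
Qed.

(** Integration by parts, from the derivative of [(r - x) * RI G l x], a product that vanishes at
    both ends. It turns the mean of eta into the moment of [F - Q] against a linear function, which
    is zero because [2 <= p] admits linear test functions. *)
Lemma RInt_prim (al : R) (G : R -> R) (l r : R) : l <= r -> pc al G ->
  RI (fun x => RI G l x) l r = RI (fun y => (r - y) * G y) l r.
Proof.
  intros Hlr HG.
  assert (Hlin : forall x, continuous (fun y => r - y) x).
  { intros x; apply @ex_derive_continuous; auto_derive; auto. }
  assert (E : RI (fun x => (r - x) * G x - RI G l x) l r = 0).
  { rewrite (ftc_pc al (fun x => (r - x) * RI G l x)); auto.
    - rewrite pcI_point; ring.
    - intros x _. apply @continuous_mult; auto. apply (prim_continuous al); auto.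
    - apply pc_minus; [apply pc_mult; auto; apply pc_cont; auto|apply prim_pc; auto].
    - intros x _ Hx.
      replace ((r - x) * G x - RI G l x) with (-1 * RI G l x + (r - x) * G x) by ring.
      apply (is_derive_mult (fun y => r - y) (fun y => RI G l y) x).
      + auto_derive; auto; ring.
      + apply (prim_derive al); auto. apply (pc_continuous_off al); auto.
      + intros; apply Rmult_comm. }
  rewrite (pcI_minus al (fun x => (r - x) * G x) (fun x => RI G l x)) in E; [cbv beta in E; lra| |apply prim_pc; auto].
  apply pc_mult; auto; apply pc_cont; auto.
Qed.

Lemma pcI_affine (al : R) (f : R -> R) (a b l r : R) : 0 < a -> pc (a * al + b) f ->
  RI (fun x => f (a * x + b)) l r = / a * RI f (a * l + b) (a * r + b).
Proof.
  intros Ha Hf. assert (E : RI (fun y => a * f (a * y + b)) l r = RI f (a * l + b) (a * r + b)).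
  { apply (RInt_comp_lin f a b l r); eapply pc_ex_RInt; eauto. }
  rewrite <- E, (pcI_scal al); [field; lra|]. apply pc_affine; auto.
Qed.

Lemma choice_nat (A : Type) (P : nat -> A -> Prop) :
  (forall i, exists t, P i t) -> exists f, forall i, P i (f i).
Proof.
  intros H.
  exists (fun i => proj1_sig (ClassicalEpsilon.constructive_indefinite_description _ (H i))).
  intros i; apply proj2_sig.
Qed.

(** On each of [n] separated subintervals of [l, r] there is a point where [q^2] is below its
    mean; Newton interpolation at these points controls [q]. *)
Lemma pol_sup_le_norm2 (n : nat) (wm : R) : 0 < wm ->
  exists C, 0 < C /\ forall (al l r : R) (w q : R -> R),
    l < r -> pc al w -> (forall x, l <= x <= r -> wm <= w x) -> pol n q ->
    forall x, l <= x <= r -> (r - l) * q x ^ 2 <= C * RI (fun y => w y * q y ^ 2) l r.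
Proof.
  intros Hwm.
  (* Cut the interval into [2 * n + 1] pieces of length [d] and sample in every second one: two
     samples are then at least [d] apart, which is the separation ratio [D]. *)
  assert (HD : 0 < 2 * INR n + 1) by (assert (A := pos_INR n); lra).
  destruct (newton_stability n _ HD) as [C0 [HC0 H0]].
  set (D := 2 * INR n + 1) in *.
  exists (C0 ^ 2 * D / wm); split.
  { apply Rdiv_lt_0_compat; auto. apply Rmult_lt_0_compat; auto. apply pow_lt; auto. }
  intros al l r w q Hlr Hw Hwl Hq x Hx.
  set (I := RI (fun y => w y * q y ^ 2) l r).
  assert (Hq2 : pc al (fun y => q y ^ 2)) by (apply pc_pow, (pc_pol al n); auto).
  assert (HI : wm * RI (fun y => q y ^ 2) l r <= I).
  { unfold I. rewrite <- (pcI_scal al) by auto.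
    apply (pcI_le al); [lra|apply pc_scal; auto|apply pc_mult; auto|].
    intros y Hy. apply Rmult_le_compat_r; [apply pow2_ge_0|apply Hwl; lra]. }
  set (d := (r - l) / D). assert (Hd : 0 < d) by (apply Rdiv_lt_0_compat; lra).
  assert (HdD : d * D = r - l) by (unfold d; field; lra).
  assert (P : forall i, exists t, (i < n)%nat ->
     (l + 2 * INR i * d <= t <= l + 2 * INR i * d + d) /\ d * (wm * q t ^ 2) <= I).
  { intros i. destruct (le_lt_dec n i) as [|Hi]; [exists 0; lia|].
    set (c := l + 2 * INR i * d).
    assert (Hi' : INR i + 1 <= INR n) by (rewrite <- S_INR; apply le_INR; lia).
    assert (Hi0 := pos_INR i).
    assert (Hc : l <= c /\ c + d <= r).
    { unfold c; split; [nra|]. unfold D in HdD. nra. }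
    destruct (continuity_ab_min (fun y => q y ^ 2) c (c + d)) as [t [Ht1 Ht2]]; [lra| |].
    { intros y _. apply continuity_pt_filterlim.
      apply (continuous_comp q (fun z => z ^ 2)); [apply (pol_continuous n); auto|].
      apply @ex_derive_continuous; auto_derive; auto. }
    exists t; intros _; split; auto.
    apply Rle_trans with (wm * RI (fun y => q y ^ 2) l r); auto.
    rewrite <- Rmult_assoc, (Rmult_comm d wm), Rmult_assoc. apply Rmult_le_compat_l; [lra|].
    rewrite <- (pcI_Chasles al _ l c r), <- (pcI_Chasles al _ c (c + d) r) by auto.
    assert (A1 : 0 <= RI (fun y => q y ^ 2) l c).
    { apply (pcI_ge0 al); auto; [lra|intros; apply pow2_ge_0]. }
    assert (A2 : 0 <= RI (fun y => q y ^ 2) (c + d) r).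
    { apply (pcI_ge0 al); auto; [lra|intros; apply pow2_ge_0]. }
    assert (A3 : q t ^ 2 * ((c + d) - c) <= RI (fun y => q y ^ 2) c (c + d)).
    { rewrite <- pcI_const. apply (pcI_le al); auto; [lra|apply pc_const|].
      intros y Hy; apply Ht1; lra. }
    lra. }
  apply choice_nat in P; destruct P as [t Ht].
  assert (HI0 : 0 <= I).
  { eapply Rle_trans; [|apply HI]. apply Rmult_le_pos; [lra|].
    apply (pcI_ge0 al); auto; [lra|intros; apply pow2_ge_0]. }
  assert (B : Rabs (q x) <= C0 * sqrt (I / (d * wm))).
  { apply (H0 q t l r); auto.
    - intros i Hi. destruct (Ht i Hi) as [[T1 T2] _].
      assert (Hi' : INR i + 1 <= INR n) by (rewrite <- S_INR; apply le_INR; lia).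
      assert (Hi0 := pos_INR i). unfold D in HdD. split; nra.
    - intros i j Hij. destruct (Ht i ltac:(lia)) as [[T1 T2] _].
      destruct (Ht j ltac:(lia)) as [[T3 T4] _].
      assert (Hi' : INR i + 1 <= INR j) by (rewrite <- S_INR; apply le_INR; lia).
      rewrite Rabs_minus_sym, Rabs_right by nra. rewrite <- HdD, (Rmult_comm d).
      apply Rmult_le_compat_l; nra.
    - apply sqrt_pos.
    - intros i Hi. destruct (Ht i Hi) as [_ T]. rewrite <- sqrt_Rsqr_abs.
      apply sqrt_le_1_alt. apply Rmult_le_reg_l with (d * wm); [nra|].
      unfold Rsqr. replace (d * wm * (I / (d * wm))) with I by (field; lra).
      simpl in T. nra. }
  assert (B2 : q x ^ 2 <= C0 ^ 2 * (I / (d * wm))).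
  { rewrite <- (sqrt_sqrt (I / (d * wm))).
    - rewrite <- (pow2_abs (q x)).
      replace (C0 ^ 2 * (sqrt (I / (d * wm)) * sqrt (I / (d * wm))))
        with ((C0 * sqrt (I / (d * wm))) ^ 2) by ring.
      apply pow_incr; split; auto; apply Rabs_pos.
    - apply Rmult_le_pos; auto. left; apply Rinv_0_lt_compat; nra. }
  apply Rle_trans with ((r - l) * (C0 ^ 2 * (I / (d * wm)))).
  - apply Rmult_le_compat_l; lra.
  - right; unfold d; field; lra.
Qed.

(** * One element *)

(** [w] is the weight [1 / beta], and [g] lists the generalized Gauss points of the element. *)
Definition gauss_element (p : nat) (wm wM al l r : R) (w : R -> R) (g : nat -> R) : Prop :=
  l < r /\ pc al w /\ (forall x, l <= x <= r -> wm <= w x <= wM) /\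
  (forall j, (j < p)%nat -> l <= g j <= r) /\
  (forall i j, (i < j < p)%nat -> g i <> g j) /\
  (forall s, pol p s -> RI (fun x => w x * (prodlin p g x * s x)) l r = 0).

(** Converts the bounds on squares that norm estimates produce; [1 + K] dominates the square root of
    [K]. *)
Lemma pow2_le_abs (x K e : R) : 0 <= e -> 0 <= K -> x ^ 2 <= K * e ^ 2 -> Rabs x <= (1 + K) * e.
Proof.
  intros He HK H. apply Rsqr_incr_0_var; [|nra].
  rewrite <- Rsqr_abs. unfold Rsqr. assert (0 <= K * e * e) by (apply Rmult_le_pos; nra).
  assert (0 <= K * K * e * e) by (repeat apply Rmult_le_pos; auto). nra.
Qed.

Lemma RI_weight_le (al l r wM B : R) (w f : R -> R) : l <= r -> pc al w -> pc al f ->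
  (forall x, l <= x <= r -> 0 <= w x <= wM) -> (forall x, l <= x <= r -> Rabs (f x) <= B) ->
  forall x, l <= x <= r -> Rabs (RI (fun y => w y * f y) l x) <= wM * B * (x - l).
Proof.
  intros Hlr Hw Hf Hwb Hfb x Hx. apply (pcI_abs al); [lra|apply pc_mult; auto|].
  intros y Hy. rewrite Rabs_mult. destruct (Hwb y ltac:(lra)).
  rewrite (Rabs_right (w y)) by lra. apply Rmult_le_compat; auto; try apply Rabs_pos.
  apply Hfb; lra.
Qed.

Lemma gauss_values_bound (p : nat) (wm wM : R) : (1 <= p)%nat -> 0 < wm -> 0 <= wM ->
  exists C, 0 < C /\ forall al l r w g, gauss_element p wm wM al l r w g ->
    forall s m, pol p s -> (forall j, (j < p)%nat -> Rabs (s (g j)) <= m) ->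
    forall x, l <= x <= r -> Rabs (s x) <= C * m.
Proof.
  intros Hp Hwm HwM. destruct (pol_sup_le_norm2 p wm Hwm) as [C0 [HC0 H0]].
  exists (INR p * (1 + C0 * wM)); split.
  { apply Rmult_lt_0_compat; [apply lt_0_INR; lia|]. nra. }
  intros al l r w g [Hlr [Hw [Hwb [Hg [Hgd Horth]]]]] s m Hs Hm x Hx.
  assert (P : forall j, exists lj, (j < p)%nat -> pol p lj /\
    (forall i, (i < p)%nat -> lj (g i) = if Nat.eqb i j then 1 else 0)).
  { intros j. destruct (pol_interpolate p g (fun i => if Nat.eqb i j then 1 else 0) Hgd)
      as [lj [L1 L2]]. exists lj; auto. }
  apply choice_nat in P; destruct P as [lg Hl].
  assert (B : forall j, (j < p)%nat -> Rabs (lg j x) <= 1 + C0 * wM).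
  { intros j Hj. destruct (Hl j Hj) as [L1 L2].
    (* [l_j^2 - l_j] vanishes at the Gauss points, so it is orthogonal to the constants. *)
    assert (Hl2 : pol (p + (p - 1)) (fun t => lg j t * lg j t)).
    { replace (p + (p - 1))%nat with ((p - 1) + p)%nat by lia.
      apply pol_mult; auto. replace (S (p - 1)) with p by lia; auto. }
    destruct (pol_factor p (p - 1) g (fun t => lg j t * lg j t - lg j t) Hgd) as [q [Hq1 Hq2]].
    { apply pol_minus; auto. apply pol_mono with p; auto; lia. }
    { intros i Hi; rewrite L2 by auto. destruct (Nat.eqb i j); ring. }
    assert (Pl : pc al (lg j)) by (apply (pc_pol al p); auto).
    assert (E : RI (fun y => w y * lg j y ^ 2) l r = RI (fun y => w y * lg j y) l r).
    { assert (E := Horth q ltac:(apply pol_mono with (p - 1)%nat; auto; lia)).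
      rewrite (RInt_ext_lt _ (fun y => w y * lg j y ^ 2 - w y * lg j y)) in E; [|lra|].
      - rewrite (pcI_minus al (fun y => w y * lg j y ^ 2) (fun y => w y * lg j y)) in E; [lra| |];
          apply pc_mult; auto; apply pc_pow; auto.
      - intros y _; rewrite <- Hq2; ring. }
    (* This is [2 * l_j <= l_j ^ 2 + 1] under the integral. With [E] it shows that the weighted
       square norm of [l_j] is at most [wM * (r - l)]. *)
    assert (F : 2 * RI (fun y => w y * lg j y) l r
                <= RI (fun y => w y * lg j y ^ 2) l r + wM * (r - l)).
    { rewrite <- pcI_const, <- (pcI_scal al), <- (pcI_plus al).
      - apply (pcI_le al); [lra| | |].
        + apply pc_scal, pc_mult; auto.
        + apply pc_plus; [apply pc_mult; auto; apply pc_pow; auto|apply pc_const].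
        + intros y Hy. destruct (Hwb y ltac:(lra)).
          assert (0 <= w y * (lg j y - 1) ^ 2) by (apply Rmult_le_pos; [lra|apply pow2_ge_0]).
          nra.
      - apply pc_mult; auto; apply pc_pow; auto.
      - apply pc_const.
      - apply pc_mult; auto. }
    assert (G := H0 al l r w (lg j) Hlr Hw ltac:(intros y Hy; apply Hwb; auto) L1 x Hx).
    rewrite <- (Rmult_1_r (1 + C0 * wM)). apply pow2_le_abs; [lra|nra|].
    apply Rmult_le_reg_l with (r - l); [lra|].
    apply Rle_trans with (C0 * (wM * (r - l))); [|right; ring].
    eapply Rle_trans; [apply G|]. apply Rmult_le_compat_l; lra. }
  assert (E : s x = sumR p (fun j => s (g j) * lg j x)).
  { enough (A : s x - sumR p (fun j => s (g j) * lg j x) = 0) by lra.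
    apply (pol_roots p g (fun x => s x - sumR p (fun j => s (g j) * lg j x))); auto.
    - apply pol_minus; auto.
      assert (Q : forall n, (n <= p)%nat -> pol p (fun x => sumR n (fun j => s (g j) * lg j x))).
      { induction n; intros Hn; simpl; [apply pol_zero|].
        apply (pol_plus p (fun x => sumR n (fun j => s (g j) * lg j x))); [apply IHn; lia|].
        apply pol_scal, Hl; lia. }
      apply Q; auto.
    - intros i Hi. rewrite (sumR_single p i); auto.
      + rewrite (proj2 (Hl i Hi)), Nat.eqb_refl by auto; ring.
      + intros j Hj Hne. rewrite (proj2 (Hl j Hj)) by auto.
        destruct (Nat.eqb_spec i j); [congruence|ring]. }
  rewrite E. eapply Rle_trans; [apply sumR_abs|].
  rewrite Rmult_assoc, <- sumR_const. apply sumR_le; intros j Hj.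
  rewrite Rabs_mult, Rmult_comm. apply Rmult_le_compat; auto; apply Rabs_pos.
Qed.

(** Testing the difference [d] of the two projections with itself, its weighted square norm equals
    the integral of [w (F - T) d], and Young's inequality leaves a bound by [e]. The length cancels
    against the one in [pol_sup_le_norm2]. *)
Lemma projection_stability (p : nat) (wm wM : R) : 0 < wm -> 0 <= wM ->
  exists C, 0 < C /\ forall al l r w F T Q q e, l < r -> pc al w ->
    (forall x, l <= x <= r -> wm <= w x <= wM) ->
    pc al F -> pc al T -> pol p Q -> pol p q -> 0 <= e ->
    (forall x, l <= x <= r -> Rabs (F x - T x) <= e) ->
    (forall s, pol p s -> RI (fun x => w x * ((F x - Q x) * s x)) l r = 0) ->
    (forall s, pol p s -> RI (fun x => w x * ((T x - q x) * s x)) l r = 0) ->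
    forall x, l <= x <= r -> Rabs (Q x - q x) <= C * e.
Proof.
  intros Hwm HwM. destruct (pol_sup_le_norm2 p wm Hwm) as [C0 [HC0 H0]].
  exists (1 + C0 * wM); split; [nra|].
  intros al l r w F T Q q e Hlr Hw Hwb HF HT HQ Hq He HFT H1 H2 x Hx.
  set (d := fun x => Q x - q x).
  assert (Hd : pol p d) by (apply pol_minus; auto).
  assert (Pd : pc al d) by (apply (pc_pol al p); auto).
  assert (PQ : pc al Q) by (apply (pc_pol al p); auto).
  assert (Pq : pc al q) by (apply (pc_pol al p); auto).
  assert (E : RI (fun y => w y * d y ^ 2) l r = RI (fun y => w y * ((F y - T y) * d y)) l r).
  { rewrite (RInt_ext_lt (fun y => w y * d y ^ 2)
      (fun y => w y * ((F y - T y) * d y) -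
        (w y * ((F y - Q y) * d y) - w y * ((T y - q y) * d y)))); [|lra|].
    - rewrite (pcI_minus al (fun y => w y * ((F y - T y) * d y))
        (fun y => w y * ((F y - Q y) * d y) - w y * ((T y - q y) * d y))).
      + rewrite (pcI_minus al (fun y => w y * ((F y - Q y) * d y))
          (fun y => w y * ((T y - q y) * d y))), H1, H2; auto; [ring| |];
          repeat apply pc_mult; auto; apply pc_minus; auto.
      + repeat apply pc_mult; auto; apply pc_minus; auto.
      + apply pc_minus; repeat apply pc_mult; auto; apply pc_minus; auto.
    - intros y _; unfold d; ring. }
  assert (F1 : 2 * RI (fun y => w y * ((F y - T y) * d y)) l r
               <= RI (fun y => w y * d y ^ 2) l r + wM * e ^ 2 * (r - l)).
  { assert (P1 : pc al (fun y => w y * ((F y - T y) * d y))).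
    { repeat apply pc_mult; auto; apply pc_minus; auto. }
    assert (P2 : pc al (fun y => w y * d y ^ 2)) by (apply pc_mult; auto; apply pc_pow; auto).
    rewrite <- pcI_const, <- (pcI_scal al), <- (pcI_plus al); auto; [|apply pc_const].
    apply (pcI_le al); [lra|apply pc_scal; auto|apply pc_plus; auto; apply pc_const|].
    intros y Hy. destruct (Hwb y ltac:(lra)) as [W1 W2].
    assert (A := HFT y ltac:(lra)).
    assert (A2 : (F y - T y) ^ 2 <= e ^ 2).
    { rewrite <- (pow2_abs (F y - T y)). apply pow_incr; split; auto; apply Rabs_pos. }
    assert (w y * (F y - T y) ^ 2 <= wM * e ^ 2).
    { apply Rmult_le_compat; auto; [lra|apply pow2_ge_0]. }
    assert (0 <= w y * (F y - T y - d y) ^ 2) by (apply Rmult_le_pos; [lra|apply pow2_ge_0]).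
    nra. }
  assert (G := H0 al l r w d Hlr Hw ltac:(intros y Hy; apply Hwb; auto) Hd x Hx).
  apply pow2_le_abs; [lra|nra|].
  apply Rmult_le_reg_l with (r - l); [lra|].
  apply Rle_trans with (C0 * (wM * e ^ 2 * (r - l))); [|right; ring].
  eapply Rle_trans; [apply G|]. apply Rmult_le_compat_l; lra.
Qed.

(** Since [n] counts coefficients, it is also the order of the error. The flux has one derivative
    less than [u], whence the limit [2 * p]. The orders used are p, p + 1, 2 p - 1 and 2 p. *)
Definition taylor_approx (p : nat) (l r M : R) (F : R -> R) : Prop :=
  forall n, (1 <= n <= 2 * p)%nat ->
    exists T, pol n T /\ forall x, l <= x <= r -> Rabs (F x - T x) <= M * (r - l) ^ n.

(** Divide the best approximation [T] by the Gauss polynomial: the multiple of it integrates to zero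
    against [w], and the remainder minus [q] and [K] has degree less than [p], so its Gauss values
    control it. The constant [K] is separated because the Gauss residual is only close to a
    constant, not small. *)
Lemma gauss_element_flux (p : nat) (wm wM : R) : (1 <= p)%nat -> 0 < wm -> 0 <= wM ->
  exists C, 0 < C /\ forall al l r w g F q K M m, gauss_element p wm wM al l r w g ->
    pc al F -> taylor_approx p l r M F -> pol p q ->
    (forall j, (j < p)%nat -> Rabs (F (g j) - q (g j) - K) <= m) ->
    Rabs (RI (fun x => w x * (F x - q x)) l r - K * RI w l r)
      <= C * (r - l) * (M * (r - l) ^ (2 * p) + m).
Proof.
  intros Hp Hwm HwM. destruct (gauss_values_bound p wm wM Hp Hwm HwM) as [C1 [HC1 H1]].
  exists (wM * (1 + C1) + 1); split; [nra|].
  intros al l r w g F q K M m Hel HF HT Hq Hm.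
  assert (H1' := H1 _ _ _ _ _ Hel).
  destruct Hel as [Hlr [Hw [Hwb [Hg [Hgd Horth]]]]].
  destruct (HT (2 * p)%nat ltac:(lia)) as [T [HTp HTb]].
  destruct (newton_division p p g T) as [t [s [Ht [Hs Hts]]]].
  { replace (p + p)%nat with (2 * p)%nat by lia; auto. }
  set (eps := M * (r - l) ^ (2 * p)) in *.
  assert (He : 0 <= eps) by (eapply Rle_trans; [apply Rabs_pos|apply (HTb l); lra]).
  assert (Hm0 : 0 <= m) by (eapply Rle_trans; [apply Rabs_pos|apply (Hm O); lia]).
  assert (B : forall x, l <= x <= r -> Rabs (t x - q x - K) <= C1 * (eps + m)).
  { apply (H1' (fun x => t x - q x - K)).
    - apply pol_minus; [apply pol_minus; auto|apply pol_const; lia].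
    - intros j Hj. assert (E := Hts (g j)). rewrite prodlin_root in E by auto.
      replace (t (g j) - q (g j) - K) with
        (- (F (g j) - T (g j)) + (F (g j) - q (g j) - K)) by (rewrite E; ring).
      eapply Rle_trans; [apply Rabs_triang|]. rewrite Rabs_Ropp.
      apply Rplus_le_compat; auto. }
  assert (PT : pc al T) by (apply (pc_pol al (2 * p)); auto).
  assert (Pt : pc al t) by (apply (pc_pol al p); auto).
  assert (Pq : pc al q) by (apply (pc_pol al p); auto).
  assert (PK := pc_const al K).
  assert (Pqt : pc al (fun x => prodlin p g x * s x)).
  { apply pc_mult; [apply (pc_pol al (S p)), pol_prodlin|apply (pc_pol al p); auto]. }
  assert (E : RI (fun x => w x * (F x - q x)) l r - K * RI w l r =
    RI (fun x => w x * ((F x - T x) + (t x - q x - K))) l r).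
  { rewrite <- (pcI_scal al), <- (pcI_minus al), <- (Rplus_0_r (RI (fun x => w x * (F x - T x + _)) l r)),
      <- (Horth s Hs), <- (pcI_plus al); auto using pc_mult, pc_minus, pc_plus, pc_scal.
    - apply RInt_ext_lt; [lra|]. intros x _; rewrite (Hts x); ring. }
  rewrite E. eapply Rle_trans; [apply (RI_weight_le al l r wM ((1 + C1) * (eps + m)))|];
    auto using pc_minus, pc_plus; try lra.
  - intros x Hx; destruct (Hwb x Hx); lra.
  - intros x Hx. eapply Rle_trans; [apply Rabs_triang|].
    assert (A1 := B x Hx). assert (A2 := HTb x Hx). lra.
  - assert (0 <= (r - l) * (eps + m)) by (apply Rmult_le_pos; lra). nra.
Qed.

Lemma pol_primitive (n : nat) (q : R -> R) (l : R) : pol n q ->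
  exists V, pol (S n) V /\ forall x, l <= x -> RI q l x = V x.
Proof.
  intros Hq. destruct (pol_antider n q Hq) as [V [HV1 HV2]].
  exists (fun x => V x - V l); split.
  - apply pol_minus; auto. apply pol_const; lia.
  - intros x Hx. apply ftc_cont; auto.
    + intros; apply (pol_continuous (S n)); auto.
    + apply (pol_continuous n); auto.
Qed.

(** Take [T] with [p + 1] coefficients: dividing it by the Gauss polynomial leaves a constant
    cofactor, so the remainder [t] is the projection of [T], and [Q - t] is as small as [F - T]. At
    the Gauss points [t] equals [T], which yields one order more there than elsewhere. The leading
    part of eta is a constant times the weighted primitive of the Gauss polynomial; where that
    primitive vanishes, eta gains an order too. *)
Lemma gauss_projection (p : nat) (wm wM : R) : (2 <= p)%nat -> 0 < wm -> 0 <= wM ->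
  exists C, 0 < C /\ forall al l r w g F Q M, gauss_element p wm wM al l r w g ->
    pc al F -> taylor_approx p l r M F -> 0 <= M -> pol p Q ->
    (forall s, pol p s -> RI (fun x => w x * ((F x - Q x) * s x)) l r = 0) ->
    (forall j, (j < p)%nat -> Rabs (F (g j) - Q (g j)) <= C * ((r - l) ^ (p + 1) * M)) /\
    (forall x, l <= x <= r ->
       Rabs (RI (fun y => w y * (F y - Q y)) l x) <= C * ((r - l) ^ (p + 1) * M)) /\
    RI (fun y => w y * (F y - Q y)) l r = 0 /\
    RI (fun x => RI (fun y => w y * (F y - Q y)) l x) l r = 0 /\
    (forall x, l <= x <= r -> RI (fun y => w y * prodlin p g y) l x = 0 ->
       Rabs (RI (fun y => w y * (F y - Q y)) l x) <= C * ((r - l) ^ (p + 2) * M)).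
Proof.
  intros Hp Hwm HwM. destruct (projection_stability p wm wM Hwm HwM) as [C0 [HC0 H0]].
  exists ((1 + wM) * (1 + C0)); split; [nra|].
  intros al l r w g F Q M [Hlr [Hw [Hwb [Hg [Hgd Horth]]]]] HF HT HM HQ HQo.
  set (h := r - l). assert (Hh : 0 < h) by (unfold h; lra).
  assert (Hwb' : forall x, l <= x <= r -> 0 <= w x <= wM).
  { intros x Hx; destruct (Hwb x Hx); lra. }
  assert (PQ : pc al Q) by (apply (pc_pol al p); auto).
  assert (Hhp : forall n, 0 <= h ^ n) by (intros; apply pow_le; lra).
  destruct (HT p ltac:(lia)) as [T0 [HT0 HT0b]].
  destruct (HT (p + 1)%nat ltac:(lia)) as [T [HTp HTb]].
  destruct (newton_division p 1 g T HTp) as [t [s [Ht [Hs Hts]]]].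
  assert (PT : pc al T) by (apply (pc_pol al (p + 1)); auto).
  assert (PT0 : pc al T0) by (apply (pc_pol al p); auto).
  assert (Pt : pc al t) by (apply (pc_pol al p); auto).
  assert (He0 : 0 <= M * h ^ p) by (apply Rmult_le_pos; auto).
  assert (He1 : 0 <= M * h ^ (p + 1)) by (apply Rmult_le_pos; auto).
  assert (HsE : forall x, s x = s 0).
  { intros x. destruct (pol_div 0 s 0 Hs) as [s1 [Hs1 E]]. rewrite E, (pol_0 _ Hs1); ring. }
  assert (BT : forall x, l <= x <= r -> Rabs (Q x - t x) <= C0 * (M * h ^ (p + 1))).
  { apply (H0 al l r w F T); auto.
    intros v Hv. rewrite (RInt_ext_lt _ (fun x => w x * (prodlin p g x * (s 0 * v x)))); [|lra|].
    - apply Horth, pol_scal; auto.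
    - intros x _. rewrite (Hts x), (HsE x); ring. }
  assert (BT0 : forall x, l <= x <= r -> Rabs (F x - Q x) <= (1 + C0) * (M * h ^ p)).
  { intros x Hx. assert (A : Rabs (Q x - T0 x) <= C0 * (M * h ^ p)).
    { apply (H0 al l r w F T0 Q T0); auto.
      intros v Hv. rewrite (RInt_ext_lt _ (fun _ => 0)); [rewrite pcI_const; ring|lra|].
      intros y _; ring. }
    replace (F x - Q x) with ((F x - T0 x) - (Q x - T0 x)) by ring.
    unfold Rminus at 1. eapply Rle_trans; [apply Rabs_triang|]. rewrite Rabs_Ropp.
    assert (A2 := HT0b x Hx). fold h in A2. lra. }
  assert (One : RI (fun y => w y * (F y - Q y)) l r = 0).
  { rewrite <- (HQo (fun _ => 1)) by (apply pol_const; lia).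
    apply RInt_ext_lt; [lra|intros; ring]. }
  assert (HCw : forall a, 0 <= a -> (1 + C0) * a <= (1 + wM) * (1 + C0) * a /\
                 wM * ((1 + C0) * a) <= (1 + wM) * (1 + C0) * a).
  { intros a Ha. assert (0 <= C0 * a) by nra.
    assert (0 <= wM * a) by nra. assert (0 <= wM * (C0 * a)) by nra. nra. }
  repeat split; auto.
  - intros j Hj. assert (E := Hts (g j)). rewrite prodlin_root in E by auto.
    replace (F (g j) - Q (g j)) with ((F (g j) - T (g j)) - (Q (g j) - t (g j)))
      by (rewrite E; ring).
    unfold Rminus at 1. eapply Rle_trans; [apply Rabs_triang|]. rewrite Rabs_Ropp.
    assert (A1 := BT (g j) (Hg j Hj)). assert (A2 := HTb (g j) (Hg j Hj)). fold h in A2.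
    destruct (HCw (M * h ^ (p + 1))); auto.
    rewrite (Rmult_comm (h ^ (p + 1)) M). lra.
  - intros x Hx. eapply Rle_trans; [apply (RI_weight_le al l r wM ((1 + C0) * (M * h ^ p)))|];
      auto using pc_minus; [lra|].
    apply Rle_trans with (wM * ((1 + C0) * (M * h ^ p)) * h).
    + apply Rmult_le_compat_l; [|unfold h; lra].
      repeat apply Rmult_le_pos; auto; lra.
    + replace ((1 + wM) * (1 + C0) * (h ^ (p + 1) * M))
        with ((1 + wM) * (1 + C0) * (M * h ^ p) * h) by (rewrite pow_add; simpl; ring).
      apply Rmult_le_compat_r; [lra|]. apply HCw; auto.
  - rewrite (RInt_prim al); [|lra|auto using pc_mult, pc_minus].
    rewrite <- (HQo (fun y => -1 * y + r)) by (apply pol_linear; lia).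
    apply RInt_ext_lt; [lra|intros; ring].
  - intros x Hx Hx0.
    assert (E : RI (fun y => w y * (F y - Q y)) l x =
                RI (fun y => w y * ((F y - T y) - (Q y - t y))) l x).
    { rewrite (RInt_ext_lt (fun y => w y * (F y - Q y))
        (fun y => w y * ((F y - T y) - (Q y - t y)) + s 0 * (w y * prodlin p g y))); [|lra|].
      - assert (Pp : pc al (prodlin p g)) by (apply (pc_pol al (S p)), pol_prodlin).
        rewrite (pcI_plus al), (pcI_scal al), Hx0; [ring| | |];
          auto using pc_mult, pc_minus, pc_scal.
      - intros y _. rewrite (Hts y), (HsE y); ring. }
    rewrite E.
    eapply Rle_trans; [apply (RI_weight_le al l r wM ((1 + C0) * (M * h ^ (p + 1))))|];
      auto using pc_minus; [lra| |].
    + intros y Hy. unfold Rminus at 1. eapply Rle_trans; [apply Rabs_triang|]. rewrite Rabs_Ropp.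
      assert (A1 := BT y Hy). assert (A2 := HTb y Hy). fold h in A2. lra.
    + apply Rle_trans with (wM * ((1 + C0) * (M * h ^ (p + 1))) * h).
      * apply Rmult_le_compat_l; [|unfold h; lra].
        repeat apply Rmult_le_pos; auto; lra.
      * replace ((1 + wM) * (1 + C0) * (h ^ (p + 2) * M))
          with ((1 + wM) * (1 + C0) * (M * h ^ (p + 1)) * h) by (rewrite !pow_add; simpl; ring).
        apply Rmult_le_compat_r; [lra|]. apply HCw; auto.
Qed.

(** When [w] is constant, [eta] is close to a polynomial of degree less than [2 p] of mean zero, and
    the convection term [gam * eta] only contributes the quadrature error. *)
Lemma gauss_element_flux_convection (p : nat) (wm wM gam : R) :
  (2 <= p)%nat -> 0 < wm -> 0 <= wM ->
  exists C, 0 < C /\ forall al l r w g F q Q K M m, gauss_element p wm wM al l r w g ->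
    pc al F -> taylor_approx p l r M F -> 0 <= M -> pol p q -> pol p Q ->
    (forall x, l <= x <= r -> w x = w l) ->
    RI (fun x => RI (fun y => w y * (F y - Q y)) l x) l r = 0 ->
    (forall j, (j < p)%nat ->
      Rabs (F (g j) - q (g j) - gam * RI (fun y => w y * (F y - Q y)) l (g j) - K) <= m) ->
    Rabs (RI (fun x => w x * (F x - q x)) l r - K * RI w l r)
      <= C * (r - l) * (M * (r - l) ^ (2 * p) + m).
Proof.
  intros Hp Hwm HwM.
  destruct (gauss_element_flux p wm wM ltac:(lia) Hwm HwM) as [C1 [HC1 H1]].
  set (G := Rabs gam). assert (HG : 0 <= G) by apply Rabs_pos.
  exists (C1 * (1 + G * wM) + G * wM * wM); split.
  { assert (0 <= G * wM) by (apply Rmult_le_pos; auto).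
    assert (0 <= G * wM * wM) by (apply Rmult_le_pos; auto). nra. }
  intros al l r w g F q Q K M m Hel HF HT HM Hq HQ Hwc Heta Hm.
  assert (H1' := fun q K m => H1 al l r w g F q K M m Hel HF HT).
  destruct Hel as [Hlr [Hw [Hwb [Hg [Hgd Horth]]]]].
  set (h := r - l) in *. assert (Hh : 0 < h) by (unfold h; lra).
  set (eta := fun x => RI (fun y => w y * (F y - Q y)) l x) in *.
  assert (PQ : pc al Q) by (apply (pc_pol al p); auto).
  assert (Pq : pc al q) by (apply (pc_pol al p); auto).
  assert (Pe : pc al eta) by (apply prim_pc; auto using pc_mult, pc_minus).
  (* One order below the best: the primitive [V] of [w l * (T - Q)] then has [2 * p] coefficients,
     the limit of exactness of the quadrature, and integration restores the missing factor [h]. *)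
  destruct (HT (2 * p - 1)%nat ltac:(lia)) as [T [HTp HTb]].
  assert (PT : pc al T) by (apply (pc_pol al (2 * p - 1)); auto).
  assert (HTQ : pol (2 * p - 1) (fun y => w l * (T y - Q y))).
  { apply pol_scal, pol_minus; auto. apply pol_mono with p; auto; lia. }
  destruct (pol_primitive _ _ l HTQ) as [V [HV HVE]].
  replace (S (2 * p - 1)) with (p + p)%nat in HV by lia.
  assert (PV : pc al V) by (apply (pc_pol al (p + p)); auto).
  set (d := wM * (M * h ^ (2 * p))).
  assert (Hh2 : 0 <= M * h ^ (2 * p)) by (apply Rmult_le_pos; auto; apply pow_le; lra).
  assert (Hd0 : 0 <= d) by (apply Rmult_le_pos; auto).
  assert (Hd : forall x, l <= x <= r -> Rabs (eta x - V x) <= d).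
  { intros x Hx. rewrite <- HVE by lra. unfold eta.
    rewrite <- (pcI_minus al); auto using pc_mult, pc_minus, pc_scal, pc_const.
    rewrite (RInt_ext_lt _ (fun y => w y * (F y - T y))); [|lra|].
    - eapply Rle_trans;
        [apply (RI_weight_le al l r wM (M * h ^ (2 * p - 1)))|]; auto using pc_minus; [lra| |].
      + intros y Hy; destruct (Hwb y Hy); lra.
      + unfold d. replace (2 * p)%nat with (S (2 * p - 1)) at 2 by lia.
        replace (wM * (M * h ^ S (2 * p - 1))) with (wM * (M * h ^ (2 * p - 1)) * h)
          by (simpl; ring).
        apply Rmult_le_compat_l; [|unfold h; lra].
        repeat apply Rmult_le_pos; auto; apply pow_le; lra.
    - intros y Hy. rewrite (Hwc y) by lra. ring. }
  destruct (newton_division p p g V HV) as [v [s [Hv [Hs Hvs]]]].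
  assert (Pv : pc al v) by (apply (pc_pol al p); auto).
  (* The interpolant [v] of [V] has degree less than [p], so the convection term can be moved into
     [q] and the preceding estimate applies; the integral of [w v] is then removed separately. *)
  assert (HqV : pol p (fun x => q x + gam * v x)) by (apply pol_plus; auto; apply pol_scal; auto).
  assert (E1 := H1' _ K (m + G * d) HqV).
  (* Exactness replaces [v] by [V], and the zero mean of eta leaves only the small difference
     [eta - V]. *)
  assert (E2 : RI (fun x => w x * v x) l r = - w l * RI (fun x => eta x - V x) l r).
  { assert (Horth' := Horth s Hs).
    assert (A : RI (fun x => w x * v x) l r = RI (fun x => w x * V x) l r).
    { rewrite <- (Rplus_0_r (RI (fun x => w x * v x) l r)), <- Horth', <- (pcI_plus al).
      - apply RInt_ext_lt; [lra|]. intros x _; rewrite Hvs; ring.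
      - auto using pc_mult.
      - apply pc_mult; auto; apply pc_mult;
          [apply (pc_pol al (S p)), pol_prodlin|apply (pc_pol al p); auto]. }
    rewrite A, (RInt_ext_lt _ (fun x => w l * V x)); [|lra|intros x Hx; rewrite (Hwc x) by lra; ring].
    rewrite (pcI_scal al (w l) V), (pcI_minus al eta V), Heta by auto. ring. }
  assert (E3 : Rabs (RI (fun x => w x * v x) l r) <= wM * d * h).
  { rewrite E2, Rabs_mult, Rabs_Ropp. destruct (Hwb l ltac:(lra)).
    rewrite (Rabs_right (w l)), Rmult_assoc by lra.
    apply Rmult_le_compat; auto; try apply Rabs_pos; try lra.
    apply (pcI_abs al); [lra|apply pc_minus; auto|]. intros x Hx; apply Hd; lra. }
  assert (E4 : RI (fun x => w x * (F x - q x)) l r - K * RI w l r =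
    (RI (fun x => w x * (F x - (q x + gam * v x))) l r - K * RI w l r)
     + gam * RI (fun x => w x * v x) l r).
  { rewrite <- (pcI_scal al gam (fun x => w x * v x)) by auto using pc_mult.
    rewrite (RInt_ext_lt (fun x => w x * (F x - q x))
      (fun x => w x * (F x - (q x + gam * v x)) + gam * (w x * v x))); [|lra|intros; ring].
    rewrite (pcI_plus al (fun x => w x * (F x - (q x + gam * v x))));
      auto using pc_mult, pc_minus, pc_scal, pc_plus. ring. }
  rewrite E4. eapply Rle_trans; [apply Rabs_triang|]. rewrite Rabs_mult. fold G.
  apply Rle_trans with (C1 * h * (M * h ^ (2 * p) + (m + G * d)) + G * (wM * d * h)).
  - apply Rplus_le_compat; [|apply Rmult_le_compat_l; auto].
    apply E1. intros j Hj. specialize (Hm j Hj).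
    assert (Ev := Hvs (g j)). rewrite prodlin_root in Ev by auto.
    replace (F (g j) - (q (g j) + gam * v (g j)) - K) with
      ((F (g j) - q (g j) - gam * eta (g j) - K) + gam * (eta (g j) - V (g j)))
      by (rewrite Ev; ring).
    eapply Rle_trans; [apply Rabs_triang|]. rewrite Rabs_mult. fold G.
    apply Rplus_le_compat; auto. apply Rmult_le_compat_l; auto.
  - assert (Hm0 : 0 <= m) by (eapply Rle_trans; [apply Rabs_pos|apply (Hm O); lia]).
    unfold d. set (z := M * h ^ (2 * p)) in *.
    replace (C1 * h * (z + (m + G * (wM * z))) + G * (wM * (wM * z) * h))
      with ((C1 * (1 + G * wM) + G * wM * wM) * h * z + C1 * h * m) by ring.
    assert (0 <= h * m) by (apply Rmult_le_pos; lra).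
    assert (0 <= C1 * (G * wM) * (h * m)) by (repeat apply Rmult_le_pos; lra).
    assert (0 <= G * wM * wM * (h * m)) by (repeat apply Rmult_le_pos; lra).
    replace ((C1 * (1 + G * wM) + G * wM * wM) * h * (z + m)) with
     ((C1 * (1 + G * wM) + G * wM * wM) * h * z + C1 * h * m + C1 * (G * wM) * (h * m) + G * wM * wM * (h * m)) by ring.
    lra.
Qed.

(** One step of a perturbed Euler scheme for E' = w (gam E + c S + K), S' = E, started from [E0] and
    [S0] at the left node. The increment of [E] is estimated twice, with one more power of [h] where
    the weight is constant. All conclusions rest on a bound for [Q - q]: its Gauss values contain
    the error again, but the part caused by [Q - q] itself enters through an integral and so carries
    a factor [h]. *)
Lemma element_step (p : nat) (wm wM gam cr : R) :
  (2 <= p)%nat -> 0 < wm -> 0 <= wM -> 0 <= cr ->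
  exists C h0, 0 < C /\ 0 < h0 /\
  forall al l r w g F q Q M E0 S0 K, gauss_element p wm wM al l r w g ->
    pc al F -> taylor_approx p l r M F -> 0 <= M -> pol p q -> pol p Q -> r - l <= h0 ->
    (forall s, pol p s -> RI (fun x => w x * ((F x - Q x) * s x)) l r = 0) ->
    let h := r - l in
    let a := Rabs E0 + Rabs S0 + Rabs K in
    let E := fun x => E0 + RI (fun y => w y * (F y - q y)) l x in
    (forall j, (j < p)%nat ->
      F (g j) - q (g j) = gam * E (g j) + cr * (S0 + RI E l (g j)) + K) ->
    (Rabs (E r - E0 - RI w l r * (gam * E0 + cr * S0 + K)) <=
       C * h * (h * a + h ^ (p + 1) * M)) /\
    ((forall x, l <= x <= r -> w x = w l) ->
       Rabs (E r - E0 - RI w l r * (gam * E0 + cr * S0 + K)) <=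
         C * h * (h * a + h ^ (p + 2) * M)) /\
    Rabs (RI E l r - h * E0) <= C * h * (h * a + h ^ (p + 2) * M) /\
    (forall x, l <= x <= r ->
       Rabs (E0 + RI (fun y => w y * (Q y - q y)) l x) <= C * (a + h ^ (p + 2) * M)) /\
    (forall j, (j < p)%nat -> Rabs (F (g j) - q (g j)) <= C * (a + h ^ (p + 1) * M)) /\
    (forall x, l <= x <= r -> RI (fun y => w y * prodlin p g y) l x = 0 ->
       Rabs (E x) <= C * (a + h ^ (p + 2) * M)).
Proof.
  intros Hp Hwm HwM Hcr.
  destruct (gauss_projection p wm wM Hp Hwm HwM) as [Cp [HCp Hproj]].
  destruct (gauss_values_bound p wm wM ltac:(lia) Hwm HwM) as [C1 [HC1 H1]].
  destruct (gauss_element_flux p wm wM ltac:(lia) Hwm HwM) as [C2 [HC2 H2]].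
  destruct (gauss_element_flux_convection p wm wM gam Hp Hwm HwM) as [C3 [HC3 H3]].
  set (G := Rabs gam + 2 * cr + 1).
  assert (HG : 1 <= G) by (assert (A := Rabs_pos gam); unfold G; lra).
  set (Cm := 4 * C1 * G * (1 + Cp)).
  assert (HCm : 0 < Cm) by (unfold Cm; repeat apply Rmult_lt_0_compat; lra).
  (* [Cr] bounds the residual of the Gauss conditions, [Cr'] includes [gam * eta]. *)
  set (Cr := G * (1 + wM * Cm + Cp)).
  assert (HCwm : 0 <= wM * Cm) by (apply Rmult_le_pos; lra).
  assert (HCr : 0 < Cr) by (unfold Cr; apply Rmult_lt_0_compat; lra).
  set (Cr' := Cr + G * Cp).
  assert (HCr' : Cr < Cr') by (unfold Cr'; assert (0 < G * Cp) by (apply Rmult_lt_0_compat; lra); lra).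
  (* The constant adds up those of the individual conclusions; the second bound on [h] is chosen to
     make the feedback of the flux error at most one half. *)
  exists ((C2 + C3) * (1 + Cr') + (1 + wM * Cm) + Cp + (G + Cr')),
    (Rmin 1 (/ (2 * C1 * G * wM + 1))).
  assert (HB : 0 <= 2 * C1 * G * wM) by (repeat apply Rmult_le_pos; lra).
  assert (HC23 : 0 < (C2 + C3) * (1 + Cr')) by (apply Rmult_lt_0_compat; lra).
  split; [lra|]. split.
  { apply Rmin_pos; [lra|]. apply Rinv_0_lt_compat; lra. }
  intros al l r w g F q Q M E0 S0 K Hel HF HT HM Hq HQ Hh0 Horth h a E HE.
  set (CC := (C2 + C3) * (1 + Cr') + (1 + wM * Cm) + Cp + (G + Cr')).
  destruct (Hproj al l r w g F Q M Hel HF HT HM HQ Horth) as [J1 [J2 [J3 [J4 J5]]]].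
  assert (H1' := fun s m => H1 al l r w g Hel s m).
  assert (H2' := fun K m => H2 al l r w g F q K M m Hel HF HT Hq).
  assert (H3' := fun K m => H3 al l r w g F q Q K M m Hel HF HT HM Hq HQ).
  destruct Hel as [Hlr [Hw [Hwb [Hg [Hgd Hgo]]]]].
  fold h in J1, J2, J5, H2', H3', Hh0 |- *.
  assert (Hh : 0 < h) by (unfold h; lra).
  assert (Hh1 : h <= 1) by (eapply Rle_trans; [apply Hh0|apply Rmin_l]).
  assert (Hh2 : h * (2 * C1 * G * wM) <= 1).
  { apply Rle_trans with (h * (2 * C1 * G * wM + 1)); [nra|].
    apply Rle_trans with (/ (2 * C1 * G * wM + 1) * (2 * C1 * G * wM + 1));
      [|rewrite Rinv_l; lra].
    apply Rmult_le_compat_r; [lra|].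
    eapply Rle_trans; [apply Hh0|apply Rmin_r]. }
  set (y := h ^ (p + 1) * M) in *.
  assert (Hy : 0 <= y) by (apply Rmult_le_pos; auto; apply pow_le; lra).
  replace (h ^ (p + 2) * M) with (h * y) in * by (unfold y; rewrite !pow_add; simpl; ring).
  assert (Hhy : 0 <= h * y <= y) by (split; [apply Rmult_le_pos; lra|nra]).
  assert (Ha : 0 <= a) by (unfold a; assert (A1 := Rabs_pos E0); assert (A2 := Rabs_pos S0); assert (A3 := Rabs_pos K); lra).
  assert (Hha : 0 <= h * a <= a) by (split; [apply Rmult_le_pos; lra|nra]).
  (* Since [2 <= p], also [p + 2 <= 2 * p], and the quadrature error is no larger than the
     supercloseness order. *)
  assert (H2p : M * h ^ (2 * p) <= h * y).
  { unfold y.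
    replace (h * (h ^ (p + 1) * M)) with (M * h ^ (p + 2)) by (rewrite !pow_add; simpl; ring).
    apply Rmult_le_compat_l; auto.
    replace (2 * p)%nat with ((p + 2) + (p - 2))%nat by lia. rewrite (pow_add h (p + 2)).
    rewrite <- (Rmult_1_r (h ^ (p + 2))) at 2. apply Rmult_le_compat_l; [apply pow_le; lra|].
    rewrite <- (pow1 (p - 2)). apply pow_incr; lra. }
  clearbody y.
  assert (Hwb' : forall x, l <= x <= r -> 0 <= w x <= wM).
  { intros x Hx; destruct (Hwb x Hx); lra. }
  assert (PQ : pc al Q) by (apply (pc_pol al p); auto).
  assert (Pq : pc al q) by (apply (pc_pol al p); auto).
  set (eta := fun x => RI (fun z => w z * (F z - Q z)) l x) in *.
  set (e := fun x => RI (fun z => w z * (Q z - q z)) l x) in *.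
  assert (Pe : pc al e) by (apply prim_pc; auto using pc_mult, pc_minus).
  assert (Peta : pc al eta) by (apply prim_pc; auto using pc_mult, pc_minus).
  (* The error is split at the projection: [e] comes from the polynomial flux [Q - q], and [eta] is
     the projection error, whose mean over the element is zero. *)
  assert (EE : forall x, E x = (E0 + e x) + eta x).
  { intros x; unfold E, e, eta. rewrite Rplus_assoc, <- (pcI_plus al); auto using pc_mult, pc_minus.
    f_equal. apply RI_ext; intros; ring. }
  assert (PE : pc al E).
  { apply pc_ext with (fun x => (E0 + e x) + eta x); [intros; rewrite EE; auto|].
    auto using pc_plus, pc_const. }
  destruct (continuity_ab_maj (fun x => Rabs (Q x - q x)) l r) as [xm [Hxm1 Hxm2]]; [lra| |].
  { intros x _. apply continuity_pt_filterlim.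
    apply (continuous_comp (fun x => Q x - q x) Rabs); [|apply continuous_Rabs].
    apply (pol_continuous p), pol_minus; auto. }
  set (m := Rabs (Q xm - q xm)) in *.
  assert (Hm0 : 0 <= m) by apply Rabs_pos.
  assert (Be : forall x, l <= x <= r -> Rabs (e x) <= wM * m * h).
  { intros x Hx. eapply Rle_trans; [apply (RI_weight_le al l r wM m)|]; auto using pc_minus; [lra|].
    apply Rmult_le_compat_l; [apply Rmult_le_pos; auto|unfold h; lra]. }
  assert (Aa : Rabs E0 <= a /\ Rabs S0 <= a).
  { unfold a; assert (A1 := Rabs_pos E0); assert (A2 := Rabs_pos S0); assert (A3 := Rabs_pos K); lra. }
  assert (BE : forall x, l <= x <= r -> Rabs (E x) <= a + wM * m * h + Cp * y).
  { intros x Hx. rewrite EE. eapply Rle_trans; [apply Rabs_triang|].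
    apply Rplus_le_compat; [|apply J2; auto].
    eapply Rle_trans; [apply Rabs_triang|]. apply Rplus_le_compat; [lra|auto]. }
  assert (BI : forall x, l <= x <= r -> Rabs (RI E l x) <= h * (a + wM * m * h + Cp * y)).
  { intros x Hx. eapply Rle_trans; [apply (pcI_abs al _ l x (a + wM * m * h + Cp * y))|]; auto; [lra| |].
    - intros z Hz; apply BE; lra.
    - rewrite Rmult_comm. apply Rmult_le_compat_r; [|unfold h; lra].
      eapply Rle_trans; [apply Rabs_pos|apply (BE x Hx)]. }
  set (kap := gam * E0 + cr * S0 + K).
  assert (Bk : Rabs kap <= G * a).
  { unfold kap. eapply Rle_trans; [apply Rabs_triang|].
    eapply Rle_trans; [apply Rplus_le_compat_r, Rabs_triang|]. rewrite !Rabs_mult, (Rabs_right cr) by lra.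
    unfold G, a. assert (A1 := Rabs_pos E0); assert (A2 := Rabs_pos S0); assert (A3 := Rabs_pos K).
    assert (A4 := Rabs_pos gam).
    assert (0 <= Rabs gam * Rabs S0) by (apply Rmult_le_pos; auto).
    assert (0 <= Rabs gam * Rabs K) by (apply Rmult_le_pos; auto).
    assert (0 <= cr * Rabs E0) by (apply Rmult_le_pos; auto).
    assert (0 <= cr * Rabs S0) by (apply Rmult_le_pos; auto).
    assert (0 <= cr * Rabs K) by (apply Rmult_le_pos; auto). nra. }
  (* [kap] is the right-hand side frozen at the left node. The rest of the residual is kept in two
     pieces, since [gam * eta] is only of size [y] while [rho] has an extra factor [h]. *)
  set (rho := fun j => gam * e (g j) + cr * RI E l (g j)).
  assert (Hrho : forall j, (j < p)%nat ->
    F (g j) - q (g j) = kap + gam * eta (g j) + rho j).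
  { intros j Hj. rewrite HE, EE by auto. unfold kap, rho; ring. }
  assert (Brho : forall j, (j < p)%nat -> Rabs (rho j) <= G * h * (a + wM * m + Cp * y)).
  { intros j Hj. unfold rho. eapply Rle_trans; [apply Rabs_triang|].
    rewrite !Rabs_mult, (Rabs_right cr) by lra.
    assert (A1 := Be (g j) (Hg j Hj)). assert (A2 := BI (g j) (Hg j Hj)).
    assert (A4 := Rabs_pos gam).
    apply Rle_trans with (Rabs gam * (wM * m * h) + cr * (h * (a + wM * m * h + Cp * y))).
    - apply Rplus_le_compat; apply Rmult_le_compat_l; auto.
    - set (X := wM * m). assert (HX : 0 <= X) by (apply Rmult_le_pos; auto).
      assert (0 <= h * X) by (apply Rmult_le_pos; lra).
      assert (h * X * h <= h * X) by nra.
      assert (0 <= Cp * y) by (apply Rmult_le_pos; lra).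
      assert (0 <= h * (Cp * y)) by (apply Rmult_le_pos; lra).
      apply Rle_trans with (Rabs gam * (h * (a + X + Cp * y)) + cr * (h * (a + X + Cp * y))).
      + apply Rplus_le_compat; apply Rmult_le_compat_l; auto; nra.
      + assert (0 <= h * (a + X + Cp * y)) by (apply Rmult_le_pos; lra). unfold G.
        rewrite Rmult_assoc. nra. }
  assert (Bgeta : forall j, (j < p)%nat -> Rabs (gam * eta (g j)) <= (G - 1) * (Cp * y)).
  { intros j Hj. rewrite Rabs_mult. apply Rmult_le_compat; try apply Rabs_pos.
    - unfold G; lra.
    - apply J2; auto. }
  (* The Gauss values bound the maximum [m] by an expression that contains [m] again; by the choice
     of [h] that term is at most [m / 2]. *)
  assert (Bm : m <= Cm * (a + y)).
  { assert (A : m <= C1 * (G * a + (G - 1) * (Cp * y) + G * h * (a + wM * m + Cp * y) + Cp * y)).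
    { apply (H1' (fun x => Q x - q x)); auto; [apply pol_minus; auto|].
      intros j Hj. replace (Q (g j) - q (g j)) with
        ((kap + gam * eta (g j) + rho j) - (F (g j) - Q (g j))) by (rewrite <- Hrho; auto; ring).
      eapply Rle_trans; [apply Rabs_triang|]. rewrite Rabs_Ropp.
      apply Rplus_le_compat; [|auto].
      eapply Rle_trans; [apply Rabs_triang|]. apply Rplus_le_compat; [|auto].
      eapply Rle_trans; [apply Rabs_triang|]. apply Rplus_le_compat; auto. }
    assert (A1 : G * h * (a + wM * m + Cp * y) <= G * a + G * (Cp * y) + h * (G * wM) * m).
    { assert (0 <= Cp * y) by (apply Rmult_le_pos; lra).
      assert (h * (Cp * y) <= Cp * y) by nra.
      assert (G * (h * a) <= G * a) by (apply Rmult_le_compat_l; lra).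
      assert (G * (h * (Cp * y)) <= G * (Cp * y)) by (apply Rmult_le_compat_l; lra). nra. }
    assert (A2 : C1 * (h * (G * wM) * m) <= m / 2).
    { replace (C1 * (h * (G * wM) * m)) with (h * (2 * C1 * G * wM) * (m / 2)) by field.
      rewrite <- (Rmult_1_l (m / 2)) at 2. apply Rmult_le_compat_r; lra. }
    assert (A3 : m <= C1 * (2 * (G * a) + 2 * (G * (Cp * y))) + m / 2).
    { eapply Rle_trans; [apply A|].
      apply Rle_trans with (C1 * ((2 * (G * a) + 2 * (G * (Cp * y))) + h * (G * wM) * m)).
      - apply Rmult_le_compat_l; lra.
      - lra. }
    unfold Cm.
    assert (0 <= C1 * G * (Cp * a)) by (repeat apply Rmult_le_pos; lra).
    assert (0 <= C1 * G * y) by (repeat apply Rmult_le_pos; lra).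
    assert (0 <= C1 * G * a) by (repeat apply Rmult_le_pos; lra).
    assert (0 <= C1 * G * (Cp * y)) by (repeat apply Rmult_le_pos; lra).
    replace (4 * C1 * G * (1 + Cp) * (a + y)) with
      (4 * (C1 * G * a) + 4 * (C1 * G * y) + 4 * (C1 * G * (Cp * a)) + 4 * (C1 * G * (Cp * y))) by ring.
    lra. }
  assert (Hay : 0 <= h * (a + y)) by (apply Rmult_le_pos; lra).
  assert (Brho' : forall j, (j < p)%nat -> Rabs (rho j) <= Cr * (h * (a + y))).
  { intros j Hj. eapply Rle_trans; [apply Brho; auto|].
    apply Rle_trans with (G * h * (a + wM * (Cm * (a + y)) + Cp * y)).
    - apply Rmult_le_compat_l; [apply Rmult_le_pos; lra|].
      apply Rplus_le_compat_r, Rplus_le_compat_l, Rmult_le_compat_l; auto.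
    - unfold Cr. replace (G * (1 + wM * Cm + Cp) * (h * (a + y)))
        with (G * h * ((1 + wM * Cm + Cp) * (a + y))) by ring.
      apply Rmult_le_compat_l; [apply Rmult_le_pos; lra|].
      assert (0 <= Cp * a) by (apply Rmult_le_pos; lra). lra. }
  assert (HE1 : E r - E0 = RI (fun x => w x * (F x - q x)) l r) by (unfold E; ring).
  assert (HCC : forall c z, 0 <= z -> 0 <= c <= CC -> c * z <= CC * z).
  { intros; apply Rmult_le_compat_r; lra. }
  assert (Bge : forall j, (j < p)%nat -> Rabs (gam * eta (g j) + rho j) <= Cr' * (h * a + y)).
  { intros j Hj. eapply Rle_trans; [apply Rabs_triang|].
    assert (A1 := Bgeta j Hj). assert (A2 := Brho' j Hj).
    assert (0 <= G * Cp * (h * a)) by (repeat apply Rmult_le_pos; lra).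
    assert (0 <= Cp * y) by (apply Rmult_le_pos; lra).
    assert (Cr * (h * y) <= Cr * y) by (apply Rmult_le_compat_l; lra).
    unfold Cr'. nra. }
  assert (Be' : forall x, l <= x <= r -> Rabs (e x) <= wM * Cm * (h * (a + y))).
  { intros x Hx. eapply Rle_trans; [apply Be; auto|].
    replace (wM * Cm * (h * (a + y))) with (wM * (Cm * (a + y)) * h) by ring.
    apply Rmult_le_compat_r; [lra|]. apply Rmult_le_compat_l; auto. }
  assert (G4 : forall x, l <= x <= r -> Rabs (E0 + e x) <= (1 + wM * Cm) * (a + h * y)).
  { intros x Hx. eapply Rle_trans; [apply Rabs_triang|]. assert (A1 := Be' x Hx).
    assert (wM * Cm * (h * a) <= wM * Cm * a) by (apply Rmult_le_compat_l; lra). nra. }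
  assert (HC2' : 0 <= C2 * (1 + Cr')) by (apply Rmult_le_pos; lra).
  assert (HC3' : 0 <= C3 * (1 + Cr')) by (apply Rmult_le_pos; lra).
  repeat split.
  - rewrite HE1, (Rmult_comm (RI w l r)).
    eapply Rle_trans; [apply (H2' kap (Cr' * (h * a + y)))|].
    + intros j Hj. rewrite Hrho by auto.
      replace (kap + gam * eta (g j) + rho j - kap) with (gam * eta (g j) + rho j) by ring. auto.
    + apply Rle_trans with (C2 * h * ((1 + Cr') * (h * a + y))).
      * apply Rmult_le_compat_l; [apply Rmult_le_pos; lra|]. lra.
      * replace (C2 * h * ((1 + Cr') * (h * a + y))) with (C2 * (1 + Cr') * (h * (h * a + y))) by ring.
        rewrite (Rmult_assoc CC). apply HCC; [apply Rmult_le_pos; lra|]. unfold CC; lra.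
  - intros Hwc. rewrite HE1, (Rmult_comm (RI w l r)).
    eapply Rle_trans; [apply (H3' kap (Cr * (h * (a + y)))); auto|].
    + intros j Hj. rewrite Hrho by auto. fold (eta (g j)).
      replace (kap + gam * eta (g j) + rho j - gam * eta (g j) - kap) with (rho j) by ring. auto.
    + apply Rle_trans with (C3 * h * ((1 + Cr') * (h * a + h * y))).
      * apply Rmult_le_compat_l; [apply Rmult_le_pos; lra|].
        assert (Cr * (h * (a + y)) <= Cr' * (h * (a + y))) by (apply Rmult_le_compat_r; lra). lra.
      * replace (C3 * h * ((1 + Cr') * (h * a + h * y)))
          with (C3 * (1 + Cr') * (h * (h * a + h * y))) by ring.
        rewrite (Rmult_assoc CC). apply HCC; [apply Rmult_le_pos; lra|]. unfold CC; lra.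
  - assert (A : RI E l r = h * E0 + RI e l r).
    { rewrite (RInt_ext_lt E (fun x => (E0 + e x) + eta x)); [|lra|intros; apply EE].
      rewrite (pcI_plus al (fun x => E0 + e x) eta), (pcI_plus al (fun _ => E0) e), pcI_const, J4;
        auto using pc_plus, pc_const. unfold h; ring. }
    rewrite A. replace (h * E0 + RI e l r - h * E0) with (RI e l r) by ring.
    eapply Rle_trans; [apply (pcI_abs al e l r (wM * Cm * (h * (a + y)))); auto; [lra|]|].
    + intros x Hx; apply Be'; lra.
    + fold h. replace (wM * Cm * (h * (a + y)) * h) with (wM * Cm * (h * (h * a + h * y))) by ring.
      rewrite (Rmult_assoc CC). apply HCC; [apply Rmult_le_pos; lra|]. unfold CC; lra.
  - intros x Hx. eapply Rle_trans; [apply G4; auto|]. apply HCC; [lra|]. unfold CC; lra.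
  - intros j Hj. rewrite Hrho by auto. rewrite Rplus_assoc.
    eapply Rle_trans; [apply Rabs_triang|].
    assert (A := Bge j Hj). apply Rle_trans with ((G + Cr') * (a + y)).
    + assert (Cr' * (h * a) <= Cr' * a) by (apply Rmult_le_compat_l; lra).
      assert (0 <= G * y) by (apply Rmult_le_pos; lra). lra.
    + apply HCC; [lra|]. unfold CC; lra.
  - intros x Hx Hx0. rewrite EE. eapply Rle_trans; [apply Rabs_triang|].
    assert (A1 := G4 x Hx). assert (A2 := J5 x Hx Hx0).
    apply Rle_trans with ((1 + wM * Cm + Cp) * (a + h * y)).
    + assert (0 <= Cp * a) by (apply Rmult_le_pos; lra). unfold eta in *. lra.
    + apply HCC; [lra|]. unfold CC; lra.
Qed.

(** * Discrete stability *)

Lemma sumR_ge0 (n : nat) (f : nat -> R) : (forall i, (i < n)%nat -> 0 <= f i) -> 0 <= sumR n f.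
Proof. intros H; rewrite <- (sumR_0 n (fun _ => 0)) by auto; apply sumR_le; auto. Qed.

Lemma sumR_mono (n m : nat) (f : nat -> R) :
  (n <= m)%nat -> (forall i, (i < m)%nat -> 0 <= f i) -> sumR n f <= sumR m f.
Proof.
  induction 1 as [|m H IH]; intros Hf; [lra|]; simpl.
  assert (A := Hf m ltac:(lia)). assert (B := IH ltac:(intros; apply Hf; lia)). lra.
Qed.

Lemma discrete_gronwall (A : R) (N : nat) (hh x d : nat -> R) : 0 <= A -> x O <= 0 ->
  (forall i, (i < N)%nat -> 0 <= hh i /\ 0 <= d i /\ x (S i) <= (1 + A * hh i) * x i + d i) ->
  forall i, (i <= N)%nat -> x i <= exp (A * sumR i hh) * sumR i d.
Proof.
  intros HA H0 H; induction i as [|i IH]; intros Hi; [simpl; lra|].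
  destruct (H i ltac:(lia)) as [H1 [H2 H3]]. specialize (IH ltac:(lia)).
  assert (HAh : 0 <= A * hh i) by (apply Rmult_le_pos; auto).
  assert (HD : 0 <= sumR i d) by (apply sumR_ge0; intros; apply H; lia).
  assert (HH : 0 <= sumR i hh) by (apply sumR_ge0; intros; apply H; lia).
  simpl. rewrite (Rmult_plus_distr_l A), exp_plus.
  set (X := exp (A * sumR i hh)) in *. assert (HX : 1 <= X).
  { unfold X. rewrite <- exp_0. assert (E : 0 <= A * sumR i hh) by (apply Rmult_le_pos; auto).
    destruct E as [E|<-]; [left; apply exp_increasing; auto|lra]. }
  assert (HY : 1 + A * hh i <= exp (A * hh i)) by apply exp_ineq1_le.
  set (Y := exp (A * hh i)) in *.
  apply Rle_trans with ((1 + A * hh i) * (X * sumR i d) + d i).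
  - eapply Rle_trans; [apply H3|]. apply Rplus_le_compat_r, Rmult_le_compat_l; auto; lra.
  - assert (0 <= X * sumR i d) by (apply Rmult_le_pos; lra).
    assert (d i <= X * Y * d i) by (rewrite <- (Rmult_1_l (d i)) at 1; apply Rmult_le_compat_r; nra).
    assert ((1 + A * hh i) * (X * sumR i d) <= Y * (X * sumR i d)) by (apply Rmult_le_compat_r; auto).
    lra.
Qed.

(** Value and running integral of the discrete shooting solution with unit initial flux. *)
Fixpoint shoot (gam cr : R) (hh om : nat -> R) (n : nat) : R * R :=
  match n with
  | O => (0, 0)
  | S m => let (v, s) := shoot gam cr hh om m in
           (v + om m * (gam * v + cr * s + 1), s + hh m * v)
  end.

(** Subtracting [K] times the shooting solution removes [K] from the main part of the recursion and
    leaves zero initial data, so Gronwall's inequality bounds the remainder by multiples of [dt] and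
    of [h * Rabs K]. Because [E N = 0], the remainder at [N] is at least [Rabs K] times the end
    value of the shooting solution; as this end value is at least [kap], the term [h * Rabs K] can
    be absorbed. *)
Lemma discrete_stability (gam cr wm wM C1 Len : R) :
  0 <= cr -> 0 < wm -> wm <= wM -> 0 <= C1 -> 0 < Len ->
  exists C h0, 0 < C /\ 0 < h0 /\
  forall N h dt (E S hh om dl : nat -> R) K, h <= h0 -> E O = 0 -> S O = 0 -> E N = 0 ->
    sumR N hh = Len -> sumR N dl <= dt ->
    (forall i, (i < N)%nat -> 0 < hh i <= h /\ wm * hh i <= om i <= wM * hh i /\ 0 <= dl i /\
      let a := Rabs (E i) + Rabs (S i) + Rabs K in
      Rabs (E (i + 1)%nat - E i - om i * (gam * E i + cr * S i + K)) <= C1 * hh i * (h * a) + dl i /\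
      Rabs (S (i + 1)%nat - S i - hh i * E i) <= C1 * hh i * (h * a) + dl i) ->
    forall i, (i <= N)%nat -> Rabs (E i) + Rabs (S i) + Rabs K <= C * dt.
Proof.
  intros Hcr Hwm HwM HC1 HLen.
  set (G := Rabs gam + 1). assert (HG : 1 <= G) by (assert (A := Rabs_pos gam); unfold G; lra).
  assert (Hg : gam <= Rabs gam /\ - Rabs gam <= gam).
  { split; [apply Rle_abs|]. assert (A := Rle_abs (- gam)). rewrite Rabs_Ropp in A; lra. }
  assert (Hga := Rabs_pos gam).
  set (A0 := wM * (Rabs gam + cr) + 1).
  assert (HA0 : 1 <= A0) by (unfold A0; assert (0 <= wM * (Rabs gam + cr)) by (apply Rmult_le_pos; lra); lra).
  set (Cf := exp (A0 * Len) * (wM * Len)).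
  assert (HCf : 0 < Cf) by (apply Rmult_lt_0_compat; [apply exp_pos|apply Rmult_lt_0_compat; lra]).
  set (A1 := A0 + 2 * C1). set (X := exp (A1 * Len)).
  assert (HX : 0 < X) by apply exp_pos.
  (* The value at [Len] of the solution of v' = wm (1 - G v), v(0) = 0, which stays below the
     shooting solution at the right end. *)
  set (kap := (1 - exp (- (G * (wm * Len)))) / G).
  assert (Hkap : 0 < kap).
  { apply Rdiv_lt_0_compat; [|lra].
    assert (exp (- (G * (wm * Len))) < 1); [|lra]. rewrite <- exp_0. apply exp_increasing.
    assert (0 < G * (wm * Len)) by (repeat apply Rmult_lt_0_compat; lra). lra. }
  set (B := X * (2 * C1 * (Cf + 1) * Len)).
  assert (HB : 0 <= B) by (unfold B; repeat apply Rmult_le_pos; lra).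
  exists ((4 * X / kap) * (B + Cf + 1) + 2 * X),
    (Rmin (Rmin 1 (/ (G * wM))) (kap / (2 * (B + 1)))).
  assert (HGw : 0 < G * wM) by (apply Rmult_lt_0_compat; lra).
  assert (HXk : 0 < 4 * X / kap) by (apply Rdiv_lt_0_compat; lra).
  split; [assert (0 < 4 * X / kap * (B + Cf + 1)) by (apply Rmult_lt_0_compat; lra); lra|].
  split.
  { repeat apply Rmin_pos; [lra|apply Rinv_0_lt_compat; auto|apply Rdiv_lt_0_compat; lra]. }
  intros N h dt E S hh om dl K Hh0 HE0 HS0 HEN Hhh Hdl H.
  assert (Hh1 : h <= 1).
  { eapply Rle_trans; [apply Hh0|]. eapply Rle_trans; [apply Rmin_l|apply Rmin_l]. }
  (* Keeps [1 - G * om i] nonnegative; a negative [gam] could otherwise make the explicit step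
     overshoot below zero. *)
  assert (Hh2 : h * (G * wM) <= 1).
  { rewrite <- (Rinv_l (G * wM)) by lra. apply Rmult_le_compat_r; [lra|].
    eapply Rle_trans; [apply Hh0|]. eapply Rle_trans; [apply Rmin_l|apply Rmin_r]. }
  assert (Hh3 : h <= kap / (2 * (B + 1))) by (eapply Rle_trans; [apply Hh0|apply Rmin_r]).
  set (f := fun n => fst (shoot gam cr hh om n)). set (F := fun n => snd (shoot gam cr hh om n)).
  assert (f0 : f O = 0) by reflexivity. assert (F0 : F O = 0) by reflexivity.
  assert (fS : forall n, f (n + 1)%nat = f n + om n * (gam * f n + cr * F n + 1)).
  { intros n; unfold f, F; rewrite Nat.add_1_r; simpl. destruct (shoot gam cr hh om n); reflexivity. }
  assert (FS : forall n, F (n + 1)%nat = F n + hh n * f n).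
  { intros n; unfold f, F; rewrite Nat.add_1_r; simpl. destruct (shoot gam cr hh om n); reflexivity. }
  clearbody f F.
  assert (Hom : forall i, (i < N)%nat -> 0 <= om i /\ G * om i <= 1).
  { intros i Hi; destruct (H i Hi) as [H1 [H2 _]]. split; [nra|].
    apply Rle_trans with (G * (wM * h)); [|lra]. apply Rmult_le_compat_l; [lra|].
    eapply Rle_trans; [apply H2|]. apply Rmult_le_compat_l; lra. }
  assert (Hpos : forall i, (i <= N)%nat -> 0 <= f i /\ 0 <= F i).
  { induction i as [|i IH]; intros Hi; [lra|].
    destruct IH as [I1 I2]; [lia|]. destruct (H i ltac:(lia)) as [H1 _].
    destruct (Hom i ltac:(lia)) as [O1 O2].
    rewrite <- Nat.add_1_r, fS, FS. split.
    - assert (0 <= om i * (cr * F i)) by (repeat apply Rmult_le_pos; auto).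
      assert (0 <= (1 - G * om i) * f i) by (apply Rmult_le_pos; lra).
      assert (0 <= om i * f i * (gam + G)) by (repeat apply Rmult_le_pos; unfold G; lra).
      nra.
    - assert (0 <= hh i * f i) by (apply Rmult_le_pos; lra). lra. }
  assert (HfN : kap <= f N).
  { assert (L : forall i, (i <= N)%nat -> 1 - G * f i <= exp (- (G * (wm * sumR i hh)))).
    { induction i as [|i IH]; intros Hi.
      - simpl. rewrite f0, !Rmult_0_r, Ropp_0, exp_0. lra.
      - specialize (IH ltac:(lia)). destruct (Hpos i ltac:(lia)) as [P1 P2].
        destruct (H i ltac:(lia)) as [H1 [H2 _]]. destruct (Hom i ltac:(lia)) as [O1 O2].
        rewrite <- Nat.add_1_r, fS.
        assert (0 <= om i * (cr * F i)) by (repeat apply Rmult_le_pos; auto).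
        assert (0 <= om i * f i * (gam + G)) by (repeat apply Rmult_le_pos; unfold G; lra).
        apply Rle_trans with ((1 - G * om i) * (1 - G * f i)).
        { assert (0 <= G * (om i * (cr * F i) + om i * f i * (gam + G))) by (apply Rmult_le_pos; lra).
          nra. }
        rewrite Nat.add_1_r; simpl.
        replace (- (G * (wm * (sumR i hh + hh i)))) with
          (- (G * (wm * hh i)) + - (G * (wm * sumR i hh))) by ring.
        rewrite exp_plus. apply Rle_trans with ((1 - G * om i) * exp (- (G * (wm * sumR i hh)))).
        { apply Rmult_le_compat_l; lra. }
        apply Rmult_le_compat_r; [left; apply exp_pos|].
        apply Rle_trans with (1 + - (G * (wm * hh i))); [|apply exp_ineq1_le].
        assert (G * (wm * hh i) <= G * om i) by (apply Rmult_le_compat_l; lra). lra. }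
    specialize (L N (le_n N)). rewrite Hhh in L. unfold kap.
    apply Rmult_le_reg_l with G; [lra|].
    replace (G * ((1 - exp (- (G * (wm * Len)))) / G)) with (1 - exp (- (G * (wm * Len)))) by (field; lra).
    lra. }
  assert (Hsum : forall i, (i <= N)%nat -> 0 <= sumR i hh <= Len).
  { intros i Hi. split; [apply sumR_ge0; intros; left; apply H; lia|].
    rewrite <- Hhh. apply sumR_mono; auto. intros; left; apply H; auto. }
  assert (Hexp : forall A i, 0 <= A -> (i <= N)%nat -> exp (A * sumR i hh) <= exp (A * Len)).
  { intros A i HA Hi. destruct (Hsum i Hi) as [_ [S1|S1]]; [|rewrite S1; lra].
    destruct HA as [HA|<-]; [|rewrite !Rmult_0_l; lra].
    left; apply exp_increasing, Rmult_lt_compat_l; auto. }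
  assert (Hf : forall i, (i <= N)%nat -> f i + F i <= Cf).
  { intros i Hi. eapply Rle_trans.
    - apply (discrete_gronwall A0 N hh (fun i => f i + F i) (fun i => wM * hh i)); auto; [lra|lra|].
      intros j Hj. destruct (H j Hj) as [H1 [H2 _]]. destruct (Hom j Hj) as [O1 O2].
      destruct (Hpos j ltac:(lia)) as [P1 P2].
      split; [lra|]. split; [apply Rmult_le_pos; lra|]. rewrite <- Nat.add_1_r, fS, FS.
      assert (om j * (gam * f j + cr * F j + 1) <= wM * hh j * ((Rabs gam + cr) * (f j + F j) + 1)).
      { apply Rle_trans with (om j * ((Rabs gam + cr) * (f j + F j) + 1)).
        - apply Rmult_le_compat_l; auto.
          assert (gam * f j <= Rabs gam * f j) by (apply Rmult_le_compat_r; lra).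
          assert (0 <= Rabs gam * F j) by (apply Rmult_le_pos; auto).
          assert (0 <= cr * f j) by (apply Rmult_le_pos; auto). lra.
        - apply Rmult_le_compat_r; [|lra].
          assert (0 <= (Rabs gam + cr) * (f j + F j)) by (apply Rmult_le_pos; lra). lra. }
      assert (0 <= hh j * F j) by (apply Rmult_le_pos; lra). unfold A0. nra.
    - rewrite sumR_scal. unfold Cf. destruct (Hsum i Hi).
      apply Rmult_le_compat; [left; apply exp_pos|apply Rmult_le_pos; lra|apply Hexp; auto; lra|].
      apply Rmult_le_compat_l; lra. }
  set (x := fun i => Rabs (E i - K * f i) + Rabs (S i - K * F i)).
  assert (HaK := Rabs_pos K).
  assert (Hx : forall i, (i <= N)%nat -> Rabs (E i) + Rabs (S i) <= x i + Rabs K * Cf).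
  { intros i Hi. unfold x. destruct (Hpos i Hi) as [P1 P2]. specialize (Hf i Hi).
    assert (T1 : Rabs (E i) <= Rabs (E i - K * f i) + Rabs K * f i).
    { replace (E i) with ((E i - K * f i) + K * f i) at 1 by ring.
      eapply Rle_trans; [apply Rabs_triang|]. rewrite Rabs_mult, (Rabs_right (f i)) by lra. lra. }
    assert (T2 : Rabs (S i) <= Rabs (S i - K * F i) + Rabs K * F i).
    { replace (S i) with ((S i - K * F i) + K * F i) at 1 by ring.
      eapply Rle_trans; [apply Rabs_triang|]. rewrite Rabs_mult, (Rabs_right (F i)) by lra. lra. }
    assert (Rabs K * (f i + F i) <= Rabs K * Cf) by (apply Rmult_le_compat_l; auto). lra. }
  assert (Hh : forall i, (i < N)%nat -> 0 < h) by (intros i Hi; destruct (H i Hi); lra).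
  assert (Hxb : forall i, (i <= N)%nat -> x i <= h * B * Rabs K + 2 * X * dt).
  { intros i Hi.
    destruct N as [|N'].
    { simpl in Hhh. lra. }
    assert (Hhp := Hh O ltac:(lia)). set (N := Datatypes.S N') in *.
    eapply Rle_trans.
    - apply (discrete_gronwall A1 N hh x (fun i => (2 * C1 * h * (Rabs K * (Cf + 1))) * hh i + 2 * dl i)); auto.
      + unfold A1; lra.
      + unfold x. rewrite HE0, HS0, f0, F0, Rmult_0_r, Rminus_0_r, Rabs_R0. lra.
      + intros j Hj. destruct (H j Hj) as [H1 [H2 [H3 [H4 H5]]]]. destruct (Hom j Hj) as [O1 O2].
        assert (Hcoef : 0 <= 2 * C1 * h * (Rabs K * (Cf + 1))) by (repeat apply Rmult_le_pos; lra).
        split; [lra|]. split.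
        { assert (0 <= (2 * C1 * h * (Rabs K * (Cf + 1))) * hh j) by (apply Rmult_le_pos; lra). lra. }
        assert (Hxj := Hx j ltac:(lia)).
        rewrite <- Nat.add_1_r. unfold x at 1.
        rewrite fS, FS. set (rE := E j - K * f j). set (rS := S j - K * F j).
        assert (Ex : x j = Rabs rE + Rabs rS) by reflexivity.
        set (t1 := E (j + 1)%nat - E j - om j * (gam * E j + cr * S j + K)) in *.
        set (t2 := S (j + 1)%nat - S j - hh j * E j) in *.
        replace (E (j + 1)%nat - K * (f j + om j * (gam * f j + cr * F j + 1)))
          with (rE + om j * (gam * rE + cr * rS) + t1) by (unfold rE, rS, t1; ring).
        replace (S (j + 1)%nat - K * (F j + hh j * f j))
          with (rS + hh j * rE + t2) by (unfold rE, rS, t2; ring).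
        assert (R1 := Rabs_pos rE). assert (R2 := Rabs_pos rS).
        assert (T1 : Rabs (rE + om j * (gam * rE + cr * rS) + t1) <=
          Rabs rE + wM * hh j * ((Rabs gam + cr) * x j) + Rabs t1).
        { eapply Rle_trans; [apply Rabs_triang|]. apply Rplus_le_compat_r.
          eapply Rle_trans; [apply Rabs_triang|]. apply Rplus_le_compat_l.
          rewrite Rabs_mult, (Rabs_right (om j)) by lra.
          apply Rmult_le_compat; auto; [apply Rabs_pos|lra|].
          eapply Rle_trans; [apply Rabs_triang|]. rewrite !Rabs_mult, (Rabs_right cr) by lra.
          rewrite Ex. assert (0 <= Rabs gam * Rabs rS) by (apply Rmult_le_pos; auto).
          assert (0 <= cr * Rabs rE) by (apply Rmult_le_pos; auto). lra. }
        assert (T2 : Rabs (rS + hh j * rE + t2) <= Rabs rS + hh j * x j + Rabs t2).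
        { eapply Rle_trans; [apply Rabs_triang|]. apply Rplus_le_compat_r.
          eapply Rle_trans; [apply Rabs_triang|]. apply Rplus_le_compat_l.
          rewrite Rabs_mult, (Rabs_right (hh j)) by lra. apply Rmult_le_compat_l; lra. }
        set (a := Rabs (E j) + Rabs (S j) + Rabs K) in *.
        assert (T3 : C1 * hh j * (h * a) <= C1 * hh j * x j + C1 * h * (Rabs K * (Cf + 1)) * hh j).
        { assert (Ha : a <= x j + Rabs K * (Cf + 1)) by (unfold a; lra).
          assert (Hch : 0 <= C1 * hh j) by (apply Rmult_le_pos; lra).
          apply Rle_trans with (C1 * hh j * (h * (x j + Rabs K * (Cf + 1)))).
          - apply Rmult_le_compat_l; auto. apply Rmult_le_compat_l; lra.
          - assert (h * x j <= x j).
            { rewrite <- (Rmult_1_l (x j)) at 2. apply Rmult_le_compat_r; lra. }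
            assert (C1 * hh j * (h * x j) <= C1 * hh j * x j) by (apply Rmult_le_compat_l; auto).
            lra. }
        unfold A1, A0. lra.
    - rewrite sumR_plus, !sumR_scal. destruct (Hsum i Hi).
      assert (Hd : 0 <= sumR i dl <= dt).
      { split; [apply sumR_ge0; intros; apply H; lia|]. eapply Rle_trans; [|apply Hdl].
        apply sumR_mono; auto. intros; apply H; auto. }
      assert (Hc : 0 <= 2 * C1 * h * (Rabs K * (Cf + 1))) by (repeat apply Rmult_le_pos; lra).
      apply Rle_trans with (X * (2 * C1 * h * (Rabs K * (Cf + 1)) * Len + 2 * dt)).
      + apply Rmult_le_compat; [left; apply exp_pos| |apply Hexp; auto; unfold A1; lra|].
        * assert (0 <= 2 * C1 * h * (Rabs K * (Cf + 1)) * sumR i hh) by (apply Rmult_le_pos; auto). lra.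
        * apply Rplus_le_compat; [apply Rmult_le_compat_l; lra|lra].
      + unfold B. right; ring. }
  assert (HKb : Rabs K <= 4 * X / kap * dt).
  { assert (A : kap * Rabs K <= x N).
    { apply Rle_trans with (Rabs (E N - K * f N)).
      - rewrite HEN. replace (0 - K * f N) with (- (K * f N)) by ring.
        rewrite Rabs_Ropp, Rabs_mult, (Rabs_right (f N)) by lra.
        rewrite Rmult_comm. apply Rmult_le_compat_l; auto.
      - unfold x. assert (P := Rabs_pos (S N - K * F N)). lra. }
    assert (A2 := Hxb N (le_n N)).
    assert (A3 : h * B <= kap / 2).
    { apply Rle_trans with (kap / (2 * (B + 1)) * B); [apply Rmult_le_compat_r; auto|].
      apply Rmult_le_reg_r with (2 * (B + 1)); [lra|].
      replace (kap / (2 * (B + 1)) * B * (2 * (B + 1))) with (kap * B) by (field; lra).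
      replace (kap / 2 * (2 * (B + 1))) with (kap * B + kap) by field. lra. }
    assert (A4 : h * B * Rabs K <= kap / 2 * Rabs K) by (apply Rmult_le_compat_r; auto).
    apply Rmult_le_reg_l with (kap / 2); [lra|].
    replace (kap / 2 * (4 * X / kap * dt)) with (2 * X * dt) by (field; lra). lra. }
  intros i Hi. assert (A1' := Hx i Hi). assert (A2 := Hxb i Hi).
  assert (A3 : h * B * Rabs K <= B * Rabs K).
  { apply Rmult_le_compat_r; auto. rewrite <- (Rmult_1_l B) at 2. apply Rmult_le_compat_r; auto. }
  assert (A4 : (B + Cf + 1) * Rabs K <= (B + Cf + 1) * (4 * X / kap * dt)) by (apply Rmult_le_compat_l; lra).
  lra.
Qed.

(** * Orthogonal families *)

Lemma is_poly_deg_intro (q : R -> R) (n : nat) (c : R) (s : R -> R) :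
  c <> 0 -> pol n s -> (forall t, q t = s t + c * t ^ n) -> is_poly_deg q n.
Proof.
  intros Hc [cs Hs] H. exists (fun m => if Nat.eqb m n then c else cs m). split.
  - rewrite Nat.eqb_refl; auto.
  - intros t. simpl. rewrite Nat.eqb_refl, H, Hs. f_equal.
    apply sumR_ext; intros i Hi; destruct (Nat.eqb_spec i n); [lia|auto].
Qed.

Lemma Leg_0 (t : R) : Leg 0 t = 1.
Proof. reflexivity. Qed.

Lemma Leg_1 (t : R) : Leg 1 t = t.
Proof. reflexivity. Qed.

Lemma Leg_SS (n : nat) (t : R) :
  (INR n + 2) * Leg (S (S n)) t = (2 * INR n + 3) * t * Leg (S n) t - (INR n + 1) * Leg n t.
Proof.
  unfold Leg. simpl. destruct (leg2 n t) as [a b]; simpl.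
  field. assert (A := pos_INR n); lra.
Qed.

Lemma Leg_SSE (n : nat) (t : R) :
  Leg (S (S n)) t = ((2 * INR n + 3) * t * Leg (S n) t - (INR n + 1) * Leg n t) / (INR n + 2).
Proof. rewrite <- Leg_SS. field. assert (A := pos_INR n); lra. Qed.

Lemma pair_ind (P : nat -> Prop) :
  P O -> P 1%nat -> (forall n, P n -> P (S n) -> P (S (S n))) -> forall n, P n.
Proof.
  intros H0 H1 H n. enough (P n /\ P (S n)) by tauto. induction n as [|n [IH1 IH2]]; auto.
Qed.

Lemma Leg_deg (n : nat) : is_poly_deg (Leg n) n.
Proof.
  enough (exists c s, 0 < c /\ pol n s /\ forall t, Leg n t = s t + c * t ^ n) as [c [s [Hc [Hs H]]]].
  { apply (is_poly_deg_intro _ _ c s); auto; lra. }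
  revert n; apply pair_ind.
  - exists 1, (fun _ => 0); split; [lra|]; split; [apply pol_zero|].
    intros t; rewrite Leg_0; ring.
  - exists 1, (fun _ => 0); split; [lra|]; split; [apply pol_zero|].
    intros t; rewrite Leg_1; ring.
  - intros n [c0 [s0 [Hc0 [Hs0 H0]]]] [c1 [s1 [Hc1 [Hs1 H1]]]].
    assert (A := pos_INR n).
    exists ((2 * INR n + 3) / (INR n + 2) * c1),
      (fun t => (2 * INR n + 3) / (INR n + 2) * ((1 * t + 0) * s1 t)
                - (INR n + 1) / (INR n + 2) * Leg n t).
    split; [apply Rmult_lt_0_compat; auto; apply Rdiv_lt_0_compat; lra|]. split.
    + apply pol_minus; apply pol_scal; [apply pol_mul_linear; auto|].
      apply pol_S, pol_S_top; exists c0, s0; auto.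
    + intros t. rewrite Leg_SSE, (H1 t). simpl. field; lra.
Qed.

Lemma Leg_endpoints (n : nat) : Leg n 1 = 1 /\ Leg n (-1) = (-1) ^ n.
Proof.
  revert n; apply pair_ind; [rewrite !Leg_0; simpl; lra|rewrite !Leg_1; simpl; lra|].
  intros n [H1 H2] [H3 H4]. assert (A := pos_INR n).
  rewrite !Leg_SSE, H1, H2, H3, H4. simpl. split; field; lra.
Qed.

(** The second and third identities carry the induction on Bonnet's recursion; their combination
    [(2 n + 3) P_(n+1) = P_(n+2)' - P_n'] is what makes [P_(n+1)] have zero mean. *)
Lemma Leg_derivatives (n : nat) : exists d0 d1, forall t,
  is_derive (Leg n) t (d0 t) /\ is_derive (Leg (S n)) t (d1 t) /\
  d1 t = t * d0 t + (INR n + 1) * Leg n t /\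
  (INR n + 1) * Leg (S n) t = t * d1 t - d0 t.
Proof.
  induction n as [|n [d0 [d1 H]]].
  - exists (fun _ => 0), (fun _ => 1). intros t; split; [|split; [|simpl; rewrite Leg_0, Leg_1; lra]].
    + apply @is_derive_ext with (fun _ => 1); [intros; reflexivity|apply @is_derive_const].
    + apply @is_derive_ext with (fun t => t); [intros; reflexivity|]. apply @is_derive_id.
  - exists d1, (fun t => ((2 * INR n + 3) * (Leg (S n) t + t * d1 t) - (INR n + 1) * d0 t) / (INR n + 2)).
    intros t. destruct (H t) as [H0 [H1 [HA HB]]]. assert (A := pos_INR n).
    rewrite S_INR. split; [auto|]. split; [|split].
    + apply @is_derive_ext with
        (fun t => ((2 * INR n + 3) * t * Leg (S n) t - (INR n + 1) * Leg n t) / (INR n + 2)).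
      { intros; symmetry; apply Leg_SSE. }
      auto_derive.
      * repeat split; [exists (d1 t); auto|exists (d0 t); auto].
      * replace (Derive (fun x => Leg (S n) x) t) with (d1 t) by (symmetry; apply is_derive_unique; auto).
        replace (Derive (fun x => Leg n x) t) with (d0 t) by (symmetry; apply is_derive_unique; auto).
        field; lra.
    + apply Rmult_eq_reg_r with (INR n + 2); [|lra].
      unfold Rdiv; rewrite Rmult_assoc, Rinv_l by lra.
      assert (E : d0 t = t * d1 t - (INR n + 1) * Leg (S n) t) by lra. rewrite E. ring.
    + assert (E : d0 t = t * d1 t - (INR n + 1) * Leg (S n) t) by lra.
      replace ((INR n + 1 + 1) * Leg (S (S n)) t) with ((INR n + 2) * Leg (S (S n)) t) by ring.
      rewrite Leg_SS. rewrite E in HA |- *.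
      assert (HA' : (INR n + 1) * Leg n t = d1 t - t * (t * d1 t - (INR n + 1) * Leg (S n) t)) by lra.
      rewrite HA'. field; lra.
Qed.

Lemma Leg_pol (n : nat) : pol (S n) (Leg n).
Proof. apply is_poly_deg_pol, Leg_deg. Qed.

Lemma Leg_mean0 (n : nat) : RI (Leg (S n)) (-1) 1 = 0.
Proof.
  destruct (Leg_derivatives n) as [d0 [d1 H]].
  destruct (Leg_derivatives (S n)) as [d1' [d2 H']].
  assert (A := pos_INR n).
  assert (P : pc 0 (Leg (S n))) by (apply (pc_pol 0 (S (S n))), Leg_pol).
  assert (E : RI (fun t => (2 * INR n + 3) * Leg (S n) t) (-1) 1 =
    (Leg (S (S n)) 1 - Leg n 1) - (Leg (S (S n)) (-1) - Leg n (-1))).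
  { apply (ftc_cont (fun t => Leg (S (S n)) t - Leg n t)); [lra| | |].
    - intros; apply @continuous_minus; eapply pol_continuous, Leg_pol.
    - apply (pol_continuous (S (S n))), pol_scal, Leg_pol.
    - intros t _. destruct (H t) as [H0 [H1 [_ HB]]]. destruct (H' t) as [H1' [H2 [HA _]]].
      assert (E : d1' t = d1 t).
      { rewrite <- (is_derive_unique _ _ _ H1), <- (is_derive_unique _ _ _ H1'); auto. }
      replace ((2 * INR n + 3) * Leg (S n) t) with (d2 t - d0 t).
      + apply @is_derive_minus; auto.
      + rewrite HA, E, S_INR. lra. }
  rewrite (pcI_scal 0) in E by auto.
  destruct (Leg_endpoints n) as [E1 E2]. destruct (Leg_endpoints (S (S n))) as [E3 E4].
  rewrite E1, E2, E3, E4 in E. simpl in E.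
  apply Rmult_eq_reg_l with (2 * INR n + 3); lra.
Qed.

(** Bonnet's recursion solved for t P_n expresses it by P_(n+1) and P_(n-1). This lowers the
    exponent by one, and the degree by at most one, so [k < n] is preserved. *)
Lemma Leg_orth_pow (k n : nat) : (k < n)%nat -> RI (fun t => Leg n t * t ^ k) (-1) 1 = 0.
Proof.
  revert n; induction k as [|k IH]; intros n Hn.
  - destruct n as [|n]; [lia|]. rewrite <- (Leg_mean0 n). apply RI_ext; intros; simpl; ring.
  - destruct n as [|[|n]]; [lia|lia|].
    assert (A := pos_INR n).
    assert (PL : forall m, pc 0 (fun t => Leg m t * t ^ k)).
    { intros m. apply pc_mult; [apply (pc_pol 0 (S m)), Leg_pol|].
      apply pc_pow, pc_cont, continuous_id. }
    rewrite (RI_ext _ (fun t => (INR n + 3) / (2 * INR n + 5) * (Leg (S (S (S n))) t * t ^ k)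
       + (INR n + 2) / (2 * INR n + 5) * (Leg (S n) t * t ^ k))).
    + rewrite (pcI_plus 0), !(pcI_scal 0), !IH by (auto using pc_scal || lia). ring.
    + intros t. assert (E := Leg_SS (S n) t). rewrite S_INR in E.
      assert (E' : Leg (S (S n)) t * t = ((INR n + 3) * Leg (S (S (S n))) t + (INR n + 2) * Leg (S n) t)
                   / (2 * INR n + 5)).
      { apply Rmult_eq_reg_r with (2 * INR n + 5); [|lra]. unfold Rdiv.
        rewrite (Rmult_assoc (_ + _) (/ _)), Rinv_l by lra. lra. }
      simpl. rewrite <- Rmult_assoc, E'. field; lra.
Qed.

(** Common frame for the Legendre polynomials, with weight 1, and the generalized ones, whose weight
    jumps at [ah]. Orthogonality is required against all polynomials of lower degree, the form in
    which it is applied to Gauss points and projections. *)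
Definition orth_family (ah : R) (w : R -> R) (Lf : nat -> R -> R) : Prop :=
  pc ah w /\ (forall n, is_poly_deg (Lf n) n) /\
  (forall n s, pol n s -> RI (fun t => w t * (Lf n t * s t)) (-1) 1 = 0).

Lemma Leg_orth_family (ah : R) : orth_family ah (fun _ => 1) Leg.
Proof.
  split; [apply pc_const|]. split; [apply Leg_deg|]. intros n s [cs Hs].
  assert (P : forall m c, pc ah (fun t => c * (Leg n t * t ^ m))).
  { intros m c. apply pc_scal, pc_mult; [apply (pc_pol ah (S n)), Leg_pol|].
    apply pc_pow, pc_cont, continuous_id. }
  rewrite (RI_ext _ (fun t => sumR n (fun m => cs m * (Leg n t * t ^ m)))).
  - destruct (pcI_sum ah n (fun m t => cs m * (Leg n t * t ^ m)) (-1) 1) as [_ E]; auto.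
    rewrite E. apply sumR_0; intros m Hm.
    rewrite (pcI_scal ah), Leg_orth_pow by
      (auto || (eapply pc_ext; [|apply (P m 1)]; intros; simpl; ring)). ring.
  - intros t. rewrite Hs, Rmult_1_l, <- sumR_scal. apply sumR_ext; intros; ring.
Qed.

Lemma gen_orth_family (bm bp al : R) (X : nat -> R) (k : nat) (L : nat -> R -> R) :
  is_gen_legendre bm bp al X k L -> orth_family (ahat al X k) (what bm bp al X k) L.
Proof.
  intros [HL HLo]. set (ah := ahat al X k).
  assert (Pw : pc ah (what bm bp al X k)).
  { apply (pc_if ah (fun _ => / bm) (fun _ => / bp)); intros; apply continuous_const. }
  assert (PL : forall n, pc ah (L n)) by (intros n; apply (pc_pol ah (S n)), is_poly_deg_pol; auto).
  split; auto. split; auto. intros n s Hs.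
  destruct (pol_span L n HL s Hs) as [cs Hcs].
  rewrite (RI_ext _ (fun t => sumR n (fun m => cs m * (what bm bp al X k t * L m t * L n t)))).
  - destruct (pcI_sum ah n (fun m t => cs m * (what bm bp al X k t * L m t * L n t)) (-1) 1) as [_ E].
    { intros; auto using pc_mult, pc_scal. }
    rewrite E. apply sumR_0; intros m Hm. rewrite (pcI_scal ah) by auto using pc_mult.
    rewrite <- RInt_DefsE by (apply (pc_ex_RInt ah); auto using pc_mult).
    rewrite HLo by lia. ring.
  - intros t. rewrite Hcs, <- !sumR_scal. apply sumR_ext; intros; ring.
Qed.

Lemma pol_zero_interval (n : nat) (q : R -> R) (l r : R) : l < r -> pol n q ->
  (forall x, l <= x <= r -> q x = 0) -> forall x, q x = 0.
Proof.
  intros Hlr Hq H0. set (d := (r - l) / (INR n + 1)).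
  assert (A := pos_INR n).
  assert (Hd : 0 < d) by (apply Rdiv_lt_0_compat; lra).
  assert (HdE : d * (INR n + 1) = r - l) by (unfold d; field; lra).
  apply (pol_roots n (fun j => l + INR j * d)); auto.
  - intros i j Hij E. assert (B : INR i < INR j) by (apply lt_INR; lia). nra.
  - intros j Hj. apply H0. assert (B : INR j < INR n) by (apply lt_INR; lia).
    assert (Bj := pos_INR j). split; nra.
Qed.

(** * Transfer from the reference interval to an element *)

Section PhysicalElement.
Variables (al l r : R) (w : R -> R) (kap : R) (wr : R -> R) (Lf : nat -> R -> R).
Let xi0 (x : R) : R := (2 * x - l - r) / (r - l).
Hypothesis Hlr : l < r.
Hypothesis HLf : orth_family (xi0 al) wr Lf.
Hypothesis Hw : pc al w.
(** Proportional weights have the same orthogonal polynomials: away from the interface the reference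
    weight is 1, while [w] is the constant 1 / beta. *)
Hypothesis Hkap : forall x, l <= x <= r -> w x = kap * wr (xi0 x).

Let a : R := 2 / (r - l).
Let b : R := (- l - r) / (r - l).

Lemma xi0_affine (x : R) : xi0 x = a * x + b.
Proof. unfold xi0, a, b; field; lra. Qed.

Lemma slope_pos : 0 < a.
Proof. apply Rdiv_lt_0_compat; lra. Qed.

Lemma RI_reference (f : R -> R) (x : R) : pc (xi0 al) f ->
  RI (fun y => f (xi0 y)) l x = / a * RI f (-1) (xi0 x).
Proof.
  intros Hf. rewrite (RI_ext _ (fun y => f (a * y + b))) by (intros; rewrite xi0_affine; auto).
  rewrite (pcI_affine al) by (apply slope_pos || (rewrite <- xi0_affine; auto)).
  rewrite <- !xi0_affine. do 2 f_equal. unfold xi0; field; lra.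
Qed.

Lemma phys_pol (n : nat) : pol (S n) (fun x => Lf n (xi0 x)).
Proof.
  apply pol_ext with (fun x => Lf n (a * x + b)); [intros; rewrite xi0_affine; auto|].
  apply pol_affine, is_poly_deg_pol, HLf.
Qed.

Lemma ref_of_phys (x : R) : exists t, xi0 t = x.
Proof. exists ((x - b) / a). rewrite xi0_affine. field. assert (A := slope_pos); lra. Qed.

Lemma phys_neq0 (n : nat) : exists x, Lf n (xi0 x) <> 0.
Proof.
  destruct HLf as [_ [HL _]]. destruct (is_poly_deg_neq0 _ _ (HL n)) as [t Ht].
  destruct (ref_of_phys t) as [x Hx]. exists x; rewrite Hx; auto.
Qed.

Lemma phys_pol_ref (n : nat) (s : R -> R) : pol n s ->
  exists s', pol n s' /\ forall x, s x = s' (xi0 x).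
Proof.
  intros Hs. exists (fun t => s (/ a * t + (- b / a))); split; [apply pol_affine; auto|].
  intros x. f_equal. rewrite xi0_affine. assert (A := slope_pos). field; lra.
Qed.

Lemma phys_span (n : nat) (s : R -> R) : pol n s ->
  exists cs, forall x, s x = sumR n (fun m => cs m * Lf m (xi0 x)).
Proof.
  intros Hs. destruct (phys_pol_ref n s Hs) as [s' [Hs' E]].
  destruct (pol_span Lf n ltac:(apply HLf) s' Hs') as [cs Hcs].
  exists cs; intros x; rewrite E, Hcs; auto.
Qed.

Lemma phys_orth (n : nat) (s : R -> R) : pol n s ->
  RI (fun x => w x * (Lf n (xi0 x) * s x)) l r = 0.
Proof.
  intros Hs. destruct (phys_pol_ref n s Hs) as [s' [Hs' E]].
  assert (PL : pc (xi0 al) (Lf n)) by (apply (pc_pol _ (S n)), is_poly_deg_pol, HLf).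
  assert (Ps : pc (xi0 al) s') by (apply (pc_pol _ n); auto).
  assert (Pw : pc (xi0 al) wr) by apply HLf.
  rewrite (RInt_ext_lt _ (fun x => kap * (wr (xi0 x) * (Lf n (xi0 x) * s' (xi0 x))))); [|lra|].
  - rewrite (pcI_scal al).
    + rewrite (RI_reference (fun t => wr t * (Lf n t * s' t))) by auto using pc_mult.
      replace (xi0 r) with 1 by (unfold xi0; field; lra).
      rewrite (proj2 (proj2 HLf)); auto. ring.
    + apply (pc_ext al (fun x => (fun t => wr t * (Lf n t * s' t)) (a * x + b))).
      * intros x; rewrite xi0_affine; auto.
      * apply (pc_affine al a b (fun t => wr t * (Lf n t * s' t))); [apply slope_pos|]. rewrite <- xi0_affine. auto using pc_mult.
  - intros x Hx. rewrite Hkap, E by lra. ring.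
Qed.

(** By [pol_sup_le_norm2], a zero norm would make the polynomial vanish on the whole element. *)
Lemma phys_norm_pos (n : nat) (wm : R) : 0 < wm -> (forall x, l <= x <= r -> wm <= w x) ->
  0 < RI (fun x => w x * Lf n (xi0 x) ^ 2) l r.
Proof.
  intros Hwm Hwl. destruct (pol_sup_le_norm2 (S n) wm Hwm) as [C [HC H]].
  assert (G := H al l r w (fun x => Lf n (xi0 x)) Hlr Hw Hwl (phys_pol n)).
  destruct (Rlt_le_dec 0 (RI (fun x => w x * Lf n (xi0 x) ^ 2) l r)) as [|Hle]; auto.
  exfalso. destruct (phys_neq0 n) as [x Hx]. apply Hx.
  apply (pol_zero_interval (S n) (fun x => Lf n (xi0 x)) l r); auto; [apply phys_pol|].
  intros y Hy. specialize (G y Hy). cbv beta in G.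
  assert (A : (r - l) * Lf n (xi0 y) ^ 2 <= 0) by nra.
  assert (B := pow2_ge_0 (Lf n (xi0 y))).
  apply Rsqr_0_uniq. unfold Rsqr. nra.
Qed.

(** The [p] distinct zeros exhaust the degree, so the cofactor is a constant. *)
Lemma phys_gauss_factor (p : nat) (g : nat -> R) :
  (forall i j, (i < j < p)%nat -> g i <> g j) -> (forall j, (j < p)%nat -> Lf p (xi0 (g j)) = 0) ->
  exists c, c <> 0 /\ forall x, Lf p (xi0 x) = c * prodlin p g x.
Proof.
  intros Hg H0. destruct (pol_factor p 1 g (fun x => Lf p (xi0 x))) as [s [Hs E]]; auto.
  { replace (p + 1)%nat with (S p) by lia. apply phys_pol. }
  destruct (pol_div 0 s 0 Hs) as [s1 [Hs1 Es]].
  exists (s 0). split.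
  - intros Hs0. destruct (phys_neq0 p) as [x Hx]. apply Hx.
    rewrite E, Es, Hs0, (pol_0 _ Hs1); ring.
  - intros x. rewrite E, (Es x), (pol_0 _ Hs1); ring.
Qed.

Lemma phys_gauss_element (p : nat) (wm wM : R) (g : nat -> R) : 0 < wm ->
  (forall x, l <= x <= r -> wm <= w x <= wM) ->
  (forall j, (j < p)%nat -> l <= g j <= r) ->
  (forall i j, (i < j < p)%nat -> g i <> g j) ->
  (forall j, (j < p)%nat -> Lf p (xi0 (g j)) = 0) ->
  gauss_element p wm wM al l r w g.
Proof.
  intros Hwm Hwb Hg Hgd H0. repeat split; auto; try apply Hwb; try apply Hg; auto.
  intros s Hs. destruct (phys_gauss_factor p g Hgd H0) as [c [Hc E]].
  assert (Pp : pc al (prodlin p g)) by (apply (pc_pol al (S p)), pol_prodlin).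
  assert (Ps : pc al s) by (apply (pc_pol al p); auto).
  apply Rmult_eq_reg_l with c; auto. rewrite Rmult_0_r, <- (phys_orth p s Hs).
  rewrite <- (pcI_scal al) by auto using pc_mult.
  apply RI_ext; intros x. rewrite E; ring.
Qed.
End PhysicalElement.

(** * The local trial functions *)

Definition wgt (bm bp al x : R) : R := / betaf bm bp al x.

Lemma betaf_pos (bm bp al x : R) : 0 < bm -> 0 < bp -> 0 < betaf bm bp al x.
Proof. intros; unfold betaf; destruct (Rle_dec x al); auto. Qed.

Lemma pc_wgt (bm bp al : R) : pc al (wgt bm bp al).
Proof.
  apply pc_ext with (fun x => if Rle_dec x al then / bm else / bp).
  - intros x; unfold wgt, betaf; destruct (Rle_dec x al); auto.
  - apply (pc_if al (fun _ => / bm) (fun _ => / bp)); intros; apply continuous_const.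
Qed.

Lemma wgt_bounds (bm bp al x : R) : 0 < bm -> 0 < bp ->
  / (bm + bp) <= wgt bm bp al x <= / bm + / bp.
Proof.
  intros Hm Hp. assert (A := Rinv_0_lt_compat _ Hm). assert (B := Rinv_0_lt_compat _ Hp).
  unfold wgt, betaf; destruct (Rle_dec x al); split; try lra; apply Rinv_le_contravar; lra.
Qed.

Lemma RI_wgt_left (bm bp al l x : R) : l <= x <= al -> RI (wgt bm bp al) l x = / bm * (x - l).
Proof.
  intros H. rewrite <- pcI_const. apply RInt_ext_lt; [lra|]. intros y Hy.
  unfold wgt, betaf; destruct (Rle_dec y al); auto; lra.
Qed.

Lemma RI_wgt_right (bm bp al l x : R) : al <= l <= x -> RI (wgt bm bp al) l x = / bp * (x - l).
Proof.
  intros H. rewrite <- pcI_const. apply RInt_ext_lt; [lra|]. intros y Hy.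
  unfold wgt, betaf; destruct (Rle_dec y al); auto; lra.
Qed.

Lemma RI_wgt_across (bm bp al l x : R) : l <= al <= x ->
  RI (wgt bm bp al) l x = / bm * (al - l) + / bp * (x - al).
Proof.
  intros H. rewrite <- (pcI_Chasles al _ l al x) by apply pc_wgt.
  rewrite RI_wgt_left, RI_wgt_right by lra. ring.
Qed.

Lemma mesh_le (X : nat -> R) (N i j : nat) : (forall i, (i < N)%nat -> X i < X (S i)) ->
  (i <= j <= N)%nat -> X i <= X j.
Proof.
  intros HX [H1 H2]. induction H1 as [|j H1 IH]; [lra|].
  assert (A := HX j ltac:(lia)). assert (B := IH ltac:(lia)). lra.
Qed.

Lemma mesh_lt (X : nat -> R) (N i : nat) : (forall i, (i < N)%nat -> X i < X (S i)) ->
  (1 <= i <= N)%nat -> X (i - 1)%nat < X i.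
Proof. intros HX H. replace i with (S (i - 1)) at 2 by lia. apply HX; lia. Qed.

Section LocalBasis.
Variables (bm bp al : R) (X : nat -> R) (N k : nat) (L : nat -> R -> R).
Hypothesis Hbm : 0 < bm.
Hypothesis Hbp : 0 < bp.
Hypothesis HX : forall i, (i < N)%nat -> X i < X (S i).
Hypothesis Hk : (1 <= k <= N)%nat.
Hypothesis Hal : X (k - 1)%nat < al < X k.
Hypothesis HL : is_gen_legendre bm bp al X k L.

Notation w := (wgt bm bp al).

Lemma mesh_side (i : nat) : (1 <= i <= N)%nat -> i <> k -> X i < al \/ al < X (i - 1)%nat.
Proof.
  intros Hi Hne. destruct (le_lt_dec i (k - 1)).
  - left. assert (A := mesh_le X N i (k - 1) HX ltac:(lia)). lra.
  - right. assert (A := mesh_le X N k (i - 1) HX ltac:(lia)). lra.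
Qed.

(** The coefficient [beta] on an element other than the interface element. *)
Definition bel (i : nat) : R := betaf bm bp al (X i).

Lemma betaf_bel (i : nat) (x : R) : (1 <= i <= N)%nat -> i <> k ->
  X (i - 1)%nat <= x <= X i -> betaf bm bp al x = bel i.
Proof.
  intros Hi Hne Hx. unfold bel, betaf.
  destruct (mesh_side i Hi Hne), (Rle_dec x al), (Rle_dec (X i) al); auto; lra.
Qed.

Lemma bel_pos (i : nat) : 0 < bel i.
Proof. apply betaf_pos; auto. Qed.

Lemma RI_wgt_bel (i : nat) (x : R) : (1 <= i <= N)%nat -> i <> k ->
  X (i - 1)%nat <= x <= X i -> RI w (X (i - 1)%nat) x = / bel i * (x - X (i - 1)%nat).
Proof.
  intros Hi Hne Hx. rewrite <- pcI_const. apply RInt_ext_lt; [lra|]. intros y Hy.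
  unfold wgt. rewrite (betaf_bel i); auto; lra.
Qed.

Lemma xi_le (x : R) : xi X k x <= ahat al X k <-> x <= al.
Proof.
  unfold ahat, xi. assert (A := mesh_lt X N k HX Hk).
  split; intros H.
  - apply Rmult_le_compat_r with (r := X k - X (k - 1)%nat) in H; [|lra].
    unfold Rdiv in H; rewrite !Rmult_assoc, !Rinv_l in H; lra.
  - apply Rmult_le_compat_r; [left; apply Rinv_0_lt_compat|]; lra.
Qed.

(** Lets the interface element share all later proofs with the others: [wr] is [what] with factor 1
    on the former, and the constant 1 with factor 1 / beta on the latter. *)
Lemma local_family (i : nat) : (1 <= i <= N)%nat ->
  exists kap wr, kap <> 0 /\
    orth_family (xi X i al) wr (fun n => if Nat.eqb i k then L n else Leg n) /\
    (forall x, X (i - 1)%nat <= x <= X i -> w x = kap * wr (xi X i x)) /\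
    (forall n x, (1 <= n)%nat ->
      ldphi bm bp al X k L i (S n) x = 2 / (X i - X (i - 1)%nat) * (wr (xi X i x) * Pin X k L i n x) /\
      lphi bm bp al X k L i (S n) x =
        RI (fun s => wr s * (if Nat.eqb i k then L n else Leg n) s) (-1) (xi X i x)).
Proof.
  intros Hi. unfold ldphi, lphi, Pin. destruct (Nat.eqb_spec i k) as [->|Hne].
  - exists 1, (what bm bp al X k). split; [lra|].
    assert (HO := gen_orth_family _ _ _ _ _ _ HL). split; [exact HO|]. split.
    + intros x Hx. rewrite Rmult_1_l. unfold wgt, betaf, what.
      destruct (Rle_dec x al) as [H|H], (Rle_dec (xi X k x) (ahat al X k)) as [H'|H']; auto;
        exfalso; rewrite xi_le in H'; auto.
    + intros n x Hn. destruct n as [|n]; [lia|]. split; auto. simpl.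
      apply RInt_DefsE, (pc_ex_RInt (ahat al X k)), pc_mult; [apply HO|].
      apply (pc_pol _ (S (S n))), is_poly_deg_pol, HO.
  - exists (/ bel i), (fun _ => 1). assert (B := bel_pos i).
    split; [apply Rinv_neq_0_compat; lra|]. split; [apply Leg_orth_family|]. split.
    + intros x Hx. unfold wgt. rewrite (betaf_bel i) by auto. ring.
    + intros n x Hn. destruct n as [|n]; [lia|]. split; [simpl; ring|]. simpl.
      rewrite RInt_DefsE.
      * apply RI_ext; intros; ring.
      * apply (pc_ex_RInt 0), (pc_pol _ (S (S n))), Leg_pol.
Qed.

(** The piecewise formulas of the first two modes describe the functions of constant flux with nodal
    values 0 and 1. The flux [c0] is the harmonic mean of beta over the element, divided by the
    length of the element. *)
Lemma local_modes_01 (i : nat) : (1 <= i <= N)%nat ->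
  exists c0, forall x, X (i - 1)%nat <= x <= X i ->
    betaf bm bp al x * ldphi bm bp al X k L i 0 x = - c0 /\
    betaf bm bp al x * ldphi bm bp al X k L i 1 x = c0 /\
    lphi bm bp al X k L i 0 x = 1 - c0 * RI w (X (i - 1)%nat) x /\
    lphi bm bp al X k L i 1 x = c0 * RI w (X (i - 1)%nat) x /\
    c0 * RI w (X (i - 1)%nat) (X i) = 1.
Proof.
  intros Hi. assert (Hlr := mesh_lt X N i HX Hi). unfold ldphi, lphi.
  destruct (Nat.eqb_spec i k) as [->|Hne].
  - assert (HD : 0 < (X k - al) * bm + (al - X (k - 1)%nat) * bp).
    { apply Rplus_lt_0_compat; apply Rmult_lt_0_compat; lra. }
    assert (ED : Dden bm bp al X k =
      2 * ((X k - al) * bm + (al - X (k - 1)%nat) * bp) / (X k - X (k - 1)%nat)).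
    { unfold Dden, ahat, xi; field; lra. }
    exists (bm * bp / Dden bm bp al X k * (2 / (X k - X (k - 1)%nat))).
    intros x Hx. rewrite (RI_wgt_across bm bp al _ (X k)) by lra.
    simpl. unfold betaf. rewrite ED.
    assert (Hle := xi_le x).
    destruct (Rle_dec x al) as [H|H], (Rle_dec (xi X k x) (ahat al X k)) as [H'|H'];
      try (exfalso; tauto).
    + rewrite RI_wgt_left by lra. unfold ahat, xi. repeat split; field; repeat split; lra.
    + rewrite RI_wgt_across by lra. unfold ahat, xi. repeat split; field; repeat split; lra.
  - assert (B := bel_pos i). exists (bel i / (X i - X (i - 1)%nat)).
    intros x Hx. rewrite !RI_wgt_bel by (auto || lra). rewrite (betaf_bel i) by auto.
    simpl. unfold xi. repeat split; field; lra.
Qed.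

(** [m n] is the flux [beta phi_(i,n)'] of mode [n], a polynomial on the whole element. *)
Lemma local_basis (i : nat) : (1 <= i <= N)%nat ->
  exists (m : nat -> R -> R) c c0 c1, c <> 0 /\
    (forall n x, (1 <= n)%nat -> m (S n) x = c * Pin X k L i n x) /\
    (forall x, m O x = c0) /\ (forall x, m 1%nat x = c1) /\
    (forall n x, X (i - 1)%nat <= x <= X i ->
      betaf bm bp al x * ldphi bm bp al X k L i n x = m n x /\
      lphi bm bp al X k L i n x =
        (if Nat.eqb n 0 then 1 else 0) + RI (fun y => w y * m n y) (X (i - 1)%nat) x /\
      lphi bm bp al X k L i n (X i) = (if Nat.eqb n 1 then 1 else 0)).
Proof.
  intros Hi. assert (Hlr := mesh_lt X N i HX Hi).
  destruct (local_family i Hi) as [kap [wr [Hkap [HO [Hw Hphi]]]]].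
  destruct (local_modes_01 i Hi) as [c0 H01].
  set (c := 2 / (X i - X (i - 1)%nat) / kap).
  exists (fun n x => match n with O => - c0 | S O => c0 | S n => c * Pin X k L i n x end), c, (- c0), c0.
  split. { unfold c. repeat apply Rmult_integral_contrapositive_currified; auto with real;
           apply Rinv_neq_0_compat; auto; lra. }
  split. { intros [|n] x Hn; [lia|auto]. }
  split; auto. split; auto.
  set (Lf := fun n => if Nat.eqb i k then L n else Leg n) in *.
  assert (EP : forall n x, Pin X k L i n x = Lf n (xi X i x)).
  { intros n x; unfold Pin, Lf; destruct (Nat.eqb i k); auto. }
  assert (PP : forall n, pol (S n) (Pin X k L i n)).
  { intros n. apply pol_ext with (fun x => Lf n (xi X i x)); [intros; rewrite EP; auto|].
    apply (phys_pol al (X (i - 1)%nat) (X i) wr Lf); auto. }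
  assert (Pw := pc_wgt bm bp al).
  intros n x Hx. destruct n as [|[|n]].
  - destruct (H01 x Hx) as [A1 [A2 [A3 [A4 A5]]]].
    destruct (H01 (X i) ltac:(lra)) as [B1 [B2 [B3 [B4 B5]]]]. simpl.
    rewrite (RI_ext _ (fun y => - c0 * w y)), (pcI_scal al) by (auto || intros; ring).
    repeat split; auto; lra.
  - destruct (H01 x Hx) as [A1 [A2 [A3 [A4 A5]]]].
    destruct (H01 (X i) ltac:(lra)) as [B1 [B2 [B3 [B4 B5]]]]. simpl.
    rewrite (RI_ext _ (fun y => c0 * w y)), (pcI_scal al) by (auto || intros; ring).
    repeat split; auto; lra.
  - destruct (Hphi (S n) x ltac:(lia)) as [A1 A2].
    assert (Pwr : pc (xi X i al) (fun s => wr s * Lf (S n) s)).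
    { apply pc_mult; [apply HO|]. apply (pc_pol _ (S (S n))), is_poly_deg_pol, HO. }
    assert (EI : forall z, X (i - 1)%nat <= z <= X i ->
      RI (fun s => wr s * Lf (S n) s) (-1) (xi X i z) =
      RI (fun y => w y * (c * Pin X k L i (S n) y)) (X (i - 1)%nat) z).
    { intros z Hz.
      rewrite (RInt_ext_lt (fun y => w y * (c * Pin X k L i (S n) y))
        (fun y => 2 / (X i - X (i - 1)%nat) * (fun s => wr s * Lf (S n) s) (xi X i y))); [|lra|].
      - assert (ER := RI_reference al (X (i - 1)%nat) (X i) Hlr _ z Pwr). cbv beta in ER.
        fold (xi X i z) in ER.
        rewrite (pcI_scal al).
        + change (RI (fun y => (fun s => wr s * Lf (S n) s) (xi X i y)) (X (i - 1)%nat) z =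
            / (2 / (X i - X (i - 1)%nat)) * RI (fun s => wr s * Lf (S n) s) (-1) (xi X i z)) in ER.
          rewrite ER. field; lra.
        + apply pc_ext with (fun y => (fun s => wr s * Lf (S n) s)
            (2 / (X i - X (i - 1)%nat) * y + (- X (i - 1)%nat - X i) / (X i - X (i - 1)%nat))).
          * intros y; cbv beta. replace (2 / (X i - X (i - 1)%nat) * y + _) with (xi X i y); auto.
            unfold xi; field; lra.
          * apply (pc_affine al _ _ (fun s => wr s * Lf (S n) s)).
            -- apply Rdiv_lt_0_compat; lra.
            -- replace (2 / (X i - X (i - 1)%nat) * al + _) with (xi X i al); auto.
               unfold xi; field; lra.
      - intros y Hy. rewrite Hw, EP by lra. unfold c. field. split; [lra|auto]. }
    split; [|split].
    + rewrite A1. assert (B := betaf_pos bm bp al x Hbm Hbp).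
      assert (E := Hw x Hx). unfold wgt in E.
      assert (Ew : wr (xi X i x) = / betaf bm bp al x / kap) by (rewrite E; field; auto).
      rewrite Ew. unfold c. field. repeat split; auto; lra.
    + rewrite A2, EI by auto. simpl; ring.
    + destruct (Hphi (S n) (X i) ltac:(lia)) as [_ A3]. rewrite A3.
      replace (xi X i (X i)) with 1 by (unfold xi; field; lra). simpl.
      destruct HO as [_ [_ HO]]. rewrite <- (HO (S n) (fun _ => 1)) by (apply pol_const; lia).
      apply RI_ext; intros; unfold Lf; destruct (Nat.eqb i k); ring.
Qed.

Lemma Pin_facts (i : nat) : (1 <= i <= N)%nat ->
  (forall n, pol (S n) (Pin X k L i n)) /\
  (forall n s, pol n s -> exists cs, forall x, s x = sumR n (fun m => cs m * Pin X k L i m x)) /\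
  (forall n s, pol n s -> RI (fun x => w x * (Pin X k L i n x * s x)) (X (i - 1)%nat) (X i) = 0) /\
  (forall n, 0 < RI (fun x => w x * Pin X k L i n x ^ 2) (X (i - 1)%nat) (X i)) /\
  (forall p g, (forall j, (j < p)%nat -> X (i - 1)%nat <= g j <= X i) ->
    (forall i j, (i < j < p)%nat -> g i <> g j) ->
    (forall j, (j < p)%nat -> Pin X k L i p (g j) = 0) ->
    gauss_element p (/ (bm + bp)) (/ bm + / bp) al (X (i - 1)%nat) (X i) w g /\
    exists c, c <> 0 /\ forall x, Pin X k L i p x = c * prodlin p g x).
Proof.
  intros Hi. assert (Hlr := mesh_lt X N i HX Hi).
  destruct (local_family i Hi) as [kap [wr [Hkap [HO [Hw Hphi]]]]].
  set (Lf := fun n => if Nat.eqb i k then L n else Leg n) in *.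
  assert (EP : forall n x, Pin X k L i n x = Lf n (xi X i x)).
  { intros n x; unfold Pin, Lf; destruct (Nat.eqb i k); auto. }
  assert (Pw := pc_wgt bm bp al).
  assert (Hwm : 0 < / (bm + bp)) by (apply Rinv_0_lt_compat; lra).
  split; [|split; [|split; [|split]]].
  - intros n. apply pol_ext with (fun x => Lf n (xi X i x)); [intros; rewrite EP; auto|].
    apply (phys_pol al (X (i - 1)%nat) (X i) wr Lf); auto.
  - intros n s Hs. destruct (phys_span al (X (i - 1)%nat) (X i) wr Lf Hlr HO n s Hs) as [cs Hcs].
    exists cs; intros x. rewrite Hcs. apply sumR_ext; intros; rewrite EP; auto.
  - intros n s Hs. rewrite <- (phys_orth al (X (i - 1)%nat) (X i) w kap wr Lf Hlr HO Hw n s Hs).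
    apply RI_ext; intros; rewrite EP; auto.
  - intros n. assert (A := phys_norm_pos al (X (i - 1)%nat) (X i) w wr Lf Hlr HO Pw n _ Hwm
      ltac:(intros; apply wgt_bounds; auto)).
    rewrite (RI_ext _ (fun x => w x * Lf n (xi X i x) ^ 2)); [exact A|intros; rewrite EP; auto].
  - intros p g Hg Hgd H0. split.
    + apply (phys_gauss_element al (X (i - 1)%nat) (X i) w kap wr Lf); auto.
      * intros; apply wgt_bounds; auto.
      * intros j Hj; rewrite <- (H0 j Hj), EP; auto.
    + destruct (phys_gauss_factor al (X (i - 1)%nat) (X i) wr Lf Hlr HO p g Hgd) as [c [Hc E]].
      * intros j Hj; rewrite <- (H0 j Hj), EP; auto.
      * exists c; split; auto. intros x; rewrite EP; apply E.
Qed.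

(** Only the modes 0 and 1 are nonzero at an end of the element, one at each end, so a trial
    function amounts to its left value and a single polynomial flux. *)
Lemma local_representation (p i : nat) (cs : nat -> R) : (1 <= p)%nat -> (1 <= i <= N)%nat ->
  exists q, pol p q /\
    (forall x, X (i - 1)%nat <= x <= X i ->
      betaf bm bp al x * sumR (S p) (fun n => cs n * ldphi bm bp al X k L i n x) = q x /\
      sumR (S p) (fun n => cs n * lphi bm bp al X k L i n x) =
        cs O + RI (fun y => w y * q y) (X (i - 1)%nat) x) /\
    sumR (S p) (fun n => cs n * lphi bm bp al X k L i n (X i)) = cs 1%nat.
Proof.
  intros Hp Hi. assert (Hlr := mesh_lt X N i HX Hi).
  destruct (local_basis i Hi) as [m [c [c0 [c1 [Hc [Hm [Hm0 [Hm1 Hb]]]]]]]].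
  destruct (Pin_facts i Hi) as [PP _].
  assert (Pm : forall n, (n <= p)%nat -> pol p (m n)).
  { intros [|[|n]] Hn.
    - apply pol_ext with (fun _ => c0); auto. apply pol_const; auto.
    - apply pol_ext with (fun _ => c1); auto. apply pol_const; auto.
    - apply pol_ext with (fun x => c * Pin X k L i (S n) x).
      { intros; rewrite Hm by lia; auto. }
      apply pol_scal. apply pol_mono with (S (S n)); auto. }
  exists (fun x => sumR (S p) (fun n => cs n * m n x)).
  split; [|split].
  - assert (Q : forall n, (n <= S p)%nat -> pol p (fun x => sumR n (fun n => cs n * m n x))).
    { induction n as [|n IH]; intros Hn; [apply pol_zero|].
      apply (pol_plus p (fun x => sumR n (fun n => cs n * m n x))); [apply IH; lia|].
      apply pol_scal, Pm; lia. }
    apply Q; auto.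
  - intros x Hx. split.
    + rewrite <- sumR_scal. apply sumR_ext; intros n Hn.
      destruct (Hb n x Hx) as [E _]. rewrite <- E; ring.
    + rewrite (RI_ext _ (fun y => sumR (S p) (fun n => cs n * (w y * m n y)))).
      * destruct (pcI_sum al (S p) (fun n y => cs n * (w y * m n y)) (X (i - 1)%nat) x) as [_ E].
        { intros n Hn. apply pc_scal, pc_mult; [apply pc_wgt|apply (pc_pol al p), Pm; lia]. }
        rewrite E.
        rewrite (sumR_ext _ _ (fun n => cs n * (if Nat.eqb n 0 then 1 else 0) +
          RI (fun y => cs n * (w y * m n y)) (X (i - 1)%nat) x)).
        -- rewrite sumR_plus. f_equal. rewrite (sumR_single (S p) 0); [simpl; ring|lia|].
           intros j Hj Hne. destruct (Nat.eqb_spec j 0); [congruence|ring].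
        -- intros n Hn. destruct (Hb n x Hx) as [_ [E2 _]]. rewrite E2.
           rewrite (pcI_scal al); [ring|].
           apply pc_mult; [apply pc_wgt|apply (pc_pol al p), Pm; lia].
      * intros y. rewrite <- sumR_scal. apply sumR_ext; intros; ring.
  - rewrite (sumR_single (S p) 1); [|lia|].
    + destruct (Hb 1%nat (X i) ltac:(lra)) as [_ [_ E]]. rewrite E; simpl; ring.
    + intros j Hj Hne. destruct (Hb j (X i) ltac:(lra)) as [_ [_ E]]. rewrite E.
      destruct (Nat.eqb_spec j 1); [congruence|ring].
Qed.

(** Writing each phi' as [w] times its polynomial flux turns the quotients of [Icoef] into Fourier
    coefficients of [F] along the weighted orthogonal polynomials. The constant component is
    supplied by interpolation at both nodes. *)
Lemma projection_representation (p i : nat) (u fu F : R -> R) : (1 <= p)%nat -> (1 <= i <= N)%nat ->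
  pc al F -> (forall x, X (i - 1)%nat <= x <= X i -> fu x = F x) ->
  RI (fun y => w y * F y) (X (i - 1)%nat) (X i) = u (X i) - u (X (i - 1)%nat) ->
  exists Q, pol p Q /\
    (forall x, X (i - 1)%nat <= x <= X i ->
      Ih bm bp al X k p L u fu i x =
        u (X (i - 1)%nat) + RI (fun y => w y * Q y) (X (i - 1)%nat) x) /\
    (forall s, pol p s -> RI (fun x => w x * ((F x - Q x) * s x)) (X (i - 1)%nat) (X i) = 0).
Proof.
  intros Hp Hi PF HF Hu. assert (Hlr := mesh_lt X N i HX Hi).
  set (cs := Icoef bm bp al X k L u fu i).
  destruct (local_representation p i cs Hp Hi) as [Q [HQ [HQ1 HQ2]]].
  exists Q. split; auto. split; [intros x Hx; apply HQ1; auto|].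
  destruct (local_basis i Hi) as [m [c [c0 [c1 [Hc [Hm [Hm0 [Hm1 Hb]]]]]]]].
  destruct (Pin_facts i Hi) as [PP [Hspan [Horth [Hnorm _]]]].
  set (l := X (i - 1)%nat) in *. set (r := X i) in *.
  assert (Pw := pc_wgt bm bp al).
  assert (PPin : forall n, pc al (Pin X k L i n)) by (intros n; apply (pc_pol al (S n)); auto).
  assert (PQ : pc al Q) by (apply (pc_pol al p); auto).
  assert (Pm : forall n, pc al (m n)).
  { intros [|[|n]].
    - apply pc_ext with (fun _ => c0); auto. apply pc_const.
    - apply pc_ext with (fun _ => c1); auto. apply pc_const.
    - apply pc_ext with (fun x => c * Pin X k L i (S n) x); [intros; rewrite Hm by lia; auto|].
      apply pc_scal; auto. }
  assert (Pin0 : exists d, d <> 0 /\ forall x, Pin X k L i 0 x = d).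
  { destruct (pol_div 0 (Pin X k L i 0) 0 (PP O)) as [s1 [Hs1 E]].
    assert (E' : forall x, Pin X k L i 0 x = Pin X k L i 0 0).
    { intros x; rewrite E, (pol_0 _ Hs1); ring. }
    exists (Pin X k L i 0 0). split; auto. intros Z. assert (A := Hnorm O).
    rewrite (RI_ext _ (fun _ => 0)) in A; [rewrite pcI_const in A; lra|].
    intros x; rewrite E', Z; ring. }
  (* On the basis function [P_(i,j)]: conservation for [j = 0], the definition of the coefficient otherwise. *)
  assert (HB : forall j, (j < p)%nat ->
    RI (fun x => w x * (F x * Pin X k L i j x)) l r = RI (fun x => w x * (Q x * Pin X k L i j x)) l r).
  { intros j Hj. destruct j as [|j].
    - destruct Pin0 as [d [_ Hd]].
      rewrite (RI_ext _ (fun x => d * (w x * F x))) by (intros; rewrite Hd; ring).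
      rewrite (RI_ext (fun x => w x * (Q x * _)) (fun x => d * (w x * Q x))) by (intros; rewrite Hd; ring).
      rewrite !(pcI_scal al), Hu by auto using pc_mult. f_equal.
      destruct (HQ1 r ltac:(lra)) as [_ E]. rewrite HQ2 in E.
      unfold cs in E; simpl in E. fold l r in E. lra.
    - set (P := Pin X k L i (S j)) in *.
      assert (PP1 : pc al P) by apply PPin.
      set (NN := RI (fun x => w x * P x ^ 2) l r). assert (HN : 0 < NN) by apply Hnorm.
      assert (Eld : forall x, l <= x <= r -> ldphi bm bp al X k L i (S (S j)) x = w x * (c * P x)).
      { intros x Hx. destruct (Hb (S (S j)) x Hx) as [E _]. rewrite Hm in E by lia. fold P in E.
        rewrite <- E. unfold wgt. assert (B := betaf_pos bm bp al x Hbm Hbp). field; lra. }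
      assert (I1 : Defs.RInt (fun x => fu x * ldphi bm bp al X k L i (S (S j)) x) l r =
                   c * RI (fun x => w x * (F x * P x)) l r).
      { destruct (RInt_ext_off al (fun x => fu x * ldphi bm bp al X k L i (S (S j)) x)
          (fun x => c * (w x * (F x * P x))) l r) as [X1 X2]; [lra|auto using pc_scal, pc_mult| |].
        - intros x Hx _. rewrite HF, Eld by lra. ring.
        - rewrite RInt_DefsE, X2, (pcI_scal al) by (auto using pc_mult). auto. }
      assert (I2 : Defs.RInt (fun x => betaf bm bp al x * ldphi bm bp al X k L i (S (S j)) x ^ 2) l r =
                   c ^ 2 * NN).
      { assert (PP2 : pc al (fun x => w x * P x ^ 2)).
        { apply pc_mult; auto; apply pc_pow; auto. }
        destruct (RInt_ext_off al (fun x => betaf bm bp al x * ldphi bm bp al X k L i (S (S j)) x ^ 2)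
          (fun x => c ^ 2 * (w x * P x ^ 2)) l r) as [X1 X2]; [lra|apply pc_scal; auto| |].
        - intros x Hx _. rewrite Eld by lra. unfold wgt.
          assert (B := betaf_pos bm bp al x Hbm Hbp). field; lra.
        - rewrite RInt_DefsE, X2, (pcI_scal al) by auto. auto. }
      assert (Ecs : cs (S (S j)) * (c * NN) = RI (fun x => w x * (F x * P x)) l r).
      { unfold cs, Icoef. fold l r. rewrite I1, I2. field. split; lra. }
      rewrite <- Ecs.
      rewrite (RInt_ext_lt (fun x => w x * (Q x * P x))
        (fun x => sumR (S p) (fun n => cs n * (w x * (m n x * P x))))); [|lra|].
      + destruct (pcI_sum al (S p) (fun n x => cs n * (w x * (m n x * P x))) l r) as [_ E].
        { intros n Hn. auto using pc_scal, pc_mult. }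
        rewrite E, (sumR_single (S p) (S (S j))); [|lia|].
        * rewrite (RI_ext _ (fun x => (cs (S (S j)) * c) * (w x * P x ^ 2))).
          -- rewrite (pcI_scal al); [fold NN; ring|].
             apply pc_mult; auto; apply pc_pow; auto.
          -- intros x. rewrite Hm by lia. fold P. ring.
        * intros n Hn Hne.
          rewrite (pcI_scal al) by (auto using pc_mult).
          enough (Z : RI (fun x => w x * (m n x * P x)) l r = 0) by (rewrite Z; ring).
          destruct (Nat.lt_trichotomy n (S (S j))) as [Hlt|[Heq|Hgt]]; [|lia|].
          -- rewrite <- (Horth (S j) (m n)); [apply RI_ext; intros; unfold P; ring|].
             destruct n as [|[|n]].
             ++ apply pol_ext with (fun _ => c0); auto. apply pol_const; lia.
             ++ apply pol_ext with (fun _ => c1); auto. apply pol_const; lia.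
             ++ apply pol_ext with (fun x => c * Pin X k L i (S n) x); [intros; rewrite Hm by lia; auto|].
                apply pol_scal, pol_mono with (S (S n)); auto; lia.
          -- destruct n as [|n]; [lia|].
             rewrite <- (Horth n (fun x => c * P x)).
             ++ apply RI_ext; intros x. rewrite Hm by lia. ring.
             ++ apply pol_scal. unfold P. apply pol_mono with (S (S j)); auto; lia.
      + intros x Hx. destruct (HQ1 x ltac:(lra)) as [E _]. rewrite <- E.
        rewrite (sumR_ext (S p) (fun n => cs n * (w x * (m n x * P x)))
          (fun n => (w x * P x) * (cs n * (betaf bm bp al x * ldphi bm bp al X k L i n x)))).
        * rewrite sumR_scal.
          rewrite (sumR_ext (S p) (fun n => cs n * (betaf bm bp al x * _))
            (fun n => betaf bm bp al x * (cs n * ldphi bm bp al X k L i n x))) by (intros; ring).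
          rewrite sumR_scal. ring.
        * intros n Hn. destruct (Hb n x ltac:(lra)) as [E' _]. rewrite E'. ring. }
  intros s Hs. destruct (Hspan p s Hs) as [ds Hds].
  rewrite (RI_ext _ (fun x => sumR p (fun j => ds j *
    (w x * (F x * Pin X k L i j x) - w x * (Q x * Pin X k L i j x))))).
  - destruct (pcI_sum al p (fun j x => ds j *
      (w x * (F x * Pin X k L i j x) - w x * (Q x * Pin X k L i j x))) l r) as [_ E].
    { intros; auto using pc_scal, pc_mult, pc_minus. }
    rewrite E. apply sumR_0; intros j Hj.
    rewrite (pcI_scal al) by auto using pc_mult, pc_minus.
    rewrite (pcI_minus al (fun x => w x * (F x * Pin X k L i j x)) (fun x => w x * (Q x * Pin X k L i j x))),
      HB by auto using pc_mult. ring.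
  - intros x. rewrite Hds, <- !sumR_scal. apply sumR_ext; intros; ring.
Qed.
End LocalBasis.

(** * The exact solution *)

(** Composition with it freezes a function outside [[l, r]]; a Lipschitz bound on the closed
    interval then holds on the whole line, where [pc] asks for continuity. *)
Definition clamp (l r x : R) : R := Rmax l (Rmin x r).

Lemma clamp_in (l r x : R) : l <= r -> l <= clamp l r x <= r.
Proof. intros H; unfold clamp, Rmax, Rmin; destruct (Rle_dec x r); destruct Rle_dec; lra. Qed.

Lemma clamp_id (l r x : R) : l <= x <= r -> clamp l r x = x.
Proof. intros H; unfold clamp, Rmax, Rmin; destruct (Rle_dec x r); destruct Rle_dec; lra. Qed.

Lemma clamp_lip (l r x y : R) : Rabs (clamp l r x - clamp l r y) <= Rabs (x - y).
Proof.
  unfold clamp, Rmax, Rmin, Rabs.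
  destruct (Rle_dec x r), (Rle_dec y r); repeat destruct Rle_dec; repeat destruct Rcase_abs; lra.
Qed.

Lemma lip_continuous (f : R -> R) (K : R) : (forall x y, Rabs (f x - f y) <= K * Rabs (x - y)) ->
  forall x, continuous f x.
Proof.
  intros H x. apply continuity_pt_filterlim. intros e He.
  assert (HK : 0 < Rabs K + 1) by (assert (A := Rabs_pos K); lra).
  exists (e / (Rabs K + 1)). split; [apply Rdiv_lt_0_compat; lra|].
  intros y [_ Hy]. simpl in *. unfold R_dist in *.
  eapply Rle_lt_trans; [apply H|]. apply Rle_lt_trans with ((Rabs K + 1) * Rabs (y - x)).
  - apply Rmult_le_compat_r; [apply Rabs_pos|]. assert (A := Rle_abs K). lra.
  - apply Rmult_lt_reg_r with (/ (Rabs K + 1)); [apply Rinv_0_lt_compat; auto|].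
    rewrite Rmult_comm, <- Rmult_assoc, Rinv_l, Rmult_1_l by lra. auto.
Qed.

Section Glue.
Variables (a al b : R).
Hypothesis Hab : a < al < b.

Definition glue (A B : R -> R) (x : R) : R :=
  if Rle_dec x al then A (clamp a al x) else B (clamp al b x).

Definition lip_on (l r K : R) (f : R -> R) : Prop :=
  forall x y, l <= x <= r -> l <= y <= r -> Rabs (f x - f y) <= K * Rabs (x - y).

Lemma clamp_lip_on (l r K : R) (f : R -> R) : l < r -> 0 <= K -> lip_on l r K f ->
  forall x y, Rabs (f (clamp l r x) - f (clamp l r y)) <= K * Rabs (x - y).
Proof.
  intros Hlr HK H x y. eapply Rle_trans; [apply H; apply clamp_in; lra|].
  apply Rmult_le_compat_l; auto. apply clamp_lip.
Qed.

Lemma glue_pc (K : R) (A B : R -> R) : 0 <= K -> lip_on a al K A -> lip_on al b K B ->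
  pc al (glue A B).
Proof.
  intros HK HA HB. apply (pc_if al (fun x => A (clamp a al x)) (fun x => B (clamp al b x))).
  - apply (lip_continuous _ K). apply (clamp_lip_on a al K); auto; lra.
  - apply (lip_continuous _ K). apply (clamp_lip_on al b K); auto; lra.
Qed.

Lemma glue_lip (K : R) (A B : R -> R) : 0 <= K -> lip_on a al K A -> lip_on al b K B ->
  A al = B al -> forall x y, Rabs (glue A B x - glue A B y) <= K * Rabs (x - y).
Proof.
  intros HK HA HB Hj.
  assert (LA := clamp_lip_on a al K A ltac:(lra) HK HA).
  assert (LB := clamp_lip_on al b K B ltac:(lra) HK HB).
  assert (M : forall x y, x <= al -> al < y -> Rabs (A (clamp a al x) - B (clamp al b y)) <= K * Rabs (x - y)).
  { intros x y Hx Hy. assert (A1 := LA x al). assert (A2 := LB al y).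
    rewrite (clamp_id a al al) in A1 by lra. rewrite (clamp_id al b al) in A2 by lra.
    replace (A (clamp a al x) - B (clamp al b y)) with
      ((A (clamp a al x) - A al) + (B al - B (clamp al b y))) by (rewrite Hj; ring).
    eapply Rle_trans; [apply Rabs_triang|].
    rewrite (Rabs_left1 (x - al)) in A1 by lra. rewrite (Rabs_left1 (al - y)) in A2 by lra.
    rewrite (Rabs_left1 (x - y)) by lra. lra. }
  intros x y. unfold glue. destruct (Rle_dec x al) as [Hx|Hx], (Rle_dec y al) as [Hy|Hy]; auto.
  - apply M; lra.
  - rewrite Rabs_minus_sym, (Rabs_minus_sym x). apply M; lra.
Qed.

Lemma glue_derive (A B A' B' : R -> R) :
  (forall x, a < x < al -> derivable_pt_lim A x (A' x)) ->
  (forall x, al < x < b -> derivable_pt_lim B x (B' x)) ->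
  forall x, a < x < b -> x <> al -> is_derive (glue A B) x (glue A' B' x).
Proof.
  intros HA HB x Hx Hne. unfold glue at 2.
  assert (Hd : 0 < Rmin (Rabs (x - al)) (Rmin (x - a) (b - x))).
  { repeat apply Rmin_pos; try lra. apply Rabs_pos_lt; lra. }
  assert (Hloc : forall y, Rabs (y - x) < Rmin (Rabs (x - al)) (Rmin (x - a) (b - x)) ->
    Rabs (y - x) < Rabs (x - al) /\ a < y < b).
  { intros y Hy. assert (M1 := Rmin_l (Rabs (x - al)) (Rmin (x - a) (b - x))).
    assert (M2 := Rmin_r (Rabs (x - al)) (Rmin (x - a) (b - x))).
    assert (M3 := Rmin_l (x - a) (b - x)). assert (M4 := Rmin_r (x - a) (b - x)).
    split; [lra|]. assert (A1 : Rabs (y - x) < Rmin (x - a) (b - x)) by lra.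
    apply Rabs_def2 in A1. lra. }
  destruct (Rle_dec x al) as [Hl|Hl].
  - rewrite clamp_id by lra. apply (is_derive_ext_loc A).
    + exists (mkposreal _ Hd). intros y Hy. destruct (Hloc y Hy) as [L1 L2].
      rewrite (Rabs_left1 (x - al)) in L1 by lra. apply Rabs_def2 in L1.
      unfold glue. destruct (Rle_dec y al); [|lra]. rewrite clamp_id; auto; lra.
    + apply is_derive_Reals, HA; lra.
  - rewrite clamp_id by lra. apply (is_derive_ext_loc B).
    + exists (mkposreal _ Hd). intros y Hy. destruct (Hloc y Hy) as [L1 L2].
      rewrite (Rabs_right (x - al)) in L1 by lra. apply Rabs_def2 in L1.
      unfold glue. destruct (Rle_dec y al); [lra|]. rewrite clamp_id; auto; lra.
    + apply is_derive_Reals, HB; lra.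
Qed.
End Glue.

(** Approximants are obtained by integrating those of the next derivative, starting from a constant
    and the Lipschitz bound. The chain is linked by integrals because differentiability is only
    known off the interface. *)
Lemma taylor_of_chain (al a b K : R) (n0 : nat) (F : nat -> R -> R) : 0 <= K ->
  (forall j, (j < n0)%nat -> pc al (F j) /\ forall x y, Rabs (F j x - F j y) <= K * Rabs (x - y)) ->
  (forall j x y, (S j < n0)%nat -> a <= x -> x <= y -> y <= b ->
     RI (F (S j)) x y = F j y - F j x) ->
  forall n j l r, (1 <= n)%nat -> (n + j <= n0)%nat -> a <= l -> l <= r -> r <= b ->
    exists T, pol n T /\ forall x, l <= x <= r -> Rabs (F j x - T x) <= K * (r - l) ^ n.
Proof.
  intros HK HF Hd. induction n as [|n IH]; intros j l r Hn Hj Hal Hlr Hrb; [lia|].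
  destruct n as [|n].
  - exists (fun _ => F j l). split; [apply pol_const; lia|]. intros x Hx.
    eapply Rle_trans; [apply HF; lia|]. rewrite pow_1, Rabs_right by lra.
    apply Rmult_le_compat_l; lra.
  - destruct (IH (S j) l r) as [T [HT HTb]]; try lia; auto.
    destruct (pol_primitive (S n) T l HT) as [V [HV HVE]].
    exists (fun x => F j l + V x). split; [apply pol_plus; auto; apply pol_const; lia|].
    intros x Hx. assert (E := Hd j l x ltac:(lia) ltac:(lra) ltac:(lra) ltac:(lra)).
    assert (PT : pc al T) by (apply (pc_pol al (S n)); auto).
    destruct (HF (S j) ltac:(lia)) as [PF _].
    replace (F j x - (F j l + V x)) with (RI (fun y => F (S j) y - T y) l x).
    + eapply Rle_trans; [apply (pcI_abs al _ l x (K * (r - l) ^ S n)); [lra|auto using pc_minus|]|].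
      * intros y Hy; apply HTb; lra.
      * replace (K * (r - l) ^ S (S n)) with (K * (r - l) ^ S n * (r - l)) by (simpl; ring).
        apply Rmult_le_compat_l; [|lra]. apply Rmult_le_pos; auto. apply pow_le; lra.
    + rewrite (pcI_minus al), E, HVE by (auto || lra). ring.
Qed.

(** Replaces the two families of one-sided derivatives by one flux on the whole interval. The
    differential equation is passed on in integrated form: this is what control volumes use, and [f]
    is unspecified at the interface. *)
Lemma exact_solution (a b al bm bp gam cr : R) (p : nat) (u f : R -> R) (Dm Dp : nat -> R -> R) (M : R) :
  a < al < b -> 0 < bm -> 0 < bp -> (2 <= p)%nat ->
  W_inf_piece a al (2 * p + 1) u Dm M -> W_inf_piece al b (2 * p + 1) u Dp M ->
  (forall j, (1 <= j <= 2 * p)%nat -> bp * Dp j al = bm * Dm j al) ->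
  (forall x, a < x < al -> f x = - bm * Dm 2%nat x + gam * Dm 1%nat x + cr * Dm 0%nat x) ->
  (forall x, al < x < b -> f x = - bp * Dp 2%nat x + gam * Dp 1%nat x + cr * Dp 0%nat x) ->
  0 <= M /\
  exists F U : R -> R, pc al F /\ pc al U /\
    (forall x, a <= x <= b -> U x = u x) /\
    (forall x, a <= x <= b -> F x = if Rle_dec x al then bm * Dm 1%nat x else bp * Dp 1%nat x) /\
    (forall l r, a <= l -> l <= r -> r <= b -> taylor_approx p l r ((bm + bp) * M) F) /\
    (forall x y, a <= x -> x <= y -> y <= b -> RI (fun z => wgt bm bp al z * F z) x y = u y - u x) /\
    (forall x y, a <= x -> x <= y -> y <= b ->
       Defs.RInt f x y = F x - F y + gam * (u y - u x) + cr * RI U x y).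
Proof.
  intros Hab Hbm Hbp Hp [Wm0 [Wm1 [Wm2 Wm3]]] [Wp0 [Wp1 [Wp2 Wp3]]] Hj Hf1 Hf2.
  assert (HM : 0 <= M).
  { eapply Rle_trans; [apply Rabs_pos|apply (Wm2 O al); [lia|lra]]. }
  split; auto.
  set (K := (bm + bp) * M). assert (HK : 0 <= K) by (apply Rmult_le_pos; lra).
  set (A := fun j x => bm * Dm (S j) x). set (B := fun j x => bp * Dp (S j) x).
  assert (LA : forall j, (j < 2 * p)%nat -> lip_on a al K (A j)).
  { intros j H x y Hx Hy. unfold A. rewrite <- Rmult_minus_distr_l, Rabs_mult, (Rabs_right bm) by lra.
    assert (E := Wm3 (S j) x y ltac:(lia) Hx Hy). unfold K. rewrite Rmult_assoc.
    apply Rmult_le_compat; [lra|apply Rabs_pos|lra|auto]. }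
  assert (LB : forall j, (j < 2 * p)%nat -> lip_on al b K (B j)).
  { intros j H x y Hx Hy. unfold B. rewrite <- Rmult_minus_distr_l, Rabs_mult, (Rabs_right bp) by lra.
    assert (E := Wp3 (S j) x y ltac:(lia) Hx Hy). unfold K. rewrite Rmult_assoc.
    apply Rmult_le_compat; [lra|apply Rabs_pos|lra|auto]. }
  (* The derivative of order [j] of the flux. The jump condition on beta u^(j+1) makes its two
     branches meet at [al], so the Lipschitz bound extends across the interface. *)
  set (Fj := fun j => glue a al b (A j) (B j)).
  assert (PF : forall j, (j < 2 * p)%nat -> pc al (Fj j)).
  { intros j H. apply (glue_pc a al b Hab K); auto. }
  assert (LF : forall j, (j < 2 * p)%nat -> forall x y, Rabs (Fj j x - Fj j y) <= K * Rabs (x - y)).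
  { intros j H. apply glue_lip; auto. unfold A, B; symmetry; apply Hj; lia. }
  assert (DF : forall j x, (S j < 2 * p)%nat -> a < x < b -> x <> al -> is_derive (Fj j) x (Fj (S j) x)).
  { intros j x H Hx Hne. apply glue_derive; auto; intros y Hy; unfold A, B.
    - apply derivable_pt_lim_scal, Wm1; auto; lia.
    - apply derivable_pt_lim_scal, Wp1; auto; lia. }
  assert (IF : forall j x y, (S j < 2 * p)%nat -> a <= x -> x <= y -> y <= b ->
     RI (Fj (S j)) x y = Fj j y - Fj j x).
  { intros j x y H H1 H2 H3. apply (ftc_pc al); auto.
    - intros z _. apply (lip_continuous _ K), LF; lia.
    - intros z Hz Hne. apply DF; auto; lra. }
  set (U := glue a al b (Dm O) (Dp O)).
  assert (LU1 : lip_on a al M (Dm O)) by (intros x y Hx Hy; apply Wm3; auto; lia).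
  assert (LU2 : lip_on al b M (Dp O)) by (intros x y Hx Hy; apply Wp3; auto; lia).
  assert (PU : pc al U) by (apply (glue_pc a al b Hab M); auto).
  assert (EU : forall x, a <= x <= b -> U x = u x).
  { intros x Hx. unfold U, glue. destruct (Rle_dec x al).
    - rewrite clamp_id by lra. apply Wm0; lra.
    - rewrite clamp_id by lra. apply Wp0; lra. }
  assert (EwF : forall x, glue a al b (Dm 1%nat) (Dp 1%nat) x = wgt bm bp al x * Fj O x).
  { intros x. unfold Fj, glue, wgt, betaf, A, B. destruct (Rle_dec x al); field; lra. }
  assert (PwF : pc al (fun x => wgt bm bp al x * Fj O x)) by (apply pc_mult; [apply pc_wgt|apply PF; lia]).
  assert (IU : forall x y, a <= x -> x <= y -> y <= b ->
     RI (fun z => wgt bm bp al z * Fj O z) x y = u y - u x).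
  { intros x y H1 H2 H3. rewrite <- !EU by lra. apply (ftc_pc al); auto.
    - intros z _. apply (lip_continuous _ M), glue_lip; auto.
      rewrite Wm0, Wp0 by lra; auto.
    - intros z Hz Hne. rewrite <- EwF. apply glue_derive; auto; try lra.
      + intros; apply Wm1; auto; lia.
      + intros; apply Wp1; auto; lia. }
  exists (Fj O), U. split; [apply PF; lia|]. split; auto. split; auto. split; [|split; [|split]]; auto.
  - intros x Hx. unfold Fj, glue, A, B. destruct (Rle_dec x al); rewrite clamp_id by lra; auto.
  - intros l r H1 H2 H3 n Hn.
    apply (taylor_of_chain al a b K (2 * p) Fj); auto; lia.
  - intros x y H1 H2 H3.
    destruct (RInt_ext_off al f (fun z => (-1 * Fj 1%nat z + gam * (wgt bm bp al z * Fj O z)) + cr * U z) x y)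
      as [X1 X2]; auto.
    + apply pc_plus; [apply pc_plus|]; apply pc_scal; auto; apply PF; lia.
    + intros z Hz Hne. unfold Fj, U, A, B, glue, wgt, betaf.
      destruct (Rle_dec z al); rewrite clamp_id by lra.
      * rewrite Hf1 by lra. field; lra.
      * rewrite Hf2 by lra. field; lra.
    + rewrite RInt_DefsE, X2 by auto.
      assert (P1 := PF 1%nat ltac:(lia)).
      rewrite (pcI_plus al (fun z => -1 * Fj 1%nat z + gam * (wgt bm bp al z * Fj O z)) (fun z => cr * U z)),
        (pcI_plus al (fun z => -1 * Fj 1%nat z) (fun z => gam * (wgt bm bp al z * Fj O z))),
        (pcI_scal al (-1)), (pcI_scal al gam (fun z => wgt bm bp al z * Fj O z)), (pcI_scal al cr U),
        IU, (IF O) by (auto using pc_plus, pc_scal || lia). ring.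
Qed.

(** * The error equations *)

Lemma glob_eval (X : nat -> R) (N : nat) (G : nat -> R -> R) (i : nat) (x : R) :
  (forall j, (j < N)%nat -> X j < X (S j)) -> (1 <= i <= N)%nat ->
  X (i - 1)%nat < x <= X i -> glob X N G x = G i x.
Proof.
  intros HX Hi Hx. unfold glob. rewrite (sumR_single N (i - 1)); [|lia|].
  - replace (S (i - 1)) with i by lia.
    destruct (Rlt_dec (X (i - 1)%nat) x); [|lra]. destruct (Rle_dec x (X i)); [auto|lra].
  - intros j Hj Hne. destruct (Rlt_dec (X j) x) as [H1|]; auto.
    destruct (Rle_dec x (X (S j))) as [H2|]; auto. exfalso.
    destruct (le_lt_dec (S j) (i - 1)).
    + assert (A := mesh_le X N (S j) (i - 1) HX ltac:(lia)). lra.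
    + assert (A := mesh_le X N i j HX ltac:(lia)). lra.
Qed.

(** The error [u - u_T] on element [i], where [q i] is the flux of [u_T] and [E] the nodal error. *)
Definition elem_err (w F : R -> R) (X : nat -> R) (q : nat -> R -> R) (E : nat -> R) (i : nat) (x : R) : R :=
  E (i - 1)%nat + RI (fun y => w y * (F y - q i y)) (X (i - 1)%nat) x.

Section ErrorEquations.
Variables (a b al bm bp gam cr : R) (N k p : nat) (X : nat -> R) (L : nat -> R -> R)
  (g : nat -> nat -> R) (u fu f F U : R -> R) (cf : nat -> nat -> R).
Hypothesis Hbm : 0 < bm.
Hypothesis Hbp : 0 < bp.
Hypothesis Hp : (2 <= p)%nat.
Hypothesis HN : (1 <= N)%nat.
Hypothesis HX0 : X 0%nat = a.
Hypothesis HXN : X N = b.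
Hypothesis HX : forall i, (i < N)%nat -> X i < X (S i).
Hypothesis Hk : (1 <= k <= N)%nat.
Hypothesis Hal : X (k - 1)%nat < al < X k.
Hypothesis HL : is_gen_legendre bm bp al X k L.
Hypothesis Hg : is_gauss X N k p L g.
Hypothesis PF : pc al F.
Hypothesis PU : pc al U.
Hypothesis EU : forall x, a <= x <= b -> U x = u x.
Hypothesis EF : forall x, a <= x <= b -> fu x = F x.
Hypothesis IF : forall x y, a <= x -> x <= y -> y <= b ->
  RI (fun z => wgt bm bp al z * F z) x y = u y - u x.
Hypothesis If : forall x y, a <= x -> x <= y -> y <= b ->
  Defs.RInt f x y = F x - F y + gam * (u y - u x) + cr * RI U x y.
Hypothesis Hua : u a = 0.
Hypothesis Hub : u b = 0.
Hypothesis HUT : in_UT bm bp al X N k p L cf.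
Hypothesis HIFV : is_IFV bm bp al X N k p L gam cr f g cf.

Notation w := (wgt bm bp al).
Notation loc := (loc bm bp al X k p L cf).
Notation dloc := (dloc bm bp al X k p L cf).
Notation fluxT := (fluxT bm bp al X k p L cf).

Lemma element_in (i : nat) (x : R) : (1 <= i <= N)%nat -> X (i - 1)%nat <= x <= X i -> a <= x <= b.
Proof.
  intros Hi Hx. assert (A := mesh_le X N 0 (i - 1) HX ltac:(lia)).
  assert (B := mesh_le X N i N HX ltac:(lia)). lra.
Qed.

Section WithFlux.
Variables (q : nat -> R -> R) (E : nat -> R).
Hypothesis Hq : forall i, (1 <= i <= N)%nat -> pol p (q i) /\
  (forall x, X (i - 1)%nat <= x <= X i -> fluxT i x = q i x /\
     loc i x = loc i (X (i - 1)%nat) + RI (fun y => w y * q i y) (X (i - 1)%nat) x).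
Hypothesis HE0 : forall i, (1 <= i <= N)%nat -> E (i - 1)%nat = u (X (i - 1)%nat) - loc i (X (i - 1)%nat).

Notation err := (elem_err w F X q E).

Lemma q_pc (i : nat) : (1 <= i <= N)%nat -> pc al (q i).
Proof. intros Hi. apply (pc_pol al p), Hq; auto. Qed.

Lemma err_pc (i : nat) : (1 <= i <= N)%nat -> pc al (err i).
Proof.
  intros Hi. apply pc_plus; [apply pc_const|]. apply (prim_pc al (fun y => w y * (F y - q i y))).
  apply pc_mult; [apply pc_wgt|]. apply pc_minus; auto. apply q_pc; auto.
Qed.

Lemma err_eq (i : nat) (x : R) : (1 <= i <= N)%nat -> X (i - 1)%nat <= x <= X i ->
  u x - loc i x = err i x.
Proof.
  intros Hi Hx. unfold elem_err. rewrite HE0 by auto. destruct (Hq i Hi) as [_ H].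
  destruct (H x Hx) as [_ ->].
  assert (Ha := element_in i x Hi Hx).
  assert (Hl := element_in i (X (i - 1)%nat) Hi ltac:(lra)).
  rewrite (RI_ext (fun y => w y * (F y - q i y)) (fun y => w y * F y - w y * q i y)) by (intros; ring).
  assert (Pq := q_pc i Hi). assert (Pw := pc_wgt bm bp al).
  rewrite (pcI_minus al), IF by (auto using pc_mult || lra). ring.
Qed.

(** Exact minus discrete volume term, written in the local error. Integrability is recorded as well,
    because the pieces on both sides of a node are joined later. *)
Lemma volume_integral (i : nat) (x y : R) : (1 <= i <= N)%nat ->
  X (i - 1)%nat <= x -> x <= y -> y <= X i ->
  let T := fun z => gam * glob X N dloc z + cr * glob X N loc z in
  ex_RInt T x y /\
  gam * (u y - u x) + cr * RI U x y - RI T x y =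
    gam * (err i y - err i x) + cr * RI (err i) x y.
Proof.
  intros Hi H1 H2 H3 T.
  assert (Pq := q_pc i Hi). assert (Pw := pc_wgt bm bp al). assert (Pe := err_pc i Hi).
  assert (Hin := fun z Hz => element_in i z Hi Hz).
  destruct (RInt_ext_off al T (fun z => gam * (w z * q i z) + cr * (U z - err i z)) x y) as [T1 T2];
    auto using pc_plus, pc_scal, pc_mult, pc_minus.
  { intros z Hz _. unfold T. rewrite !(glob_eval X N _ i) by (auto || lra).
    rewrite <- err_eq, EU by (auto || lra || (apply Hin; lra)).
    destruct (Hq i Hi) as [_ Hq']. destruct (Hq' z ltac:(lra)) as [E1 _]. rewrite <- E1.
    unfold Defs.fluxT, wgt. assert (B := betaf_pos bm bp al z Hbm Hbp). field; lra. }
  split; auto. rewrite T2.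
  rewrite (pcI_plus al (fun z => gam * (w z * q i z)) (fun z => cr * (U z - err i z))),
    (pcI_scal al gam (fun z => w z * q i z)), (pcI_scal al cr (fun z => U z - err i z)),
    (pcI_minus al U (err i)) by auto using pc_scal, pc_mult, pc_minus.
  assert (D : err i y - err i x = (u y - u x) - RI (fun z => w z * q i z) x y).
  { rewrite <- !err_eq by (auto || lra). destruct (Hq i Hi) as [_ Hq'].
    destruct (Hq' x ltac:(lra)) as [_ ->]. destruct (Hq' y ltac:(lra)) as [_ ->].
    rewrite <- (pcI_Chasles al (fun z => w z * q i z) (X (i - 1)%nat) x y) by auto using pc_mult. ring. }
  rewrite D. ring.
Qed.

Definition err_int (i : nat) : R := sumR i (fun j => RI (err (S j)) (X j) (X (S j))).

Hypothesis HEr : forall i, (1 <= i <= N)%nat -> E i = u (X i) - loc i (X i).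

(** A discrete first integral: each IFV equation, subtracted from the integrated exact one, says
    that its values at two consecutive Gauss points agree. *)
Definition flux_residual (i j : nat) : R :=
  F (g i j) - q i (g i j) - gam * err i (g i j)
  - cr * (err_int (i - 1) + RI (err i) (X (i - 1)%nat) (g i j)).

Lemma gauss_in (i j : nat) : (1 <= i <= N)%nat -> (1 <= j <= p)%nat ->
  X (i - 1)%nat <= g i j <= X i.
Proof. intros Hi Hj. destruct (Hg i Hi) as [_ [H _]]. apply H; auto. Qed.

Lemma err_right (i : nat) : (1 <= i <= N)%nat -> err i (X i) = E i.
Proof.
  intros Hi. assert (A := mesh_lt X N i HX Hi). rewrite <- err_eq, HEr; auto; lra.
Qed.

Lemma err_left (i : nat) : err i (X (i - 1)%nat) = E (i - 1)%nat.
Proof. unfold elem_err. rewrite pcI_point. ring. Qed.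

Lemma flux_residual_next (i j : nat) : (1 <= i <= N)%nat -> (1 <= j < p)%nat ->
  flux_residual i (S j) = flux_residual i j.
Proof.
  intros Hi Hj. assert (G1 := gauss_in i j Hi ltac:(lia)). assert (G2 := gauss_in i (S j) Hi ltac:(lia)).
  destruct (Hg i Hi) as [Hlt _]. specialize (Hlt j Hj).
  assert (H := HIFV i j Hi ltac:(lia) ltac:(destruct (Nat.ltb i N); lia)).
  unfold gnext, enext in H. destruct (Nat.ltb_spec j p); [|lia].
  destruct (Hq i Hi) as [_ Hq'].
  rewrite (proj1 (Hq' _ G1)), (proj1 (Hq' _ G2)) in H.
  destruct (volume_integral i (g i j) (g i (S j)) Hi) as [V1 V2]; try lra.
  assert (A1 := element_in i _ Hi G1). assert (A2 := element_in i _ Hi G2).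
  rewrite RInt_DefsE, If in H by (auto || lra).
  unfold flux_residual.
  rewrite <- (pcI_Chasles al (err i) (X (i - 1)%nat) (g i j) (g i (S j))) by (apply err_pc; auto).
  lra.
Qed.

(** The control volume contains the node [X i]. The integrals are split there, and the two local
    errors match because both take the value [E i] at the node. *)
Lemma flux_residual_cross (i : nat) : (1 <= i < N)%nat ->
  flux_residual (S i) 1 = flux_residual i p.
Proof.
  intros Hi. assert (G1 := gauss_in i p ltac:(lia) ltac:(lia)).
  assert (G2 := gauss_in (S i) 1 ltac:(lia) ltac:(lia)).
  assert (Ei : (S i - 1)%nat = i) by lia.
  assert (H := HIFV i p ltac:(lia) ltac:(lia) ltac:(destruct (Nat.ltb_spec i N); lia)).
  unfold gnext, enext in H. destruct (Nat.ltb_spec p p); [lia|].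
  destruct (Hq i ltac:(lia)) as [_ Hq1]. destruct (Hq (S i) ltac:(lia)) as [_ Hq2].
  rewrite (proj1 (Hq1 _ G1)), (proj1 (Hq2 _ G2)) in H.
  assert (A1 := element_in i _ ltac:(lia) G1). assert (A2 := element_in (S i) _ ltac:(lia) G2).
  rewrite Ei in G2.
  destruct (volume_integral i (g i p) (X i)) as [V1 V2]; try lra; try lia.
  destruct (volume_integral (S i) (X i) (g (S i) 1%nat)) as [V3 V4]; try lra; try lia.
  { rewrite Ei; lra. }
  set (T := fun x => gam * glob X N dloc x + cr * glob X N loc x) in *.
  assert (V5 : ex_RInt T (g i p) (g (S i) 1%nat)) by (apply @ex_RInt_Chasles with (X i); auto).
  assert (V6 : RI T (g i p) (X i) + RI T (X i) (g (S i) 1%nat) = RI T (g i p) (g (S i) 1%nat)).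
  { unfold RI; apply @RInt_Chasles; auto. }
  change (Defs.RInt (fun x => gam * glob X N dloc x + cr * glob X N loc x) (g i p) (g (S i) 1%nat))
    with (Defs.RInt T (g i p) (g (S i) 1%nat)) in H.
  rewrite RInt_DefsE, If in H by (auto || lra).
  assert (R1 := err_right i ltac:(lia)). assert (R2 := err_left (S i)). rewrite Ei in R2.
  unfold flux_residual. rewrite Ei.
  assert (S1 : err_int i = err_int (i - 1) + RI (err i) (X (i - 1)%nat) (X i)).
  { unfold err_int. replace i with (S (i - 1)) at 1 by lia. simpl.
    replace (S (i - 1)) with i by lia. auto. }
  assert (P1 := err_pc i ltac:(lia)).
  rewrite S1, <- (pcI_Chasles al (err i) (X (i - 1)%nat) (g i p) (X i)) by auto.
  assert (V7 := pcI_Chasles al U (g i p) (X i) (g (S i) 1%nat) PU).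
  rewrite <- V7 in H. rewrite R1 in V2. rewrite R2 in V4. lra.
Qed.

Lemma flux_residual_const (i j : nat) : (1 <= i <= N)%nat -> (1 <= j <= p)%nat ->
  flux_residual i j = flux_residual 1 1.
Proof.
  assert (A : forall n m, (1 <= n <= N)%nat -> (1 <= m <= p)%nat ->
    flux_residual n m = flux_residual n 1).
  { intros n; induction m as [|m IH]; intros Hn Hm; [lia|].
    destruct m as [|m]; auto. rewrite flux_residual_next; [apply IH; lia|auto|lia]. }
  intros Hi Hj. rewrite A by auto. clear j Hj.
  induction i as [|i IH]; [lia|]. destruct i as [|i]; auto.
  rewrite flux_residual_cross, A by lia. apply IH; lia.
Qed.
End WithFlux.

Lemma error_equations :
  exists (q Q : nat -> R -> R) (E Se : nat -> R) (K : R),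
    E O = 0 /\ E N = 0 /\ Se O = 0 /\
    forall i, (1 <= i <= N)%nat ->
      pol p (q i) /\ pol p (Q i) /\
      (forall x, X (i - 1)%nat <= x <= X i ->
         fluxT i x = q i x /\ u x - loc i x = elem_err w F X q E i x /\
         loc i x - Ih bm bp al X k p L u fu i x =
           - (E (i - 1)%nat + RI (fun y => w y * (Q i y - q i y)) (X (i - 1)%nat) x)) /\
      (forall s, pol p s -> RI (fun x => w x * ((F x - Q i x) * s x)) (X (i - 1)%nat) (X i) = 0) /\
      E i = elem_err w F X q E i (X i) /\ E i = u (X i) - loc i (X i) /\
      E (i - 1)%nat = u (X (i - 1)%nat) - loc i (X (i - 1)%nat) /\
      Se i = Se (i - 1)%nat + RI (elem_err w F X q E i) (X (i - 1)%nat) (X i) /\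
      (forall j, (1 <= j <= p)%nat ->
         F (g i j) - q i (g i j) = gam * elem_err w F X q E i (g i j) +
           cr * (Se (i - 1)%nat + RI (elem_err w F X q E i) (X (i - 1)%nat) (g i j)) + K).
Proof.
  assert (P : forall i, exists qi, (1 <= i <= N)%nat -> pol p qi /\
    (forall x, X (i - 1)%nat <= x <= X i -> fluxT i x = qi x /\
     loc i x = loc i (X (i - 1)%nat) + RI (fun y => w y * qi y) (X (i - 1)%nat) x)).
  { intros i. destruct (le_lt_dec 1 i); [|exists (fun _ => 0); lia].
    destruct (le_lt_dec i N); [|exists (fun _ => 0); lia].
    destruct (local_representation bm bp al X N k L Hbm Hbp HX Hk Hal HL p i (cf i)) as [qi [H1 [H2 _]]];
      try lia.
    exists qi; intros Hi; split; auto. intros x Hx. destruct (H2 x Hx) as [H3 H4].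
    assert (A := mesh_lt X N i HX Hi).
    split; [exact H3|]. unfold Defs.loc at 1. rewrite H4.
    destruct (H2 (X (i - 1)%nat) ltac:(lra)) as [_ H5]. unfold Defs.loc. rewrite H5, pcI_point. ring. }
  apply choice_nat in P; destruct P as [q Hq].
  assert (P : forall i, exists Qi, (1 <= i <= N)%nat -> pol p Qi /\
    (forall x, X (i - 1)%nat <= x <= X i -> Ih bm bp al X k p L u fu i x =
        u (X (i - 1)%nat) + RI (fun y => w y * Qi y) (X (i - 1)%nat) x) /\
    (forall s, pol p s -> RI (fun x => w x * ((F x - Qi x) * s x)) (X (i - 1)%nat) (X i) = 0)).
  { intros i. destruct (le_lt_dec 1 i) as [l1|]; [|exists (fun _ => 0); lia].
    destruct (le_lt_dec i N) as [l2|]; [|exists (fun _ => 0); lia].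
    assert (A := mesh_lt X N i HX (conj l1 l2)).
    assert (A1 := element_in i (X i) (conj l1 l2) ltac:(lra)).
    assert (A2 := element_in i (X (i - 1)%nat) (conj l1 l2) ltac:(lra)).
    destruct (projection_representation bm bp al X N k L Hbm Hbp HX Hk Hal HL p i u fu F) as [Qi HQi];
      auto; try lia.
    - intros x Hx. apply EF, (element_in i); auto.
    - apply IF; lra.
    - exists Qi; auto. }
  apply choice_nat in P; destruct P as [Q HQ].
  destruct HUT as [HU1 [HU2 HU3]].
  (* There is no element 0, so the error at [a] is set by hand; the boundary conditions make it
     agree with the left end of element 1. *)
  set (E := fun i => match i with O => 0 | S _ => u (X i) - loc i (X i) end).
  assert (HEr : forall i, (1 <= i <= N)%nat -> E i = u (X i) - loc i (X i)).
  { intros [|i] Hi; [lia|reflexivity]. }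
  assert (HEl : forall i, (1 <= i <= N)%nat -> E (i - 1)%nat = u (X (i - 1)%nat) - loc i (X (i - 1)%nat)).
  { intros i Hi. destruct (Nat.eq_dec i 1) as [->|Hne].
    - simpl. rewrite HU2, HX0, Hua. ring.
    - rewrite HEr by lia. rewrite HU1 by lia. replace (S (i - 1)) with i by lia. auto. }
  exists q, Q, E, (err_int q E), (flux_residual q E 1 1).
  split; auto. split; [rewrite HEr, HU3, HXN, Hub by lia; ring|]. split; auto.
  intros i Hi. assert (A := mesh_lt X N i HX Hi).
  destruct (Hq i Hi) as [Q1 Q2]. destruct (HQ i Hi) as [Q3 [Q4 Q5]].
  split; auto. split; auto. split; [|split; [auto|split; [|split; [auto|split; [auto|split]]]]].
  - intros x Hx. destruct (Q2 x Hx) as [Q6 Q7].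
    split; auto. split; [apply err_eq; auto|].
    rewrite Q7, Q4, HEl by auto.
    assert (Pw := pc_wgt bm bp al).
    assert (Pq : pc al (q i)) by (apply (pc_pol al p); auto).
    assert (PQ : pc al (Q i)) by (apply (pc_pol al p); auto).
    rewrite (RI_ext (fun y => w y * (Q i y - q i y)) (fun y => w y * Q i y - w y * q i y)) by (intros; ring).
    rewrite (pcI_minus al) by auto using pc_mult. ring.
  - rewrite err_right; auto.
  - unfold err_int. replace i with (S (i - 1)) at 1 by lia. simpl.
    replace (S (i - 1)) with i by lia. auto.
  - intros j Hj. assert (R := flux_residual_const q E Hq HEl HEr i j Hi Hj).
    unfold flux_residual at 1 in R. lra.
Qed.
End ErrorEquations.

(** * Error estimates *)

Lemma hmax_ge (X : nat -> R) (N i : nat) : (i < N)%nat -> X (S i) - X i <= hmax X N.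
Proof.
  induction N as [|N IH]; intros Hi; [lia|]; simpl.
  destruct (Nat.eq_dec i N) as [->|Hne]; [apply Rmax_r|].
  eapply Rle_trans; [apply IH; lia|apply Rmax_l].
Qed.

(** For the second part: phi_(i,p+1) has a flux proportional to P_(i,p), hence is a nonzero multiple
    of the weighted primitive of the Gauss polynomial, and the Lobatto points are the zeros of that
    primitive. *)
Lemma gauss_points_element (bm bp al : R) (X : nat -> R) (N k p : nat) (L : nat -> R -> R)
  (g : nat -> nat -> R) (i : nat) :
  0 < bm -> 0 < bp -> (forall i, (i < N)%nat -> X i < X (S i)) ->
  (1 <= k <= N)%nat -> X (k - 1)%nat < al < X k -> is_gen_legendre bm bp al X k L ->
  is_gauss X N k p L g -> (1 <= p)%nat -> (1 <= i <= N)%nat ->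
  gauss_element p (/ (bm + bp)) (/ bm + / bp) al (X (i - 1)%nat) (X i) (wgt bm bp al)
    (fun j => g i (S j)) /\
  forall x, X (i - 1)%nat <= x <= X i -> lphi bm bp al X k L i (S p) x = 0 ->
    RI (fun y => wgt bm bp al y * prodlin p (fun j => g i (S j)) y) (X (i - 1)%nat) x = 0.
Proof.
  intros Hbm Hbp HX Hk Hal HL Hg Hp Hi. destruct (Hg i Hi) as [G1 [G2 _]].
  destruct (Pin_facts bm bp al X N k L Hbm Hbp HX Hk Hal HL i Hi) as [_ [_ [_ [_ H]]]].
  destruct (H p (fun j => g i (S j))) as [H1 [c' [Hc' H2]]].
  - intros j Hj; apply G2; lia.
  - intros m n [Hmn Hn]. apply Rlt_not_eq.
    induction Hmn as [|n Hmn IH]; [apply G1; lia|].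
    apply Rlt_trans with (g i (S n)); [apply IH; lia|apply G1; lia].
  - intros j Hj; apply G2; lia.
  - split; auto. intros x Hx H0.
    destruct (local_basis bm bp al X N k L Hbm Hbp HX Hk Hal HL i Hi)
      as [m [c [c0 [c1 [Hc [Hm [_ [_ Hb]]]]]]]].
    destruct (Hb (S p) x Hx) as [_ [E _]]. rewrite H0 in E. simpl in E.
    assert (Pp : pc al (prodlin p (fun j => g i (S j)))) by (apply (pc_pol al (S p)), pol_prodlin).
    rewrite (RI_ext _ (fun y => (c * c') * (wgt bm bp al y * prodlin p (fun j => g i (S j)) y))) in E.
    + rewrite (pcI_scal al) in E by (apply pc_mult; auto; apply pc_wgt).
      apply Rmult_eq_reg_l with (c * c'); [lra|].
      apply Rmult_integral_contrapositive_currified; auto.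
    + intros y. rewrite Hm, H2 by auto. ring.
Qed.

Lemma pow_le_pow_l (x y : R) (n : nat) : 0 <= x <= y -> 0 <= x ^ n <= y ^ n.
Proof. intros H; split; [apply pow_le; lra|apply pow_incr; auto]. Qed.

Theorem theorem4p2 :
  forall (a b al bm bp gam cr sigma : R) (p : nat),
    a < al < b -> 0 < bm -> 0 < bp -> 0 <= cr -> 0 < sigma -> (2 <= p)%nat ->
  exists C h0 : R, 0 < C /\ 0 < h0 /\
  forall (N k : nat) (X : nat -> R),
    (1 <= N)%nat -> X 0%nat = a -> X N = b ->
    (forall i, (i < N)%nat -> X i < X (S i)) ->
    (1 <= k <= N)%nat -> X (k - 1)%nat < al < X k ->
    (forall i, (1 <= i <= N)%nat -> hmax X N <= sigma * (X i - X (i - 1)%nat)) ->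
    hmax X N <= h0 ->
  let h := hmax X N in
  forall (L : nat -> R -> R), is_gen_legendre bm bp al X k L ->
  forall (g : nat -> nat -> R), is_gauss X N k p L g ->
  forall (u f : R -> R) (Dm Dp : nat -> R -> R) (M : R),
    W_inf_piece a al (2 * p + 1) u Dm M ->
    W_inf_piece al b (2 * p + 1) u Dp M ->
    u a = 0 -> u b = 0 ->
    (forall j, (1 <= j <= 2 * p)%nat -> bp * Dp j al = bm * Dm j al) ->
    (forall x, a < x < al -> f x = - bm * Dm 2%nat x + gam * Dm 1%nat x + cr * Dm 0%nat x) ->
    (forall x, al < x < b -> f x = - bp * Dp 2%nat x + gam * Dp 1%nat x + cr * Dp 0%nat x) ->
  let fu := fun x => if Rle_dec x al then bm * Dm 1%nat x else bp * Dp 1%nat x in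
  forall (cf : nat -> nat -> R),
    in_UT bm bp al X N k p L cf ->
    is_IFV bm bp al X N k p L gam cr f g cf ->
    (* (1) supercloseness *)
    (forall i x, (1 <= i <= N)%nat -> X (i - 1)%nat <= x <= X i ->
       Rabs (loc bm bp al X k p L cf i x - Ih bm bp al X k p L u fu i x)
         <= C * h ^ (p + 2) * M) /\
    (* (2) generalized Lobatto points *)
    (forall i x, (1 <= i <= N)%nat -> X (i - 1)%nat <= x <= X i ->
       lphi bm bp al X k L i (S p) x = 0 ->
       Rabs (u x - loc bm bp al X k p L cf i x) <= C * h ^ (p + 2) * M) /\
    (* (3) flux at Gauss points *)
    (forall i j, (1 <= i <= N)%nat -> (1 <= j <= p)%nat ->
       Rabs (fu (g i j) - fluxT bm bp al X k p L cf i (g i j))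
         <= C * h ^ (p + 1) * M) /\
    (* (4) the case gamma = c = 0 *)
    (gam = 0 -> cr = 0 ->
      (forall i j, (1 <= i <= N)%nat -> (1 <= j <= p)%nat ->
         Rabs (fu (g i j) - fluxT bm bp al X k p L cf i (g i j))
           <= C * h ^ (2 * p) * M) /\
      (forall i, (1 <= i <= N)%nat ->
         Rabs (u (X i) - loc bm bp al X k p L cf i (X i)) <= C * h ^ (2 * p) * M) /\
      (forall i, (1 <= i <= N)%nat ->
         Rabs ((u (X i) - loc bm bp al X k p L cf i (X i))
               - (u (X (i - 1)%nat) - loc bm bp al X k p L cf i (X (i - 1)%nat)))
           <= C * h ^ (2 * p + 1) * M)).
Proof.
  intros a b al bm bp gam cr sigma p Hab Hbm Hbp Hcr Hsig Hp.
  set (wm := / (bm + bp)). set (wM := / bm + / bp).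
  assert (Hwm : 0 < wm) by (apply Rinv_0_lt_compat; lra).
  assert (HwmM : wm <= wM) by (destruct (wgt_bounds bm bp al al Hbm Hbp); unfold wm, wM; lra).
  destruct (element_step p wm wM gam cr Hp Hwm ltac:(lra) Hcr) as [Cs [hs [HCs [Hhs Hstep]]]].
  destruct (discrete_stability gam cr wm wM Cs (b - a) Hcr Hwm HwmM ltac:(lra) ltac:(lra))
    as [Cd [hd [HCd [Hhd Hstab]]]].
  destruct (gauss_element_flux p wm wM ltac:(lia) Hwm ltac:(lra)) as [C2 [HC2 Hflux]].
  set (B := bm + bp). assert (HB : 0 < B) by (unfold B; lra).
  (* The perturbations add up to [Cs * y2 * (b - a)] over all elements, plus one extra [Cs * y2]
     from the interface element. *)
  set (Ca := Cd * Cs * (b - a + 1)).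
  assert (HCa : 0 < Ca) by (unfold Ca; repeat apply Rmult_lt_0_compat; lra).
  set (C1 := Cs * (Ca + 1) * B).
  assert (HC1 : 0 < C1) by (unfold C1; repeat apply Rmult_lt_0_compat; lra).
  set (CK := C2 / wm). assert (HCK : 0 < CK) by (apply Rdiv_lt_0_compat; lra).
  (* [CK] comes from the bound on [K]; the other term covers both a single increment of the nodal
     error and the sum of all increments. *)
  set (C4 := (CK + (CK * wM + C2) * (b - a + 1)) * B).
  assert (HCw : 0 < CK * wM) by (apply Rmult_lt_0_compat; lra).
  assert (HC4' : 0 < (CK * wM + C2) * (b - a + 1)) by (apply Rmult_lt_0_compat; lra).
  assert (HC4 : 0 < C4) by (apply Rmult_lt_0_compat; lra).
  exists (C1 + C4), (Rmin (Rmin hs hd) 1).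
  split; [lra|]. split; [repeat apply Rmin_pos; lra|].
  intros N k X HN HX0 HXN HX Hk Hal _ Hh0 h L HL g Hg u f Dm Dp M HWm HWp Hua Hub Hj Hf1 Hf2 fu cf HUT HIFV.
  fold h in Hh0.
  assert (Hh1 : h <= hs /\ h <= hd /\ h <= 1).
  { assert (A1 := Rmin_l (Rmin hs hd) 1). assert (A2 := Rmin_r (Rmin hs hd) 1).
    assert (A3 := Rmin_l hs hd). assert (A4 := Rmin_r hs hd). lra. }
  destruct (exact_solution a b al bm bp gam cr p u f Dm Dp M Hab Hbm Hbp Hp HWm HWp Hj Hf1 Hf2)
    as [HM [F [U [PF [PU [EU [EF [HT [IF If]]]]]]]]].
  fold B in HT. set (M' := B * M) in *. assert (HM' : 0 <= M') by (apply Rmult_le_pos; lra).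
  assert (EF' : forall x, a <= x <= b -> fu x = F x) by (intros; unfold fu; rewrite EF; auto).
  destruct (error_equations a b al bm bp gam cr N k p X L g u fu f F U cf Hbm Hbp Hp HN HX0 HXN HX
    Hk Hal HL Hg PF PU EU EF' IF If Hua Hub HUT HIFV) as [q [Q [E [Se [K [HE0 [HEN [HS0 Heq]]]]]]]].
  set (w := wgt bm bp al) in *.
  assert (Hlr : forall i, (1 <= i <= N)%nat -> 0 < X i - X (i - 1)%nat <= h).
  { intros i Hi. assert (A := mesh_lt X N i HX Hi). split; [lra|].
    unfold h. replace i with (S (i - 1)) at 1 by lia. apply hmax_ge; lia. }
  assert (Hh : 0 < h) by (destruct (Hlr 1%nat ltac:(lia)); lra).
  assert (Hin : forall i x, (1 <= i <= N)%nat -> X (i - 1)%nat <= x <= X i -> a <= x <= b).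
  { intros i x Hi Hx. assert (A1 := mesh_le X N 0 (i - 1) HX ltac:(lia)).
    assert (A2 := mesh_le X N i N HX ltac:(lia)). lra. }
  assert (Hgin : forall i j, (1 <= i <= N)%nat -> (1 <= j <= p)%nat -> X (i - 1)%nat <= g i j <= X i).
  { intros i j Hi Hj'. apply (Hg i Hi); auto. }
  assert (Hge := fun i => gauss_points_element bm bp al X N k p L g i Hbm Hbp HX Hk Hal HL Hg ltac:(lia)).
  fold w wm wM in Hge.
  assert (Htay : forall i, (1 <= i <= N)%nat -> taylor_approx p (X (i - 1)%nat) (X i) M' F).
  { intros i Hi. assert (A := Hlr i Hi).
    assert (A1 := Hin i (X i) Hi ltac:(lra)). assert (A2 := Hin i (X (i - 1)%nat) Hi ltac:(lra)).
    apply HT; lra. }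
  assert (Hflx : forall i j, (1 <= i <= N)%nat -> (1 <= j <= p)%nat ->
    fu (g i j) - fluxT bm bp al X k p L cf i (g i j) = F (g i j) - q i (g i j)).
  { intros i j Hi Hj'. destruct (Heq i Hi) as [_ [_ [H3 _]]].
    destruct (H3 (g i j) (Hgin i j Hi Hj')) as [-> _].
    rewrite EF'; auto. apply (Hin i); auto. }
  (* Perturbations per unit length in the recursion for [E]: [y1] on the interface element, [y2] on
     the others. *)
  set (y1 := h ^ (p + 1) * M'). set (y2 := h ^ (p + 2) * M').
  assert (Hy12 : 0 <= y2 <= y1 /\ y2 = h * y1).
  { assert (E2 : y2 = h * y1) by (unfold y1, y2; rewrite !pow_add; simpl; ring).
    assert (0 <= y1) by (apply Rmult_le_pos; auto; apply pow_le; lra).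
    rewrite E2. split; [|auto]. split; [apply Rmult_le_pos; lra|nra]. }
  set (av := fun i => Rabs (E i) + Rabs (Se i) + Rabs K).
  assert (Hav0 : forall i, 0 <= av i).
  { intros i; unfold av. assert (A1 := Rabs_pos (E i)). assert (A2 := Rabs_pos (Se i)).
    assert (A3 := Rabs_pos K). lra. }
  assert (Hst : forall i, (1 <= i <= N)%nat ->
    let l := X (i - 1)%nat in let r := X i in let hi := r - l in
    Rabs (E i - E (i - 1)%nat - RI w l r * (gam * E (i - 1)%nat + cr * Se (i - 1)%nat + K)) <=
       Cs * hi * (h * av (i - 1)%nat + (if Nat.eqb i k then y1 else y2)) /\
    Rabs (Se i - Se (i - 1)%nat - hi * E (i - 1)%nat) <= Cs * hi * (h * av (i - 1)%nat + y2) /\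
    (forall x, l <= x <= r -> Rabs (E (i - 1)%nat + RI (fun y => w y * (Q i y - q i y)) l x)
       <= Cs * (av (i - 1)%nat + y2)) /\
    (forall j, (1 <= j <= p)%nat -> Rabs (F (g i j) - q i (g i j)) <= Cs * (av (i - 1)%nat + y1)) /\
    (forall x, l <= x <= r -> lphi bm bp al X k L i (S p) x = 0 ->
       Rabs (elem_err w F X q E i x) <= Cs * (av (i - 1)%nat + y2))).
  { intros i Hi l r hi. destruct (Hge i Hi) as [Hel Hlob].
    destruct (Heq i Hi) as [q1 [Q1 [_ [Horth [HEi [_ [_ [HSi Hgau]]]]]]]].
    destruct (Hlr i Hi) as [Hi1 Hi2]. fold l r hi in Hi1, Hi2.
    destruct (Hstep al l r w (fun j => g i (S j)) F (q i) (Q i) M' (E (i - 1)%nat) (Se (i - 1)%nat) K)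
      as [T1 [T2 [T3 [T4 [T5 T6]]]]];
      [exact Hel|exact PF|exact (Htay i Hi)|exact HM'|exact q1|exact Q1|fold hi; lra|exact Horth| |].
    { intros j Hj'. exact (Hgau (S j) ltac:(lia)). }
    fold hi in T1, T2, T3, T4, T5, T6. fold (av (i - 1)%nat) in T1, T2, T3, T4, T5, T6.
    change (fun x => E (i - 1)%nat + RI (fun y => w y * (F y - q i y)) l x)
      with (elem_err w F X q E i) in T3.
    assert (Z1 : 0 <= hi ^ (p + 1) * M' <= y1).
    { destruct (pow_le_pow_l hi h (p + 1) ltac:(lra)). split; [apply Rmult_le_pos; auto|].
      apply Rmult_le_compat_r; auto. }
    assert (Z2 : 0 <= hi ^ (p + 2) * M' <= y2).
    { destruct (pow_le_pow_l hi h (p + 2) ltac:(lra)). split; [apply Rmult_le_pos; auto|].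
      apply Rmult_le_compat_r; auto. }
    assert (Z3 : hi * av (i - 1)%nat <= h * av (i - 1)%nat) by (apply Rmult_le_compat_r; auto).
    assert (Z4 : 0 <= Cs * hi) by (apply Rmult_le_pos; lra).
    assert (Eerr : E i = E (i - 1)%nat + RI (fun y => w y * (F y - q i y)) l r) by exact HEi.
    repeat split.
    - rewrite Eerr. destruct (Nat.eqb_spec i k) as [Hik|Hik].
      + eapply Rle_trans; [apply T1|]. apply Rmult_le_compat_l; lra.
      + eapply Rle_trans; [apply T2|apply Rmult_le_compat_l; lra].
        intros x Hx. unfold w, wgt. f_equal.
        rewrite !(betaf_bel bm bp al X N k HX Hk Hal i); auto; fold l r; lra.
    - replace (Se i - Se (i - 1)%nat) with (RI (elem_err w F X q E i) l r) by (rewrite HSi; unfold l, r; ring).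
      eapply Rle_trans; [apply T3|]. apply Rmult_le_compat_l; lra.
    - intros x Hx. eapply Rle_trans; [apply T4; auto|]. apply Rmult_le_compat_l; lra.
    - intros j Hj'. assert (A := T5 (j - 1)%nat ltac:(lia)). replace (S (j - 1)) with j in A by lia.
      eapply Rle_trans; [apply A|]. apply Rmult_le_compat_l; lra.
    - intros x Hx Hx0. eapply Rle_trans; [apply (T6 x Hx (Hlob x Hx Hx0))|].
      apply Rmult_le_compat_l; lra. }
  set (hh := fun j => X (S j) - X j). set (om := fun j => RI w (X j) (X (S j))).
  assert (Hsumhh : sumR N hh = b - a) by (unfold hh; rewrite sumR_telescope, HX0, HXN; auto).
  assert (Hom : forall j, (j < N)%nat -> 0 < hh j <= h /\ wm * hh j <= om j <= wM * hh j).
  { intros j Hj'. assert (A := Hlr (S j) ltac:(lia)). replace (S j - 1)%nat with j in A by lia.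
    assert (Pw : pc al w) by apply pc_wgt.
    split; [exact A|]. unfold hh, om. rewrite <- !pcI_const.
    split; (apply (pcI_le al); [lra|auto using pc_const|auto using pc_const|]);
      intros x _; destruct (wgt_bounds bm bp al x Hbm Hbp); auto. }
  assert (Hav : forall i, (i <= N)%nat -> av i <= Ca * y2).
  (* Element [k] has index [k - 1] here. Its perturbation [Cs * hh j * y1] is at most [Cs * y2]: the
     length of this one element makes up for the lost order. *)
  { set (dl := fun j => Cs * y2 * hh j + (if Nat.eqb j (k - 1) then Cs * y2 else 0)).
    replace (Ca * y2) with (Cd * (Cs * y2 * (b - a) + Cs * y2)) by (unfold Ca; ring).
    apply (Hstab N h _ E Se hh om dl K); auto; try lra.
    - unfold dl. rewrite sumR_plus, sumR_scal, Hsumhh, (sumR_single N (k - 1)); [|lia|].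
      + rewrite Nat.eqb_refl; lra.
      + intros i Hi Hne. destruct (Nat.eqb_spec i (k - 1)); [congruence|auto].
    - intros j Hj'. destruct (Hom j Hj') as [O1 O2].
      assert (Z : 0 <= Cs * y2) by (apply Rmult_le_pos; lra).
      assert (Z' : 0 <= Cs * y2 * hh j) by (apply Rmult_le_pos; lra).
      split; auto. split; auto. split.
      { unfold dl. destruct (Nat.eqb j (k - 1)); lra. }
      destruct (Hst (S j) ltac:(lia)) as [S1 [S2 _]].
      replace (S j - 1)%nat with j in S1, S2 by lia. rewrite Nat.add_1_r.
      fold (hh j) (om j) in S1, S2. fold (av j).
      split; [eapply Rle_trans; [apply S1|]|eapply Rle_trans; [apply S2|]].
      + unfold dl. destruct (Nat.eqb_spec (S j) k), (Nat.eqb_spec j (k - 1)); try lia.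
        * assert (Cs * (hh j * y1) <= Cs * (h * y1)).
          { apply Rmult_le_compat_l; [lra|]. apply Rmult_le_compat_r; lra. }
          replace (Cs * y2) with (Cs * (h * y1)) in * by (rewrite (proj2 Hy12); auto). lra.
        * lra.
      + unfold dl. destruct (Nat.eqb j (k - 1)); lra. }
  assert (HCs2 : forall i, (i <= N)%nat -> Cs * (av i + y2) <= (C1 + C4) * h ^ (p + 2) * M).
  { intros i Hi. apply Rle_trans with (Cs * (Ca * y2 + y2)).
    - apply Rmult_le_compat_l; [lra|]. specialize (Hav i Hi). lra.
    - replace (Cs * (Ca * y2 + y2)) with (C1 * (h ^ (p + 2) * M)) by (unfold C1, y2, M'; ring).
      rewrite Rmult_assoc. apply Rmult_le_compat_r; [|lra].
      apply Rmult_le_pos; auto; apply pow_le; lra. }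
  split; [|split; [|split]].
  - intros i x Hi Hx. destruct (Hst i Hi) as [_ [_ [S3 _]]].
    destruct (Heq i Hi) as [_ [_ [H3 _]]]. destruct (H3 x Hx) as [_ [_ ->]].
    rewrite Rabs_Ropp. eapply Rle_trans; [apply S3; auto|]. apply HCs2; lia.
  - intros i x Hi Hx Hx0. destruct (Hst i Hi) as [_ [_ [_ [_ S5]]]].
    destruct (Heq i Hi) as [_ [_ [H3 _]]]. destruct (H3 x Hx) as [_ [-> _]].
    eapply Rle_trans; [apply S5; auto|]. apply HCs2; lia.
  - intros i j Hi Hj'. destruct (Hst i Hi) as [_ [_ [_ [S4 _]]]].
    rewrite Hflx by auto. eapply Rle_trans; [apply S4; auto|].
    apply Rle_trans with (Cs * (Ca * y1 + y1)).
    + apply Rmult_le_compat_l; [lra|]. assert (A := Hav (i - 1)%nat ltac:(lia)).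
      assert (Ca * y2 <= Ca * y1) by (apply Rmult_le_compat_l; lra). lra.
    + replace (Cs * (Ca * y1 + y1)) with (C1 * (h ^ (p + 1) * M)) by (unfold C1, y1, M'; ring).
      rewrite Rmult_assoc. apply Rmult_le_compat_r; [|lra].
      apply Rmult_le_pos; auto; apply pow_le; lra.
  (* Now the Gauss residual is exactly [K], so [gauss_element_flux] applies with [m = 0] and the
     full quadrature order is visible. *)
  - intros Hgam Hcr0. rewrite Hgam, Hcr0 in Heq.
    set (z := h ^ (2 * p) * M'). assert (Hz : 0 <= z) by (apply Rmult_le_pos; auto; apply pow_le; lra).
    assert (HFK : forall i j, (1 <= i <= N)%nat -> (1 <= j <= p)%nat -> F (g i j) - q i (g i j) = K).
    { intros i j Hi Hj'. destruct (Heq i Hi) as [_ [_ [_ [_ [_ [_ [_ [_ Hgau]]]]]]]].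
      rewrite Hgau by auto. ring. }
    assert (Hloc : forall j, (j < N)%nat -> Rabs (E (S j) - E j - K * om j) <= C2 * z * hh j).
    { intros j Hj'. set (i := S j). assert (Hi : (1 <= i <= N)%nat) by (unfold i; lia).
      destruct (Hge i Hi) as [Hel _].
      destruct (Heq i Hi) as [q1 [Q1 [_ [_ [HEi _]]]]].
      assert (Hi2 := Hlr i Hi).
      assert (A := Hflux al (X (i - 1)%nat) (X i) w (fun j => g i (S j)) F (q i) K M' 0 Hel PF
        (Htay i Hi) q1).
      rewrite HEi. unfold elem_err. unfold i in A, Hi2 |- *.
      replace (S j - 1)%nat with j in A, Hi2 |- * by lia.
      replace (E j + RI (fun y => w y * (F y - q (S j) y)) (X j) (X (S j)) - E j - K * om j)
        with (RI (fun y => w y * (F y - q (S j) y)) (X j) (X (S j)) - K * om j) by ring.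
      eapply Rle_trans; [apply A|].
      - intros m Hm. fold i. rewrite HFK by (auto || lia).
        replace (K - K) with 0 by ring. rewrite Rabs_R0; lra.
      - fold (hh j) in Hi2 |- *. rewrite Rplus_0_r.
        assert (hh j ^ (2 * p) * M' <= z).
        { apply Rmult_le_compat_r; auto. apply pow_incr; lra. }
        assert (0 <= C2 * hh j) by (apply Rmult_le_pos; lra). nra. }
    (* Summed over the elements, the increments of [E] telescope to [E N - E 0 = 0], which leaves
       [K] times the total weight, at least [wm * (b - a)]. *)
    assert (HKb : Rabs K <= CK * z).
    { assert (A : Rabs (sumR N (fun j => E (S j) - E j - K * om j)) <= C2 * z * (b - a)).
      { eapply Rle_trans; [apply sumR_abs|]. rewrite <- Hsumhh, <- sumR_scal.
        apply sumR_le; auto. }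
      rewrite (sumR_ext _ _ (fun j => (E (S j) - E j) + - K * om j)), sumR_plus, sumR_telescope,
        sumR_scal, HEN, HE0 in A by (intros; ring).
      replace (0 - 0 + - K * sumR N om) with (- (K * sumR N om)) in A by ring.
      assert (Hso : wm * (b - a) <= sumR N om).
      { rewrite <- Hsumhh, <- sumR_scal. apply sumR_le; intros j Hj'; apply Hom; auto. }
      assert (Hso0 : 0 < wm * (b - a)) by (apply Rmult_lt_0_compat; lra).
      rewrite Rabs_Ropp, Rabs_mult, (Rabs_right (sumR N om)) in A by lra.
      apply Rmult_le_reg_r with (wm * (b - a)); auto.
      replace (CK * z * (wm * (b - a))) with (C2 * z * (b - a)) by (unfold CK; field; lra).
      eapply Rle_trans; [|apply A]. apply Rmult_le_compat_l; auto. apply Rabs_pos. }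
    assert (Hinc : forall j, (j < N)%nat -> Rabs (E (S j) - E j) <= (CK * wM + C2) * z * hh j).
    { intros j Hj'. destruct (Hom j Hj') as [O1 O2].
      replace (E (S j) - E j) with ((E (S j) - E j - K * om j) + K * om j) by ring.
      assert (A0 : 0 < wm * hh j) by (apply Rmult_lt_0_compat; lra).
      eapply Rle_trans; [apply Rabs_triang|]. rewrite Rabs_mult, (Rabs_right (om j)) by lra.
      assert (A1 := Hloc j Hj').
      assert (A2 : Rabs K * om j <= CK * z * (wM * hh j)).
      { apply Rmult_le_compat; auto; [apply Rabs_pos|lra|lra]. }
      lra. }
    assert (HEb : forall i, (i <= N)%nat -> Rabs (E i) <= (CK * wM + C2) * z * (b - a)).
    { intros i Hi. replace (E i) with (sumR i (fun j => E (S j) - E j))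
        by (rewrite sumR_telescope, HE0; ring).
      eapply Rle_trans; [apply sumR_abs|]. rewrite <- Hsumhh, <- sumR_scal.
      eapply Rle_trans; [apply (sumR_le i _ (fun j => (CK * wM + C2) * z * hh j))|].
      - intros j Hj'; apply Hinc; lia.
      - apply sumR_mono; auto. intros j Hj'. destruct (Hom j Hj').
        apply Rmult_le_pos; [|lra]. apply Rmult_le_pos; lra. }
    assert (Hfin : forall c n, 0 <= c -> c * B <= C4 -> c * (h ^ n * M') <= (C1 + C4) * h ^ n * M).
    { intros c n Hc1 Hc2. assert (0 <= h ^ n * M) by (apply Rmult_le_pos; auto; apply pow_le; lra).
      replace (c * (h ^ n * M')) with (c * B * (h ^ n * M)) by (unfold M'; ring).
      rewrite (Rmult_assoc (C1 + C4)). apply Rmult_le_compat_r; lra. }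
    split; [|split].
    + intros i j Hi Hj'. rewrite Hflx, HFK by auto. eapply Rle_trans; [apply HKb|].
      apply Hfin; [lra|]. unfold C4. apply Rmult_le_compat_r; lra.
    + intros i Hi. destruct (Heq i Hi) as [_ [_ [_ [_ [_ [<- _]]]]]].
      eapply Rle_trans; [apply HEb; lia|].
      replace ((CK * wM + C2) * z * (b - a)) with ((CK * wM + C2) * (b - a) * z) by ring.
      apply Hfin; [apply Rmult_le_pos; lra|]. unfold C4. apply Rmult_le_compat_r; lra.
    + intros i Hi. destruct (Heq i Hi) as [_ [_ [_ [_ [_ [<- [<- _]]]]]]].
      assert (A := Hinc (i - 1)%nat ltac:(lia)). destruct (Hom (i - 1)%nat ltac:(lia)) as [O1 _].
      replace (S (i - 1)) with i in A by lia.
      eapply Rle_trans; [apply A|].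
      apply Rle_trans with ((CK * wM + C2) * (h ^ (2 * p + 1) * M')).
      * replace (h ^ (2 * p + 1) * M') with (z * h) by (unfold z; rewrite pow_add; simpl; ring).
        rewrite Rmult_assoc. apply Rmult_le_compat_l; [lra|]. apply Rmult_le_compat_l; lra.
      * apply Hfin; [lra|]. unfold C4. apply Rmult_le_compat_r; [lra|].
        assert (0 <= (CK * wM + C2) * (b - a)) by (apply Rmult_le_pos; lra). lra.
Qed.
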